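(* Let $G=\langle g_i : i\in I\rangle$ be a rational semigroup generated by the nonconstant rational maps $\{g_i : i \in I\}$ ($I$ an arbitrary index set), and assume $G$ is non-elementary. Suppose there is a constant $C<+\infty$ with $\operatorname{Lip} g_i \le C$ for all $i\in I$. Then the Julia set $J(G)$ is uniformly perfect.
   Context: A rational semigroup is a semigroup of nonconstant rational functions on the Riemann sphere $\overline{\mathbb{C}}$ under composition; $\langle g_i : i\in I\rangle$ denotes the semigroup generated by the $g_i$ (all finite compositions of them). No restriction on degrees is made (degree-one maps are allowed). The Fatou set $N(G)$ is the set of $z\in\overline{\mathbb{C}}$ having a neighborhood on which $G$ is a normal family, and the Julia set is $J(G)=\overline{\mathbb{C}}\setminus N(G)$. $G$ is called non-elementary if $J(G)$ contains at least three points. For a rational map $g$, $\operatorname{Lip} g=\inf\{M : \sigma(g(z),g(w))\le M\sigma(z,w)\ \text{for all } z,w\in\overline{\mathbb{C}}\}$, where $\sigma$ is the spherical metric. A conformal annulus is an open set $\mathcal{A}\subset\overline{\mathbb{C}}$ conformally equivalent to some $\{z : r_1<|z|<r_2\}$ with $0\le r_1<r_2\le\infty$; its modulus is $\frac{1}{2\pi}\log(r_2/r_1)$. A conformal annulus $\mathcal{A}$ separates a set $F$ if $F\cap\mathcal{A}=\emptyset$ and $F$ meets both components of $\overline{\mathbb{C}}\setminus\mathcal{A}$. A compact set $F\subset\overline{\mathbb{C}}$ is uniformly perfect if it has at least two points and there is a uniform upper bound on the moduli of all conformal annuli in $\overline{\mathbb{C}}\setminus F$ that separate $F$. *)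

(* Defs.v *)
From HB Require Import structures.
From mathcomp Require Import all_boot all_order all_algebra.
From mathcomp Require Import boolp classical_sets cardinality reals constructive_ereal ereal exp trigo.
From mathcomp.real_closed Require Import complex.

Set Implicit Arguments.
Unset Strict Implicit.
Unset Printing Implicit Defensive.

Import Order.TTheory GRing.Theory Num.Theory.
Local Open Scope ring_scope.
Local Open Scope classical_set_scope.

Section RiemannSphere.
Variable R : realType.

Local Notation C := (R[i]).
Local Notation normc := (@Normc.normc R).

(* The Riemann sphere: [Some z] is the finite point z, [None] is infinity. *)
Definition sphere := option C.

(* chordal distance on the unit-diameter-2 sphere (stereographic projection) *)
Definition chordal (p q : sphere) : R :=
  match p, q with
  | Some z, Some w =>
      2 * normc (z - w) / Num.sqrt ((1 + normc z ^+ 2) * (1 + normc w ^+ 2))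
  | Some z, None | None, Some z => 2 / Num.sqrt (1 + normc z ^+ 2)
  | None, None => 0
  end.

(* the spherical (great-circle) metric sigma *)
Definition sigma (p q : sphere) : R := 2 * asin (chordal p q / 2).

(* rational function P/Q acting on the sphere (P, Q coprime, Q != 0) *)
Definition ratmap (P Q : {poly C}) (p : sphere) : sphere :=
  match p with
  | Some z => if Q.[z] == 0 then None else Some (P.[z] / Q.[z])
  | None =>
      if (size Q < size P)%N then None
      else if size P == size Q then Some (lead_coef P / lead_coef Q)
      else Some 0
  end.

Definition is_rational_map (f : sphere -> sphere) : Prop :=
  exists P Q : {poly C}, Q != 0 /\ coprimep P Q /\ forall p, f p = ratmap P Q p.

Definition nonconstant (f : sphere -> sphere) : Prop :=
  exists p q, f p <> f q.

(* Lip g = inf { M : sigma(g z, g w) <= M sigma(z, w) for all z, w }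
   (taken in the extended reals, so that inf of the empty set is +oo) *)
Definition Lip (f : sphere -> sphere) : \bar R :=
  ereal_inf [set M%:E | M in
    [set M : R | forall z w, sigma (f z) (f w) <= M * sigma z w]].

Inductive semigroup (I : Type) (g : I -> sphere -> sphere) :
    (sphere -> sphere) -> Prop :=
  | sg_gen i : semigroup g (g i)
  | sg_comp f h : semigroup g f -> semigroup g h -> semigroup g (f \o h).

Definition sball (p : sphere) (r : R) : set sphere := [set q | sigma p q < r].

Definition sopen (U : set sphere) : Prop :=
  forall p, U p -> exists2 r : R, 0 < r & sball p r `<=` U.

Definition scompact (F : set sphere) : Prop :=
  forall (J : Type) (U : J -> set sphere), (forall j, sopen (U j)) ->
    F `<=` \bigcup_(j in setT) U j ->
    exists D : set J, finite_set D /\ F `<=` \bigcup_(j in D) U j.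

Definition sconnected (S : set sphere) : Prop :=
  forall U V, sopen U -> sopen V -> S `<=` U `|` V ->
    S `&` U `&` V = set0 -> S `&` U !=set0 -> S `&` V !=set0 -> False.

Definition same_component (S : set sphere) (x y : sphere) : Prop :=
  exists K, K `<=` S /\ sconnected K /\ K x /\ K y.

Definition normal_on (F : set (sphere -> sphere)) (U : set sphere) : Prop :=
  forall h : nat -> sphere -> sphere, (forall n, F (h n)) ->
  exists (s : nat -> nat) (phi : sphere -> sphere),
    (forall n, (s n < s n.+1)%N) /\
    forall p, U p -> exists r : R, 0 < r /\ sball p r `<=` U /\
      forall eps : R, 0 < eps -> exists N : nat, forall n, (N <= n)%N ->
        forall q, sball p r q -> sigma (h (s n) q) (phi q) < eps.

Definition fatou (F : set (sphere -> sphere)) : set sphere :=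
  [set p | exists2 r : R, 0 < r & normal_on F (sball p r)].

Definition julia (F : set (sphere -> sphere)) : set sphere := ~` fatou F.

Definition non_elementary (F : set (sphere -> sphere)) : Prop :=
  exists a b c, julia F a /\ julia F b /\ julia F c /\
    a <> b /\ b <> c /\ a <> c.

Definition round_annulus (r1 : R) (r2 : \bar R) : set C :=
  [set z | r1 < normc z /\ ((normc z)%:E < r2)%E].

Definition cdiff_at (f : C -> C) (z0 : C) : Prop :=
  exists l : C, forall eps : R, 0 < eps -> exists2 d : R, 0 < d &
    forall h : C, 0 < normc h < d ->
      normc (f (z0 + h) - f z0 - l * h) <= eps * normc h.

(* holomorphy of phi : sphere -> C at the points of A, in the charts
   z |-> z (finite points) and z |-> 1/z (infinity) *)
Definition holo_on (A : set sphere) (phi : sphere -> C) : Prop :=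
  forall p, A p ->
    match p with
    | Some z0 => cdiff_at (fun u => phi (Some u)) z0
    | None => cdiff_at (fun u => phi (if u == 0 then None else Some u^-1)) 0
    end.

Definition conformal_annulus (A : set sphere) (r1 : R) (r2 : \bar R) : Prop :=
  sopen A /\ 0 <= r1 /\ (r1%:E < r2)%E /\
  exists phi : sphere -> C,
    holo_on A phi /\ {in A &, injective phi} /\ phi @` A = round_annulus r1 r2.

Definition modulus (r1 : R) (r2 : \bar R) : \bar R :=
  if (r1 == 0) || (r2 == +oo%E) then +oo%E
  else (ln (fine r2 / r1) / (2 * pi))%:E.

(* A separates F: F misses A and meets both components of the complement *)
Definition separates (A F : set sphere) : Prop :=
  F `&` A = set0 /\
  exists x y, F x /\ F y /\ ~ same_component (~` A) x y.

Definition uniformly_perfect (F : set sphere) : Prop :=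
  scompact F /\ (exists x y, F x /\ F y /\ x <> y) /\
  exists M : R, forall (A : set sphere) (r1 : R) (r2 : \bar R),
    conformal_annulus A r1 r2 -> A `<=` ~` F -> separates A F ->
    (modulus r1 r2 <= M%:E)%E.

End RiemannSphere.

(* Main.v *)
(* Let a, b, c be three points of the Julia set J and let psi map a round annulus
   conformally onto an annulus A that separates J.  Every g in G maps A into the
   Fatou set, so g o psi omits a, b and c.  Comparing its pullback of a metric of
   curvature at most -k < 0 on the sphere minus {a, b, c} with the hyperbolic metric of
   the annulus (Ahlfors' lemma) shows that g maps the core curve of A onto a set of
   chordal diameter O(1 / modulus), uniformly in g.  Suppose that the modulus is
   huge.  The core curve cuts the sphere into two open sets, both of which meet J,
   and one of them, W, is small.  For every g the boundary of g(W) lies in the small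
   set g(core), so g(W) is either small or contains all points away from g(core);
   by the uniform Lipschitz bound a generator cannot turn a small set into one of
   the second kind, so by induction all g(W) are small.  Then G is equicontinuous
   on W by Cauchy's estimates, hence normal there, although W meets J. *)
From HB Require Import structures.
From mathcomp Require Import all_boot all_order all_algebra.
From mathcomp Require Import boolp classical_sets cardinality reals constructive_ereal ereal exp trigo.
From mathcomp.real_closed Require Import complex.
From mathcomp Require Import ring lra.
From mathcomp Require Import topology normedtype sequences measure lebesgue_measure lebesgue_integral derive realfun ftc.
Require Import Defs.
Import Order.TTheory GRing.Theory Num.Theory numFieldNormedType.Exports.
Local Open Scope ring_scope.
Local Open Scope classical_set_scope.
Set Implicit Arguments.
Unset Strict Implicit.
Unset Printing Implicit Defensive.

(** The Lipschitz bound degrades exponentially along a word, so it is never iterated: after each new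
    outer letter the core estimate, whose bound is the same for all words, restores the original
    size. The size [e] = 1 / (8 M), with M a chordal Lipschitz constant of the generators, leaves
    room for one letter, and the bound on the modulus is the one that brings the core estimate down
    to [e]. Metrics are compared through the logarithm of their quotient: the sum of four
    surrounding values minus four times the central one is at most 0 at a maximum, and second order
    expansions at one point evaluate it. On the annulus the density 1 / (|w| (H^2 - t^2)), t = ln
    |w| - s0, stands in for the hyperbolic one: it also blows up at both ends. The maximum principle
    carries the rest of the function theory. It comes from Goursat's theorem for difference
    quotients of f^n, tolerates points of mere continuity, and yields removability, derivative
    estimates, open mapping and local inverses. Distances are chordal, because homogeneous
    coordinates make that metric algebraic, also at infinity. *)

Section ComplexModulus.
Variable R : realType.
Local Notation C := (R[i]).
Local Notation nm := (@Normc.normc R).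

Lemma nm_ge0 (z : C) : 0 <= nm z.
Proof. by case: z => a b; exact: sqrtr_ge0. Qed.

Lemma nm0 : nm 0 = 0. Proof. exact: Normc.normc0. Qed.
Lemma nm1 : nm 1 = 1. Proof. exact: Normc.normc1. Qed.

Lemma nm0_eq0 (z : C) : nm z = 0 -> z = 0. Proof. exact: Normc.eq0_normc. Qed.

Lemma nm_eq0 (z : C) : (nm z == 0) = (z == 0).
Proof. by apply/eqP/eqP => [/nm0_eq0//|->]; rewrite nm0. Qed.

Lemma nm_gt0 (z : C) : (0 < nm z) = (z != 0).
Proof. by rewrite lt_neqAle nm_ge0 andbT eq_sym nm_eq0. Qed.

Lemma nmD (x y : C) : nm (x + y) <= nm x + nm y.
Proof. exact: le_normcD. Qed.

Lemma nmN (x : C) : nm (- x) = nm x. Proof. exact: normcN. Qed.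

Lemma nmM (x y : C) : nm (x * y) = nm x * nm y. Proof. exact: Normc.normcM. Qed.

Lemma nmV (x : C) : nm x^-1 = (nm x)^-1. Proof. exact: Normc.normcV. Qed.

Lemma nmX (x : C) n : nm (x ^+ n) = nm x ^+ n.
Proof. by elim: n => [|n IH]; rewrite ?expr0 ?nm1 // !exprS nmM IH. Qed.

Lemma nm_dist (x y : C) : nm (x - y) = nm (y - x).
Proof. by rewrite -nmN opprB. Qed.

Lemma nmB (x y : C) : nm (x - y) <= nm x + nm y.
Proof. by rewrite -[nm y]nmN; exact: nmD. Qed.

Lemma nm_tri (y x z : C) : nm (x - z) <= nm (x - y) + nm (y - z).
Proof. by have := nmD (x - y) (y - z); rewrite addrA subrK. Qed.

Lemma nm_lower (x y : C) : nm x - nm y <= nm (x - y).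
Proof. by rewrite lerBlDr; have := nmD (x - y) y; rewrite subrK. Qed.

Lemma nm_real (x : R) : nm (x%:C)%C = `|x|.
Proof. by rewrite /Normc.normc /= expr0n /= addr0 sqrtr_sqr. Qed.

Lemma nm_sq (z : C) : nm z ^+ 2 = complex.Re z ^+ 2 + complex.Im z ^+ 2.
Proof. by case: z => a b /=; rewrite sqr_sqrtr // addr_ge0 // sqr_ge0. Qed.

Lemma Re_le_nm (z : C) : `|complex.Re z| <= nm z.
Proof.
rewrite -(ler_pXn2r (n := 2)) ?nnegrE ?nm_ge0 // nm_sq -normrX.
by rewrite ger0_norm ?sqr_ge0 // lerDl sqr_ge0.
Qed.

Lemma Im_le_nm (z : C) : `|complex.Im z| <= nm z.
Proof.
rewrite -(ler_pXn2r (n := 2)) ?nnegrE ?nm_ge0 // nm_sq -normrX.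
by rewrite ger0_norm ?sqr_ge0 // lerDr sqr_ge0.
Qed.

Lemma nm_le_ReIm (z : C) : nm z <= `|complex.Re z| + `|complex.Im z|.
Proof.
rewrite -(ler_pXn2r (n := 2)) ?nnegrE ?nm_ge0 ?addr_ge0 // nm_sq.
by rewrite -(real_normK (num_real (complex.Re z)))
  -(real_normK (num_real (complex.Im z))); have := normr_ge0 (complex.Re z);
  have := normr_ge0 (complex.Im z); nra.
Qed.

Lemma ReD (x y : C) : complex.Re (x + y) = complex.Re x + complex.Re y.
Proof. by case: x; case: y. Qed.
Lemma ImD (x y : C) : complex.Im (x + y) = complex.Im x + complex.Im y.
Proof. by case: x; case: y. Qed.
Lemma ReN (x : C) : complex.Re (- x) = - complex.Re x. Proof. by case: x. Qed.
Lemma ImN (x : C) : complex.Im (- x) = - complex.Im x. Proof. by case: x. Qed.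
Lemma ReM (x y : C) : complex.Re (x * y) =
  complex.Re x * complex.Re y - complex.Im x * complex.Im y.
Proof. by case: x; case: y. Qed.
Lemma ImM (x y : C) : complex.Im (x * y) =
  complex.Re x * complex.Im y + complex.Im x * complex.Re y.
Proof. by case: x; case: y. Qed.

Lemma ReImP (x y : C) :
  complex.Re x = complex.Re y -> complex.Im x = complex.Im y -> x = y.
Proof. by case: x => a b; case: y => c d /= -> ->. Qed.

Lemma nm_i : nm (0 +i* 1)%C = 1.
Proof. by rewrite /Normc.normc /= expr0n /= add0r expr1n sqrtr1. Qed.

End ComplexModulus.

(** * Induction on the unit interval, and bisection of rectangles *)

Section RealLine.
Variable R : realType.

(** Let m be the supremum of the t such that P holds on [0, t]. The limit hypothesis gives P at m
    and the step hypothesis carries P beyond m, which is absurd if P fails somewhere later. *)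
Lemma real_induction (P : R -> Prop) : P 0 ->
  (forall t, 0 <= t < 1 -> (forall s, 0 <= s <= t -> P s) ->
     exists2 d, 0 < d & forall s, t < s < t + d -> s <= 1 -> P s) ->
  (forall t, 0 < t <= 1 -> (forall s, 0 <= s < t -> P s) -> P t) ->
  forall t, 0 <= t <= 1 -> P t.
Proof.
move=> P0 Pr Pl t0 t01; apply: contrapT => nPt0.
pose A := [set t : R | 0 <= t <= 1 /\ forall s, 0 <= s <= t -> P s].
have A0 : A 0.
  split; first lra.
  by move=> s s0; have -> : s = 0 by lra.
have supA : has_sup A.
  by split; [exists 0 | exists 1 => x [? _]; lra].
pose m := sup A.
have m0 : 0 <= m by exact: (ub_le_sup supA.2 A0).
have mt0 : m <= t0.
  apply: ge_sup; first by exists 0.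
  move=> x [x01 Px]; rewrite leNgt; apply/negP => t0x; apply: nPt0.
  apply: Px; lra.
have Pm' s : 0 <= s < m -> P s.
  move=> /andP[s0 sm].
  have [x [x01 Px] sx] := @sup_adherent R A (m - s) ltac:(lra) supA.
  apply: Px; move: sx; rewrite -/m; lra.
have Pm : forall s, 0 <= s <= m -> P s.
  have Pm : P m.
    have [<-//|mn0] := eqVneq 0 m.
    by apply: Pl => //; move: (m0); rewrite le_eqVlt (negbTE mn0) /=; lra.
  by move=> s sm; have [->//|sm'] := eqVneq s m; apply: Pm';
     move: sm; rewrite le_eqVlt [s <= m]le_eqVlt (negbTE sm') /=; lra.
have mt : m < t0.
  rewrite lt_neqAle mt0 andbT; apply/negP => /eqP E.
  by apply: nPt0; rewrite -E; apply: Pm; lra.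
have [d d0 Pd] := Pr m ltac:(lra) Pm.
pose u := m + Num.min (d / 2) (t0 - m).
have um : m < u by rewrite /u ltrDl lt_min; lra.
have ud : u <= m + d / 2 by rewrite /u lerD2l ge_min lexx.
have ut : u <= t0 by rewrite /u addrC -lerBrDr ge_min lexx orbT.
have : A u.
  split; first lra.
  move=> s su; have [sm|ms] := leP s m; first by apply: Pm; lra.
  apply: Pd; lra.
by move/(ub_le_sup supA.2); rewrite -/m; lra.
Qed.

Lemma unit_connected (P : R -> Prop) : P 0 ->
  (forall t, 0 <= t <= 1 -> P t ->
     exists2 d, 0 < d & forall s, 0 <= s <= 1 -> `|s - t| < d -> P s) ->
  (forall t, 0 <= t <= 1 -> ~ P t ->
     exists2 d, 0 < d & forall s, 0 <= s <= 1 -> `|s - t| < d -> ~ P s) ->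
  forall t, 0 <= t <= 1 -> P t.
Proof.
move=> P0 Po Pc; apply: real_induction => //.
  move=> t t01 Pt; have [|d d0 Pd] := Po t ltac:(lra) (Pt t _); first lra.
  by exists d => // s std s1; apply: Pd; [lra|rewrite ger0_norm; lra].
move=> t t01 Pt; apply: contrapT => /(Pc t ltac:(lra))[d d0 Pd].
pose s := Num.max 0 (t - d / 2).
have s0 : 0 <= s by rewrite le_max lexx.
have st : s < t by rewrite gt_max; lra.
have sd : t - d / 2 <= s by rewrite le_max lexx orbT.
by apply: (Pd s); [lra|rewrite ler0_norm; lra|apply: Pt; lra].
Qed.

(** The local bound compares f only with its value at the centre t, and real induction chains these
    comparisons. The gauge d may be signed and asymmetric, because [isint_Im] uses it, through
    [isint_lower], for a difference of imaginary parts. *)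
Lemma mean_value_ineq (X : Type) (d : X -> X -> R) (f : R -> X) (M : R) :
  (forall x y z, d x z <= d x y + d y z) ->
  (forall x, d x x = 0) ->
  (forall t, 0 <= t <= 1 -> exists2 e, 0 < e & forall s, 0 <= s <= 1 ->
     `|s - t| < e -> (s <= t -> d (f s) (f t) <= M * (t - s)) /\
                     (t <= s -> d (f t) (f s) <= M * (s - t))) ->
  d (f 0) (f 1) <= M.
Proof.
move=> tri dd loc.
suff H : forall t, 0 <= t <= 1 -> d (f 0) (f t) <= M * t.
  by have := H 1; rewrite mulr1; apply; lra.
apply: real_induction; first by rewrite dd mulr0.
  move=> t t01 Pt; have [e e0 He] := loc t ltac:(lra).
  exists e => // s ste s1; have := He s ltac:(lra).
  rewrite ger0_norm; last lra.
  move=> /(_ ltac:(lra)) [_ /(_ ltac:(lra)) h]; apply: (le_trans (tri _ (f t) _)).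
  by have := Pt t ltac:(lra); lra.
move=> t t01 Pt; have [e e0 He] := loc t ltac:(lra).
pose s := Num.max 0 (t - e / 2).
have s0 : 0 <= s by rewrite le_max lexx.
have st : s < t by rewrite gt_max; lra.
have sd : t - e / 2 <= s by rewrite le_max lexx orbT.
have := He s ltac:(lra); rewrite ler0_norm; last lra.
move=> /(_ ltac:(lra)) [/(_ ltac:(lra)) h _]; apply: (le_trans (tri _ (f s) _)).
by have := Pt s ltac:(lra); lra.
Qed.

Lemma half_pow_small (w e : R) : 0 < e -> exists n, w / 2 ^+ n < e.
Proof.
move=> e0.
have := archi_boundP (normr_ge0 (w / e)); set k := Num.bound _ => hk.
exists k; rewrite ltr_pdivrMr ?exprn_gt0 // mulrC -ltr_pdivrMr //.
apply: le_lt_trans (ler_norm _) _; apply: (lt_le_trans hk).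
rewrite -natrX ler_nat; exact: ltnW (ltn_expl _ _).
Qed.

(* [P x y w h] speaks of the rectangle with lower left corner (x, y), width w and
   height h. *)
Lemma cousin (x0 y0 w0 h0 : R) (P : R -> R -> R -> R -> Prop) :
  0 <= w0 -> 0 <= h0 ->
  (forall x y w h, 0 <= w -> 0 <= h -> x0 <= x -> x + w <= x0 + w0 ->
     y0 <= y -> y + h <= y0 + h0 ->
     P x y (w / 2) (h / 2) -> P (x + w / 2) y (w / 2) (h / 2) ->
     P x (y + h / 2) (w / 2) (h / 2) -> P (x + w / 2) (y + h / 2) (w / 2) (h / 2) ->
     P x y w h) ->
  (forall X Y, x0 <= X <= x0 + w0 -> y0 <= Y <= y0 + h0 ->
     exists2 d, 0 < d & forall x y w h, 0 <= w < d -> 0 <= h < d ->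
       x <= X <= x + w -> y <= Y <= y + h -> x0 <= x -> x + w <= x0 + w0 ->
     y0 <= y -> y + h <= y0 + h0 -> P x y w h) ->
  P x0 y0 w0 h0.
Proof.
move=> w00 h00 split loc; apply: contrapT => nP.
pose W n := w0 / 2 ^+ n; pose H n := h0 / 2 ^+ n.
have W2 n : W n.+1 = W n / 2 by rewrite /W exprS invfM mulrA mulrAC.
have H2 n : H n.+1 = H n / 2 by rewrite /H exprS invfM mulrA mulrAC.
have W0 n : 0 <= W n by rewrite divr_ge0 // exprn_ge0.
have H0 n : 0 <= H n by rewrite divr_ge0 // exprn_ge0.
(* If P fails on a rectangle, it fails on one of its quarters. A state (n, x, y) records the depth
   and the lower left corner of a failing rectangle; the corners increase to a common point of all
   of them, where the local hypothesis is contradicted at a large depth. *)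
pose Q (s : nat * R * R) := [/\ x0 <= s.1.2, s.1.2 + W s.1.1 <= x0 + w0, y0 <= s.2,
   s.2 + H s.1.1 <= y0 + h0 & ~ P s.1.2 s.2 (W s.1.1) (H s.1.1)].
pose T (s t : nat * R * R) := [/\ t.1.1 = s.1.1.+1, s.1.2 <= t.1.2,
  t.1.2 + W t.1.1 <= s.1.2 + W s.1.1,
  s.2 <= t.2 & t.2 + H t.1.1 <= s.2 + H s.1.1].
have step s : exists t, Q s -> T s t /\ Q t.
  have [Qs|] := pselect (Q s); last by move=> ?; exists s.
  case: s Qs => [[n x] y] [/= qx1 qx2 qy1 qy2 np].
  have wn := W0 n; have hn := H0 n.
  suff : exists x' y', [/\ x <= x', x' + W n.+1 <= x + W n, y <= y',
     y' + H n.+1 <= y + H n & ~ P x' y' (W n.+1) (H n.+1)].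
    move=> [x' [y' [a b c d e]]]; exists (n.+1, x', y') => _.
    split; split => //=; lra.
  apply: contrapT => no; apply: np.
  have no' x' y' : x <= x' -> x' + W n.+1 <= x + W n -> y <= y' ->
     y' + H n.+1 <= y + H n -> P x' y' (W n / 2) (H n / 2).
    move=> a b c d; apply: contrapT => np; apply: no; exists x', y'.
    by split=> //; rewrite W2 H2.
  apply: split => //; apply: no'; rewrite ?W2 ?H2; lra.
have [nxt nxtP] := choice step.
pose s n := iter n nxt (0%N, x0, y0).
have Q0 : Q (0%N, x0, y0).
  by rewrite /Q /W /H /= expr0 !divr1; split.
have Qs n : Q (s n).
  by elim: n => // n IH; have [_] := nxtP _ IH.
have Ts n : T (s n) (s n.+1) by have [] := nxtP _ (Qs n).
have sn n : (s n).1.1 = n.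
  by elim: n => // n IH; have [-> *] := Ts n; rewrite IH.
pose x n := (s n).1.2; pose y n := (s n).2.
have xm n k : x n <= x (n + k)%N /\ x (n + k)%N + W (n + k)%N <= x n + W n.
  elim: k => [|k [IH1 IH2]]; first by rewrite addn0.
  have [_ h1 h2 _ _] := Ts (n + k)%N; rewrite !sn in h2.
  by rewrite addnS; split; [exact: le_trans h1|exact: le_trans IH2].
have ym n k : y n <= y (n + k)%N /\ y (n + k)%N + H (n + k)%N <= y n + H n.
  elim: k => [|k [IH1 IH2]]; first by rewrite addn0.
  have [_ _ _ h1 h2] := Ts (n + k)%N; rewrite !sn in h2.
  by rewrite addnS; split; [exact: le_trans h1|exact: le_trans IH2].
have xb n m : x m <= x n + W n.
  have [/subnKC E|/ltnW/subnKC E] := leqP n m.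
    by have [_] := xm n (m - n)%N; rewrite E; have := W0 m; lra.
  by have [] := xm m (n - m)%N; rewrite E; have := W0 n; lra.
have yb n m : y m <= y n + H n.
  have [/subnKC E|/ltnW/subnKC E] := leqP n m.
    by have [_] := ym n (m - n)%N; rewrite E; have := H0 m; lra.
  by have [] := ym m (n - m)%N; rewrite E; have := H0 n; lra.
have Xn n : x n <= sup (range x) <= x n + W n.
  apply/andP; split.
    by apply: ub_le_sup; [exists (x 0%N + W 0%N) => _ [m _ <-]|exists n].
  by apply: ge_sup; [exists (x 0%N); exists 0%N|move=> _ [m _ <-]].
have Yn n : y n <= sup (range y) <= y n + H n.
  apply/andP; split.
    by apply: ub_le_sup; [exists (y 0%N + H 0%N) => _ [m _ <-]|exists n].
  by apply: ge_sup; [exists (y 0%N); exists 0%N|move=> _ [m _ <-]].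
have [||d d0 Pd] := loc (sup (range x)) (sup (range y)).
- by have := Xn 0%N; rewrite /W /x /= expr0 divr1.
- by have := Yn 0%N; rewrite /H /y /= expr0 divr1.
have [n hn] := half_pow_small (Num.max w0 h0) d0.
have [q1 q2 q3 q4] := Qs n; rewrite sn in q2 q4 *; apply; rewrite -/(x n) -/(y n) in q1 q2 q3 q4 *.
have wn : W n < d.
  by apply: le_lt_trans hn; rewrite ler_pM2r ?invr_gt0 ?exprn_gt0 // le_max lexx.
have hhn : H n < d.
  by apply: le_lt_trans hn; rewrite ler_pM2r ?invr_gt0 ?exprn_gt0 // le_max lexx orbT.
by apply: Pd => //; rewrite ?W0 ?H0.
Qed.

End RealLine.

(** * Continuity at a point, for maps between sets with a distance function *)

Section Continuity.
Variable R : realType.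
Local Notation C := (R[i]).
Local Notation nm := (@Normc.normc R).

Definition dC (z w : C) : R := nm (z - w).
Definition dR (x y : R) : R := `|x - y|.

(** The distances are parameters, so that the line, the plane and the sphere with its chordal
    distance share the same lemmas. *)
Definition mcont (X Y : Type) (dX : X -> X -> R) (dY : Y -> Y -> R) (f : X -> Y)
  (x : X) := forall e, 0 < e -> exists2 d, 0 < d &
    forall y, dX x y < d -> dY (f x) (f y) < e.

Lemma dCC (x y : C) : dC x y = dC y x. Proof. exact: nm_dist. Qed.
Lemma dCxx (x : C) : dC x x = 0. Proof. by rewrite /dC subrr nm0. Qed.
Lemma dRxx (x : R) : dR x x = 0. Proof. by rewrite /dR subrr normr0. Qed.
Lemma dRC (x y : R) : dR x y = dR y x. Proof. exact: distrC. Qed.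

Section Generic.
Variables (X : Type) (dX : X -> X -> R).
Implicit Types (f g : X -> C) (x : X).

Lemma mcont_comp (Y Z : Type) (dY : Y -> Y -> R) (dZ : Z -> Z -> R)
    (f : X -> Y) (g : Y -> Z) x :
  mcont dX dY f x -> mcont dY dZ g (f x) -> mcont dX dZ (fun y => g (f y)) x.
Proof.
move=> cf cg e e0; have [d d0 hd] := cg e e0; have [d' d'0 hd'] := cf d d0.
by exists d' => // y /hd' /hd.
Qed.

Lemma mcont_near (Y : Type) (dY : Y -> Y -> R) (f g : X -> Y) x :
  f x = g x -> (exists2 d, 0 < d & forall y, dX x y < d -> f y = g y) ->
  mcont dX dY f x -> mcont dX dY g x.
Proof.
move=> fgx [d d0 fg] cf e e0; have [d' d'0 h] := cf e e0.
exists (Num.min d d'); first by rewrite lt_min d0.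
by move=> y; rewrite lt_min => /andP[yd yd']; rewrite -fgx -fg //; exact: h.
Qed.

Lemma ccont_cst c x : mcont dX dC (fun=> c) x.
Proof. by move=> e e0; exists 1 => // y _; rewrite dCxx. Qed.

Lemma ccontD f g x : mcont dX dC f x -> mcont dX dC g x ->
  mcont dX dC (fun y => f y + g y) x.
Proof.
move=> cf cg e e0; have [d d0 h] := cf (e / 2) ltac:(lra).
have [d' d'0 h'] := cg (e / 2) ltac:(lra).
exists (Num.min d d'); first by rewrite lt_min d0.
move=> y; rewrite lt_min => /andP[/h hf /h' hg].
have := nmD (f x - f y) (g x - g y); rewrite /dC in hf hg *.
rewrite opprD addrACA; lra.
Qed.

Lemma ccontN f x : mcont dX dC f x -> mcont dX dC (fun y => - f y) x.
Proof.
move=> cf e e0; have [d d0 h] := cf e e0; exists d => // y /h.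
by rewrite /dC -opprD nmN.
Qed.

Lemma ccontB f g x : mcont dX dC f x -> mcont dX dC g x ->
  mcont dX dC (fun y => f y - g y) x.
Proof. by move=> cf cg; apply: ccontD => //; exact: ccontN. Qed.

Lemma ccontM f g x : mcont dX dC f x -> mcont dX dC g x ->
  mcont dX dC (fun y => f y * g y) x.
Proof.
move=> cf cg e e0.
pose A := nm (f x) + 1; pose B := nm (g x) + 1.
have A0 : 0 < A by have := nm_ge0 (f x); rewrite /A; lra.
have B0 : 0 < B by have := nm_ge0 (g x); rewrite /B; lra.
have [d d0 h] := cf (Num.min 1 (e / 2 / B)) ltac:(by rewrite lt_min ltr01 !divr_gt0).
have [d' d'0 h'] := cg (e / 2 / A) ltac:(by rewrite !divr_gt0).
exists (Num.min d d'); first by rewrite lt_min d0.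
move=> y; rewrite lt_min => /andP[/h + /h' hg]; rewrite lt_min => /andP[hf1 hf].
have -> : dC (f x * g x) (f y * g y) = nm ((f x - f y) * g x + f y * (g x - g y)).
  by rewrite /dC; congr nm; ring.
apply: (le_lt_trans (nmD _ _)); rewrite !nmM -!/(dC _ _).
have fy : nm (f y) <= A.
  have := nm_lower (f y) (f x); rewrite -[nm (_ - _)]/(dC _ _) dCC /A; lra.
have h1 : dC (f x) (f y) * B <= e / 2 by rewrite -ler_pdivlMr // ltW.
have h2 : A * dC (g x) (g y) < e / 2 by rewrite mulrC -ltr_pdivlMr.
have : dC (f x) (f y) * nm (g x) <= dC (f x) (f y) * B.
  by rewrite ler_wpM2l ?nm_ge0 // /B lerDl.
have : nm (f y) * dC (g x) (g y) <= A * dC (g x) (g y).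
  by rewrite ler_wpM2r ?nm_ge0.
lra.
Qed.

Lemma near_neq0 f x : mcont dX dC f x -> f x != 0 ->
  exists2 d, 0 < d & forall y, dX x y < d -> f y != 0 /\ nm (f x) / 2 <= nm (f y).
Proof.
move=> cf fx; have f0 : 0 < nm (f x) by rewrite nm_gt0.
have [d d0 h] := cf (nm (f x) / 2) ltac:(lra); exists d => // y /h hy.
have := nm_lower (f x) (f y); rewrite /dC in hy; rewrite -nm_gt0; split; lra.
Qed.

Lemma ccontV f x : mcont dX dC f x -> f x != 0 ->
  mcont dX dC (fun y => (f y)^-1) x.
Proof.
move=> cf fx; have [d d0 h] := near_neq0 cf fx => e e0.
have f0 : 0 < nm (f x) by rewrite nm_gt0.
have [d' d'0 h'] := cf (e * (nm (f x) * (nm (f x) / 2)))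
  ltac:(by rewrite !mulr_gt0 ?invr_gt0).
exists (Num.min d d'); first by rewrite lt_min d0.
move=> y; rewrite lt_min => /andP[/h [fy fy2] /h' h1].
have -> : dC (f x)^-1 (f y)^-1 = dC (f x) (f y) / (nm (f x) * nm (f y)).
  rewrite /dC -nmM -nmV -nmM -nmN; congr nm; field; by rewrite fx fy.
rewrite ltr_pdivrMr ?mulr_gt0 ?nm_gt0 //; apply: (lt_le_trans h1).
by rewrite ler_pM2l // ler_pM2l.
Qed.

Lemma ccont_div f g x : mcont dX dC f x -> mcont dX dC g x -> g x != 0 ->
  mcont dX dC (fun y => f y / g y) x.
Proof. by move=> cf cg gx; apply: ccontM => //; exact: ccontV. Qed.

Lemma ccontX f x n : mcont dX dC f x -> mcont dX dC (fun y => f y ^+ n) x.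
Proof.
move=> cf; elim: n => [|n IH]; first exact: ccont_cst.
under [fun y => _]eq_fun => y do rewrite exprS.
exact: ccontM.
Qed.

Lemma cont_nm f x : mcont dX dC f x -> mcont dX dR (fun y => nm (f y)) x.
Proof.
move=> cf e e0; have [d d0 h] := cf e e0; exists d => // y /h; rewrite /dC => hy.
have := nm_lower (f x) (f y); have := nm_lower (f y) (f x).
by rewrite (nm_dist (f y)) /dR ltr_norml; lra.
Qed.

Lemma rcont_cst c x : mcont dX dR (fun=> c) x.
Proof. by move=> e e0; exists 1 => // y _; rewrite dRxx. Qed.

Lemma rcont_cplx (f : X -> R) x :
  mcont dX dR f x <-> mcont dX dC (fun y => (f y)%:C%C) x.
Proof.
by split=> h e /h [d d0 H]; exists d => // y /H; rewrite /dC /dR -rmorphB nm_real.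
Qed.

Lemma rcontD (f g : X -> R) x : mcont dX dR f x -> mcont dX dR g x ->
  mcont dX dR (fun y => f y + g y) x.
Proof.
move=> /rcont_cplx cf /rcont_cplx cg; apply/rcont_cplx.
by under [fun y => _]eq_fun => y do rewrite rmorphD; exact: ccontD.
Qed.

Lemma rcontM (f g : X -> R) x : mcont dX dR f x -> mcont dX dR g x ->
  mcont dX dR (fun y => f y * g y) x.
Proof.
move=> /rcont_cplx cf /rcont_cplx cg; apply/rcont_cplx.
by under [fun y => _]eq_fun => y do rewrite rmorphM; exact: ccontM.
Qed.

Lemma rcontN (f : X -> R) x : mcont dX dR f x -> mcont dX dR (fun y => - f y) x.
Proof.
move=> /rcont_cplx cf; apply/rcont_cplx.
by under [fun y => _]eq_fun => y do rewrite rmorphN; exact: ccontN.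
Qed.

Lemma rcontB (f g : X -> R) x : mcont dX dR f x -> mcont dX dR g x ->
  mcont dX dR (fun y => f y - g y) x.
Proof. by move=> cf cg; apply: rcontD => //; exact: rcontN. Qed.

End Generic.

Lemma mcont_id (X : Type) (dX : X -> X -> R) x : mcont dX dX id x.
Proof. by move=> e e0; exists e. Qed.

Lemma mcont_cvg (f : R -> R) (x : R) : mcont dR dR f x <-> {for x, continuous f}.
Proof.
split=> [h|].
  apply/cvgrPdist_lt => e e0; have [d d0 H] := h e e0.
  by exists d => //= y yd; exact: H.
move=> /cvgrPdist_lt h e /h [d /= d0 H]; exists d => // y yd; exact: H.
Qed.

Lemma le_lim_mcont (X : Type) (dX : X -> X -> R) (f : X -> C) (x : X) (M : R) :
  mcont dX dC f x ->
  (forall d, 0 < d -> exists2 y, dX x y < d & nm (f y) <= M) -> nm (f x) <= M.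
Proof.
move=> cf H; rewrite leNgt; apply/negP => Mf.
have [d d0 h] := cf (nm (f x) - M) ltac:(lra).
have [y /h hy fy] := H d d0; rewrite /dC in hy.
have := nm_lower (f x) (f y); lra.
Qed.

End Continuity.

(** * Complex differentiability in Caratheodory's form *)

Section ComplexDerivative.
Variable R : realType.
Local Notation C := (R[i]).
Local Notation nm := (@Normc.normc R).
Local Notation ccont := (mcont (@dC R) (@dC R)).
Implicit Types (f g : C -> C) (z w l : C).

(** The difference quotient with the candidate derivative l filled in at z. Differentiability
    becomes continuity of this function at z, and the rules for products, inverses and compositions
    become algebraic identities between such factors. *)
Definition slope f z l w := if w == z then l else (f w - f z) / (w - z).

Definition cder f z l := ccont (slope f z l) z.

Lemma slopexx f z l : slope f z l z = l. Proof. by rewrite /slope eqxx. Qed.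

Lemma slopeE f z l w : f w = f z + slope f z l w * (w - z).
Proof.
rewrite /slope; case: eqVneq => [->|wz]; first by rewrite subrr mulr0 addr0.
by rewrite divfK ?subr_eq0 // addrC subrK.
Qed.

Lemma cder_slope f z k : ccont k z ->
  (exists2 d, 0 < d & forall w, dC z w < d -> f w = f z + k w * (w - z)) ->
  cder f z (k z).
Proof.
move=> ck [d d0 h]; apply: mcont_near ck; first by rewrite slopexx.
exists d => // w /h fw; rewrite /slope; case: eqVneq => [->//|wz].
by rewrite fw addrAC subrr add0r mulfK // subr_eq0.
Qed.

Lemma cder_slope_all f z k : ccont k z ->
  (forall w, f w = f z + k w * (w - z)) -> cder f z (k z).
Proof. by move=> ck h; apply: cder_slope => //; exists 1. Qed.

Lemma cder_near f g z l : (exists2 d, 0 < d & forall w, dC z w < d -> f w = g w) ->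
  cder f z l -> cder g z l.
Proof.
move=> [d d0 fg] cf; have fz : f z = g z by apply: fg; rewrite dCxx.
rewrite -(slopexx f z l); apply: cder_slope => //.
by exists d => // w /fg <-; rewrite -fz; exact: slopeE.
Qed.

Lemma cder_cont f z l : cder f z l -> ccont f z.
Proof.
move=> cf; have -> : f = fun w => f z + slope f z l w * (w - z).
  by apply: funext => w; exact: slopeE.
apply: ccontD; first exact: ccont_cst.
apply: ccontM => //; apply: ccontB; [exact: mcont_id|exact: ccont_cst].
Qed.

Lemma cder_cst c z : cder (fun=> c) z 0.
Proof.
apply: (@cder_slope_all _ _ (fun=> 0)); first exact: ccont_cst.
by move=> w; rewrite mul0r addr0.
Qed.

Lemma cder_id z : cder id z 1.
Proof.
apply: (@cder_slope_all _ _ (fun=> 1)); first exact: ccont_cst.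
by move=> w; rewrite mul1r addrC subrK.
Qed.

Lemma cderD f g z l m : cder f z l -> cder g z m ->
  cder (fun w => f w + g w) z (l + m).
Proof.
move=> cf cg; have -> : l + m = slope f z l z + slope g z m z by rewrite !slopexx.
apply: (@cder_slope_all _ _ (fun w => slope f z l w + slope g z m w)).
  exact: ccontD.
by move=> w; rewrite {1}(slopeE f z l w) {1}(slopeE g z m w); ring.
Qed.

Lemma cderM f g z l m : cder f z l -> cder g z m ->
  cder (fun w => f w * g w) z (l * g z + f z * m).
Proof.
move=> cf cg.
have -> : l * g z + f z * m = slope f z l z * g z + f z * slope g z m z.
  by rewrite !slopexx.
apply: (@cder_slope_all _ _ (fun w => slope f z l w * g w + f z * slope g z m w)).
  apply: ccontD; apply: ccontM => //; [exact: cder_cont cg|exact: ccont_cst].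
by move=> w; rewrite {1}(slopeE f z l w) {1 2}(slopeE g z m w); ring.
Qed.

Lemma cderV f z l : cder f z l -> f z != 0 ->
  cder (fun w => (f w)^-1) z (- l / (f z) ^+ 2).
Proof.
move=> cf fz; have cc := cder_cont cf.
have -> : - l / f z ^+ 2 = - slope f z l z / (f z * f z) by rewrite slopexx expr2.
apply: (@cder_slope _ _ (fun w => - slope f z l w / (f z * f w))).
  apply: ccont_div; first exact: ccontN.
    by apply: ccontM => //; exact: ccont_cst.
  by rewrite mulf_neq0.
have [d d0 h] := near_neq0 cc fz; exists d => // w /h [fw _].
have : slope f z l w * (w - z) = f w - f z.
  by rewrite [in RHS](slopeE f z l w) addrAC subrr add0r.
rewrite -mulrA [_^-1 * _]mulrC mulrA mulNr => ->; field.
by rewrite fz fw.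
Qed.

Lemma cder_comp f g z l m : cder f z l -> cder g (f z) m ->
  cder (fun w => g (f w)) z (m * l).
Proof.
move=> cf cg; have -> : m * l = slope g (f z) m (f z) * slope f z l z.
  by rewrite !slopexx.
apply: (@cder_slope_all _ _ (fun w => slope g (f z) m (f w) * slope f z l w)).
  apply: ccontM => //.
  by apply: (mcont_comp (g := slope g (f z) m)); [exact: cder_cont cf|].
move=> w; rewrite {1}(slopeE g (f z) m (f w)) {2}(slopeE f z l w); ring.
Qed.

Lemma cder_unique f z l m : cder f z l -> cder f z m -> l = m.
Proof.
move=> hl hm; apply/eqP; rewrite -subr_eq0 -nm_eq0; apply/negP => /negP n0.
have e0 : 0 < nm (l - m) by rewrite lt_neqAle eq_sym n0 nm_ge0.
have [d d0 h] := hl (nm (l - m) / 2) ltac:(lra).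
have [d' d'0 h'] := hm (nm (l - m) / 2) ltac:(lra).
pose t := Num.min d d' / 2.
have t0 : 0 < t by rewrite divr_gt0 // lt_min d0.
have [td td'] : t < d /\ t < d'.
  have : Num.min d d' <= d by rewrite ge_min lexx.
  have : Num.min d d' <= d' by rewrite ge_min lexx orbT.
  by rewrite /t in t0 *; lra.
have dt : dC z (z + t%:C%C) = t.
  by rewrite /dC opprD addrA subrr add0r nmN nm_real gtr0_norm.
have := h (z + t%:C%C); rewrite dt => /(_ td).
have := h' (z + t%:C%C); rewrite dt => /(_ td').
rewrite !slopexx /slope; case: ifP => [|_].
  by rewrite -subr_eq0 addrAC subrr add0r => /eqP [E]; rewrite E ltxx in t0.
rewrite /dC [nm (m - _)]nm_dist; set q := _ / _ => A B.
have := nm_tri q l m; lra.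
Qed.

Lemma cdiff_atP f z : cdiff_at f z <-> exists l, cder f z l.
Proof.
split=> [[l H]|[l H]]; exists l => e e0.
  have [d d0 h] := H (e / 2) ltac:(lra); exists d => // w wd.
  rewrite slopexx /slope; case: eqVneq => [_|wz]; first by rewrite dCxx.
  have wz' : 0 < nm (w - z) by rewrite nm_gt0 subr_eq0.
  have wd' : nm (w - z) < d by rewrite nm_dist.
  have := h (w - z); rewrite wz' wd' => /(_ isT).
  have -> : z + (w - z) = w by ring.
  have -> : f w - f z - l * (w - z) = ((f w - f z) / (w - z) - l) * (w - z).
    by rewrite mulrBl divfK // subr_eq0.
  rewrite nmM ler_pM2r // => h1; rewrite /dC nm_dist; lra.
have [d d0 h] := H e e0; exists d => // k /andP[k0 kd].
have kz : z + k != z by rewrite -subr_eq0 addrAC subrr add0r -nm_gt0.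
have := h (z + k); rewrite /dC opprD addrA subrr add0r nmN => /(_ kd).
rewrite slopexx /slope (negbTE kz) (addrC z k) addrK nm_dist => h1.
have -> : f (k + z) - f z - l * k = ((f (k + z) - f z) / k - l) * k.
  by rewrite mulrBl divfK // -nm_gt0.
by rewrite nmM ler_pM2r // ltW.
Qed.

Lemma cdiff_near f g z : (exists2 d, 0 < d & forall w, dC z w < d -> f w = g w) ->
  cdiff_at f z -> cdiff_at g z.
Proof. by move=> h /cdiff_atP[l /(cder_near h) ?]; apply/cdiff_atP; exists l. Qed.

Lemma cdiff_cont f z : cdiff_at f z -> ccont f z.
Proof. by move=> /cdiff_atP[l /cder_cont]. Qed.

Lemma cdiff_cst c z : cdiff_at (fun=> c) z.
Proof. by apply/cdiff_atP; exists 0; exact: cder_cst. Qed.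

Lemma cdiff_id z : cdiff_at (fun w => w) z.
Proof. by apply/cdiff_atP; exists 1; exact: cder_id. Qed.

Lemma cdiffD f g z : cdiff_at f z -> cdiff_at g z -> cdiff_at (fun w => f w + g w) z.
Proof.
move=> /cdiff_atP[l cf] /cdiff_atP[m cg]; apply/cdiff_atP.
by exists (l + m); exact: cderD.
Qed.

Lemma cdiffM f g z : cdiff_at f z -> cdiff_at g z -> cdiff_at (fun w => f w * g w) z.
Proof.
move=> /cdiff_atP[l cf] /cdiff_atP[m cg]; apply/cdiff_atP.
by exists (l * g z + f z * m); exact: cderM.
Qed.

Lemma cdiffN f z : cdiff_at f z -> cdiff_at (fun w => - f w) z.
Proof.
move=> cf; under [fun w => _]eq_fun => w do rewrite -mulN1r.
by apply: cdiffM => //; exact: cdiff_cst.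
Qed.

Lemma cdiffB f g z : cdiff_at f z -> cdiff_at g z -> cdiff_at (fun w => f w - g w) z.
Proof. by move=> cf cg; apply: cdiffD => //; exact: cdiffN. Qed.

Lemma cdiffV f z : cdiff_at f z -> f z != 0 -> cdiff_at (fun w => (f w)^-1) z.
Proof.
move=> /cdiff_atP[l cf] fz; apply/cdiff_atP.
by exists (- l / (f z) ^+ 2); exact: cderV.
Qed.

Lemma cdiff_div f g z : cdiff_at f z -> cdiff_at g z -> g z != 0 ->
  cdiff_at (fun w => f w / g w) z.
Proof. by move=> cf cg gz; apply: cdiffM => //; exact: cdiffV. Qed.

Lemma cdiff_comp f g z : cdiff_at f z -> cdiff_at g (f z) ->
  cdiff_at (fun w => g (f w)) z.
Proof.
move=> /cdiff_atP[l cf] /cdiff_atP[m cg]; apply/cdiff_atP.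
by exists (m * l); exact: cder_comp.
Qed.

Lemma cdiffX f z n : cdiff_at f z -> cdiff_at (fun w => f w ^+ n) z.
Proof.
move=> cf; elim: n => [|n IH]; first exact: cdiff_cst.
by under [fun w => _]eq_fun => w do rewrite exprS; exact: cdiffM.
Qed.

Lemma cdiff_horner (p : {poly C}) f z : cdiff_at f z -> cdiff_at (fun w => p.[f w]) z.
Proof.
move=> cf; elim/poly_ind: p => [|p c IH].
  by under [fun w => _]eq_fun => w do rewrite horner0; exact: cdiff_cst.
under [fun w => _]eq_fun => w do rewrite hornerMXaddC.
by apply: cdiffD; [exact: cdiffM|exact: cdiff_cst].
Qed.

Lemma cdiff_slope f z l w : w != z -> cdiff_at f w -> cdiff_at (slope f z l) w.
Proof.
move=> wz cf; apply: (@cdiff_near (fun w => (f w - f z) / (w - z))).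
  exists (nm (w - z)); first by rewrite nm_gt0 subr_eq0.
  move=> v; rewrite /slope; case: eqVneq => // ->; by rewrite ltxx.
apply: cdiff_div; last by rewrite subr_eq0.
  by apply: cdiffB => //; exact: cdiff_cst.
by apply: cdiffB; [exact: cdiff_id|exact: cdiff_cst].
Qed.

End ComplexDerivative.

(** * Integrals of complex functions over real intervals *)

Section PathIntegral.
Variable R : realType.
Local Notation C := (R[i]).
Local Notation nm := (@Normc.normc R).
Implicit Types (h F : R -> C) (a b : R).

Definition primitive_on a b h F := forall t, a <= t <= b -> forall e, 0 < e ->
  exists2 d, 0 < d & forall s, a <= s <= b -> `|s - t| < d ->
    nm (F s - F t - h t * (s - t)%:C%C) <= e * `|s - t|.

(** An integral is the increment of a primitive, so linearity, splitting and estimates are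
    statements about derivatives; Lebesgue integration enters only to produce a primitive in
    [real_primitive]. *)
Definition isint h a b (I : C) := exists2 F, primitive_on a b h F & I = F b - F a.

Lemma real_primitive (u : R -> R) a b : (forall x, {for x, continuous u}) ->
  exists F : R -> R, forall t, a <= t <= b -> forall e, 0 < e ->
  exists2 d, 0 < d & forall s, `|s - t| < d ->
    `|F s - F t - u t * (s - t)| <= e * `|s - t|.
Proof.
move=> cu.
(* Starting at a - 1, with integrability up to b + 1, makes every t of [a, b] an interior point, so
   that the derivative is two-sided. *)
pose F x := (\int[lebesgue_measure]_(t in [set` Interval (BLeft (a - 1)) (BRight x)]) u t)%R.
exists F => t tab e e0.
have int : lebesgue_measure.-integrable
    [set` Interval (BLeft (a - 1)) (BRight (b + 1))] (EFin \o u).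
  apply: continuous_compact_integrable; first exact: segment_compact.
  by apply: continuous_subspaceT => x; exact: cu.
have tb : t < b + 1 by lra.
have at_ : a - 1 < t by lra.
have [dF dE] := continuous_FTC1_closed tb int at_ (cu t).
have := dF; rewrite /derivable => /cvg_ex [l hl].
have lE : l = u t.
  rewrite -dE derive1E /derive; apply/esym; apply: cvg_lim => //.
move: hl; rewrite lE => /cvgrPdist_le /(_ e e0) [d /= d0 H].
exists d => // s sd.
have [->|st] := eqVneq s t; first by rewrite !subrr mulr0 subrr normr0 mulr0.
have := H (s - t); rewrite /ball_ /= sub0r normrN => /(_ sd).
rewrite subr_eq0 => /(_ st).
rewrite /GRing.scale /= mulr1 subrK => h.
have st0 : 0 < `|s - t| by rewrite normr_gt0 subr_eq0.
have -> : F s - F t - u t * (s - t) = - ((u t - (s - t)^-1 * (F s - F t)) * (s - t)).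
  field. by rewrite subr_eq0.
by rewrite normrN normrM ler_pM2r.
Qed.

Lemma primitive_exists h a b : a <= b ->
  (forall t, a <= t <= b -> forall e, 0 < e -> exists2 d, 0 < d &
     forall s, a <= s <= b -> `|s - t| < d -> nm (h s - h t) < e) ->
  exists F, primitive_on a b h F.
Proof.
(* [cl] is the retraction of the line onto [a, b]. It is 1-Lipschitz, so composing with it extends h
   continuously to the whole line. *)
move=> ab ch; pose cl t := Num.max a (Num.min b t).
have cl1 t : a <= cl t <= b by rewrite /cl le_max lexx ge_max ab ge_min lexx.
have cl2 t : a <= t <= b -> cl t = t.
  move=> /andP[at_ tb]; rewrite /cl.
  by rewrite (min_idPr _) // (max_idPr _).
have cl3 s t : `|cl s - cl t| <= `|s - t|.
  have mn x y : `|Num.min b x - Num.min b y| <= `|x - y|.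
    have := ler_norm (x - y); have := ler_norm (y - x); rewrite [`|y - x|]distrC.
    rewrite ler_norml; case: (leP b x) => ?; case: (leP b y) => ?; lra.
  have mx x y : `|Num.max a x - Num.max a y| <= `|x - y|.
    have := ler_norm (x - y); have := ler_norm (y - x); rewrite [`|y - x|]distrC.
    rewrite ler_norml; case: (leP a x) => ?; case: (leP a y) => ?; lra.
  exact: le_trans (mx _ _) (mn _ _).
have cc t e : 0 < e -> exists2 d, 0 < d & forall s, `|s - t| < d -> nm (h (cl s) - h (cl t)) < e.
  move=> e0; have [d d0 H] := ch (cl t) (cl1 t) e e0.
  exists d => // s sd; apply: H => //; exact: le_lt_trans (cl3 _ _) sd.
have cRe x : {for x, continuous (fun t => complex.Re (h (cl t)))}.
  apply/mcont_cvg => e /(cc x)[d d0 H]; exists d => // s; rewrite dRC => /H.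
  by apply: le_lt_trans; rewrite dRC /dR -ReN -ReD; exact: Re_le_nm.
have cIm x : {for x, continuous (fun t => complex.Im (h (cl t)))}.
  apply/mcont_cvg => e /(cc x)[d d0 H]; exists d => // s; rewrite dRC => /H.
  by apply: le_lt_trans; rewrite dRC /dR -ImN -ImD; exact: Im_le_nm.
have [F1 H1] := real_primitive a b cRe; have [F2 H2] := real_primitive a b cIm.
exists (fun t => (F1 t +i* F2 t)%C) => t tab e e0.
have [d1 d10 h1] := H1 t tab (e / 2) ltac:(lra).
have [d2 d20 h2] := H2 t tab (e / 2) ltac:(lra).
exists (Num.min d1 d2); first by rewrite lt_min d10.
move=> s sab; rewrite lt_min => /andP[/h1 {}h1 /h2 {}h2].
apply: (le_trans (nm_le_ReIm _)); rewrite !(ReD, ImD, ReN, ImN, ReM, ImM) /=.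
rewrite !mulr0 subr0 add0r; rewrite (cl2 t tab) in h1 h2; lra.
Qed.

(** The mean value inequality for a general translation invariant gauge: the modulus of y - x gives
    the upper bound [isint_bound], and Im x - Im y gives the lower bound [isint_Im]. *)
Lemma isint_lower (d : C -> C -> R) h a b I M : a <= b ->
  (forall x y z, d x z <= d x y + d y z) -> (forall x, d x x = 0) ->
  (forall x y z, d x y - d x z <= nm (y - z)) ->
  (forall x y (t : R), 0 <= t -> d x (x + y * t%:C%C) = d 0 y * t) ->
  (forall t, a <= t <= b -> d 0 (h t) <= M) ->
  isint h a b I -> d 0 I <= M * (b - a).
Proof.
move=> ab tri dd lip hom hM [F HF ->].
have tr x y : d x y = d 0 (y - x).
  have := hom x (y - x) 1 ler01; rewrite rmorph1 !mulr1 => <-.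
  by rewrite addrC subrK.
rewrite -tr.
apply/ler_addgt0Pl => e e0.
have [<-|anb] := eqVneq a b; first by rewrite dd subrr mulr0; lra.
have ab' : 0 < b - a by rewrite subr_gt0 lt_neqAle anb.
have lem t s u : 0 <= u -> t = s + u -> nm (F t - F s - h s * u%:C%C) <= e / (b - a) * u ->
   d 0 (h s) <= M -> d (F s) (F t) <= (M + e / (b - a)) * u.
  move=> u0 ts H1 H2; rewrite tr -[X in d _ X](subrK (h s * u%:C%C)).
  have := lip 0 (F t - F s - h s * u%:C%C + h s * u%:C%C) (h s * u%:C%C).
  rewrite addrK; have := hom 0 (h s) u u0; rewrite add0r => ->.
  have : d 0 (h s) * u <= M * u by rewrite ler_wpM2r.
  lra.
have lem' t s u : 0 <= u -> t = s + u -> nm (F s - F t - h t * (- u)%:C%C) <= e / (b - a) * u ->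
   d 0 (h t) <= M -> d (F s) (F t) <= (M + e / (b - a)) * u.
  move=> u0 ts H1 H2; rewrite tr -[X in d _ X](subrK (h t * u%:C%C)).
  have := lip 0 (F t - F s - h t * u%:C%C + h t * u%:C%C) (h t * u%:C%C).
  rewrite addrK; have := hom 0 (h t) u u0; rewrite add0r => ->.
  have -> : F t - F s - h t * u%:C%C = - (F s - F t - h t * (- u)%:C%C).
    rewrite rmorphN; ring.
  rewrite nmN.
  have : d 0 (h t) * u <= M * u by rewrite ler_wpM2r.
  lra.
pose f u := F (a + u * (b - a)).
have -> : F a = f 0 by rewrite /f mul0r addr0.
have -> : F b = f 1 by rewrite /f mul1r addrC subrK.
have -> : e + M * (b - a) = (M + e / (b - a)) * (b - a).
  by rewrite mulrDl divfK ?gt_eqF // addrC.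
apply: mean_value_ineq => // t t01.
have tin : a <= a + t * (b - a) <= b.
  apply/andP; split; nra.
have [dl dl0 H] := HF _ tin (e / (b - a)) ltac:(by rewrite divr_gt0).
exists (dl / (b - a)); first by rewrite divr_gt0.
move=> s s01; rewrite ltr_pdivlMr // => sd.
have sin : a <= a + s * (b - a) <= b by apply/andP; split; nra.
have E : a + s * (b - a) - (a + t * (b - a)) = (s - t) * (b - a) by ring.
have {H} := H _ sin; rewrite E normrM (gtr0_norm ab') => /(_ sd) H.
split=> st; rewrite -mulrA [(b - a) * _]mulrC; last first.
  rewrite (ger0_norm (_ : 0 <= s - t)) in H; last lra.
  apply: lem => //; [apply: mulr_ge0; lra|rewrite /f; ring|exact: hM].
rewrite (ler0_norm (_ : s - t <= 0)) ?opprB in H; last lra.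
apply: lem' => //; [apply: mulr_ge0; lra|ring| |exact: hM].
by have -> : - ((t - s) * (b - a)) = (s - t) * (b - a) by ring.
Qed.

Lemma isint_bound h a b I M : a <= b -> (forall t, a <= t <= b -> nm (h t) <= M) ->
  isint h a b I -> nm I <= M * (b - a).
Proof.
move=> ab hM HI; have := isint_lower (d := fun x y => nm (y - x)) ab _ _ _ _ _ HI.
rewrite subr0; apply.
- by move=> x y z; rewrite [leRHS]addrC; exact: nm_tri.
- by move=> x; rewrite subrr nm0.
- move=> x y z; have := nm_lower (y - x) (z - x).
  by rewrite opprB addrA subrK.
- move=> x y t t0; rewrite [x + _]addrC addrK subr0 nmM nm_real ger0_norm //.
- by move=> t tab; rewrite subr0; exact: hM.
Qed.

Lemma isint_Im h a b I M : a <= b -> (forall t, a <= t <= b -> M <= complex.Im (h t)) ->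
  isint h a b I -> M * (b - a) <= complex.Im I.
Proof.
move=> ab hM HI.
have := isint_lower (d := fun x y => complex.Im x - complex.Im y) (M := - M) ab _ _ _ _ _ HI.
rewrite /= sub0r mulNr lerN2; apply.
- by move=> x y z; lra.
- by move=> x; rewrite subrr.
- move=> x y z; have := Im_le_nm (y - z); rewrite ImD ImN ler_norml; lra.
- by move=> x y t t0; rewrite ImD ImM /= mulr0 add0r; lra.
- by move=> t tab; rewrite sub0r lerN2; exact: hM.
Qed.

Lemma isint_ext h k a b I : (forall t, a <= t <= b -> h t = k t) ->
  isint h a b I -> isint k a b I.
Proof.
move=> hk [F HF ->]; exists F => // t tab e e0; rewrite -hk //; exact: HF.
Qed.

Lemma isintD h k a b I J : isint h a b I -> isint k a b J ->
  isint (fun t => h t + k t) a b (I + J).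
Proof.
move=> [F HF ->] [G HG ->]; exists (fun t => F t + G t); last by ring.
move=> t tab e e0; have [d d0 h1] := HF t tab (e / 2) ltac:(lra).
have [d' d'0 h2] := HG t tab (e / 2) ltac:(lra).
exists (Num.min d d'); first by rewrite lt_min d0.
move=> s sab; rewrite lt_min => /andP[/(h1 _ sab) {}h1 /(h2 _ sab) {}h2].
have -> : F s + G s - (F t + G t) - (h t + k t) * (s - t)%:C%C =
  (F s - F t - h t * (s - t)%:C%C) + (G s - G t - k t * (s - t)%:C%C) by ring.
apply: (le_trans (nmD _ _)); lra.
Qed.

Lemma isintZ c h a b I : isint h a b I -> isint (fun t => c * h t) a b (c * I).
Proof.
move=> [F HF ->]; exists (fun t => c * F t); last by ring.
move=> t tab e e0.
have c1 : 0 < nm c + 1 by have := nm_ge0 c; lra.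
have [d d0 h1] := HF t tab (e / (nm c + 1)) ltac:(by rewrite divr_gt0).
exists d => // s sab /(h1 _ sab) {}h1.
have -> : c * F s - c * F t - c * h t * (s - t)%:C%C =
  c * (F s - F t - h t * (s - t)%:C%C) by ring.
rewrite nmM; apply: (le_trans (ler_wpM2l (nm_ge0 _) h1)).
rewrite mulrA; apply: ler_wpM2r => //.
by rewrite mulrA ler_pdivrMr // mulrC ler_pM2l //; lra.
Qed.

Lemma isint_split h a m b I : a <= m -> m <= b -> isint h a b I ->
  exists I1 I2, [/\ isint h a m I1, isint h m b I2 & I = I1 + I2].
Proof.
move=> am mb [F HF ->]; exists (F m - F a), (F b - F m); split; last by ring.
- exists F => // t tam e e0; have [|d d0 H] := HF t _ e e0; first lra.
  by exists d => // s sam; apply: H; lra.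
- exists F => // t tam e e0; have [|d d0 H] := HF t _ e e0; first lra.
  by exists d => // s sam; apply: H; lra.
Qed.

Lemma isint_exists h a b : a <= b ->
  (forall t, a <= t <= b -> mcont (@dR R) (@dC R) h t) -> exists I, isint h a b I.
Proof.
move=> ab ch; have [|F HF] := @primitive_exists h a b ab.
  move=> t tab e e0; have [d d0 H] := ch t tab e e0; exists d => // s _ sd.
  by rewrite nm_dist; apply: H; rewrite dRC.
by exists (F b - F a), F.
Qed.

End PathIntegral.

(** * Boundary integrals over rectangles and Goursat's theorem *)

Section CauchyTheory.
Variable R : realType.
Local Notation C := (R[i]).
Local Notation nm := (@Normc.normc R).
Local Notation ccont := (mcont (@dC R) (@dC R)).
Local Notation Re := (@complex.Re R).
Local Notation Im := (@complex.Im R).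
Implicit Types (f g : C -> C) (z w : C).

Definition hside f y (t : R) : C := f (t +i* y)%C.
Definition vside f x (t : R) : C := (0 +i* 1)%C * f (x +i* t)%C.

(** The counterclockwise boundary integral; the top and left sides are parametrised against that
    direction, and the factor i of a vertical side is part of [vside]. *)
Definition Rint f x1 x2 y1 y2 (I : C) := exists Ib Ir It Il,
  [/\ isint (hside f y1) x1 x2 Ib, isint (vside f x2) y1 y2 Ir,
      isint (hside f y2) x1 x2 It, isint (vside f x1) y1 y2 Il &
      I = Ib + Ir - It - Il].

Definition inrect (x1 x2 y1 y2 : R) z := x1 <= Re z <= x2 /\ y1 <= Im z <= y2.
Definition onbd (x1 x2 y1 y2 : R) z := inrect x1 x2 y1 y2 z /\
  [\/ Re z = x1, Re z = x2, Im z = y1 | Im z = y2].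

Lemma cderP f z l : cder f z l -> forall e, 0 < e -> exists2 d, 0 < d &
  forall w, dC z w < d -> nm (f w - f z - l * (w - z)) <= e * nm (w - z).
Proof.
move=> H e /H [d d0 h]; exists d => // w /h; rewrite slopexx => h1.
have -> : f w - f z - l * (w - z) = (slope f z l w - l) * (w - z).
  by rewrite {1}(slopeE f z l w); ring.
by rewrite nmM ler_wpM2r ?nm_ge0 // nm_dist ltW.
Qed.

Lemma isint_hside f y a b : a <= b ->
  (forall t, a <= t <= b -> ccont f (t +i* y)%C) -> exists I, isint (hside f y) a b I.
Proof.
move=> ab cf; apply: isint_exists => // t tab.
apply: (mcont_comp (f := fun t => (t +i* y)%C) (dY := @dC R)); last exact: cf.
move=> e e0; exists e => // s; rewrite /dC /dR.
have -> : ((t +i* y) - (s +i* y))%C = (t - s)%:C%C.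
  by apply: ReImP => /=; rewrite ?subrr.
by rewrite nm_real.
Qed.

Lemma isint_vside f x a b : a <= b ->
  (forall t, a <= t <= b -> ccont f (x +i* t)%C) -> exists I, isint (vside f x) a b I.
Proof.
move=> ab cf; apply: isint_exists => // t tab.
apply: ccontM; first exact: ccont_cst.
apply: (mcont_comp (f := fun t => (x +i* t)%C) (dY := @dC R)); last exact: cf.
move=> e e0; exists e => // s; rewrite /dC /dR.
have -> : ((x +i* t) - (x +i* s))%C = (0 +i* 1)%C * (t - s)%:C%C.
  by apply: ReImP; rewrite ?(ReM, ImM) /= ?subrr; ring.
by rewrite nmM nm_i nm_real mul1r.
Qed.

Lemma Rint_exists f x1 x2 y1 y2 : x1 <= x2 -> y1 <= y2 ->
  (forall z, onbd x1 x2 y1 y2 z -> ccont f z) -> exists I, Rint f x1 x2 y1 y2 I.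
Proof.
move=> x12 y12 cf.
have [||Ib HIb] := @isint_hside f y1 x1 x2 => //.
  by move=> t tt; apply: cf; split; [split => //=; lra|constructor 3].
have [||It HIt] := @isint_hside f y2 x1 x2 => //.
  by move=> t tt; apply: cf; split; [split => //=; lra|constructor 4].
have [||Il HIl] := @isint_vside f x1 y1 y2 => //.
  by move=> t tt; apply: cf; split; [split => //=; lra|constructor 1].
have [||Ir HIr] := @isint_vside f x2 y1 y2 => //.
  by move=> t tt; apply: cf; split; [split => //=; lra|constructor 2].
by exists (Ib + Ir - It - Il), Ib, Ir, It, Il.
Qed.

Lemma Rint_cutx f x1 m x2 y1 y2 I : x1 <= m -> m <= x2 -> y1 <= y2 ->
  (forall t, y1 <= t <= y2 -> ccont f (m +i* t)%C) ->
  Rint f x1 x2 y1 y2 I ->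
  exists I1 I2, [/\ Rint f x1 m y1 y2 I1, Rint f m x2 y1 y2 I2 & I = I1 + I2].
Proof.
move=> x1m mx2 y12 cm [Ib [Ir [It [Il [HIb HIr HIt HIl ->]]]]].
have [b1 [b2 [h1 h2 ->]]] := isint_split x1m mx2 HIb.
have [t1 [t2 [h3 h4 ->]]] := isint_split x1m mx2 HIt.
have [v hv] := isint_vside y12 cm.
exists (b1 + v - t1 - Il), (b2 + Ir - t2 - v); split; last by ring.
  by exists b1, v, t1, Il.
by exists b2, Ir, t2, v.
Qed.

Lemma Rint_cuty f x1 x2 y1 m y2 I : y1 <= m -> m <= y2 -> x1 <= x2 ->
  (forall t, x1 <= t <= x2 -> ccont f (t +i* m)%C) ->
  Rint f x1 x2 y1 y2 I ->
  exists I1 I2, [/\ Rint f x1 x2 y1 m I1, Rint f x1 x2 m y2 I2 & I = I1 + I2].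
Proof.
move=> y1m my2 x12 cm [Ib [Ir [It [Il [HIb HIr HIt HIl ->]]]]].
have [b1 [b2 [h1 h2 ->]]] := isint_split y1m my2 HIr.
have [t1 [t2 [h3 h4 ->]]] := isint_split y1m my2 HIl.
have [v hv] := isint_hside x12 cm.
exists (Ib + b1 - v - t1), (v + b2 - It - t2); split; last by ring.
  by exists Ib, b1, v, t1.
by exists v, b2, It, t2.
Qed.

Lemma Rint_bound f x1 x2 y1 y2 I M : x1 <= x2 -> y1 <= y2 ->
  (forall z, onbd x1 x2 y1 y2 z -> nm (f z) <= M) ->
  Rint f x1 x2 y1 y2 I -> nm I <= M * (2 * ((x2 - x1) + (y2 - y1))).
Proof.
move=> x12 y12 fM [Ib [Ir [It [Il [HIb HIr HIt HIl ->]]]]].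
have H1 : nm Ib <= M * (x2 - x1).
  apply: isint_bound HIb => // t tt; apply: fM.
  by split; [split => //=; lra|constructor 3].
have H2 : nm It <= M * (x2 - x1).
  apply: isint_bound HIt => // t tt; apply: fM.
  by split; [split => //=; lra|constructor 4].
have H3 : nm Ir <= M * (y2 - y1).
  apply: isint_bound HIr => // t tt; rewrite nmM nm_i mul1r; apply: fM.
  by split; [split => //=; lra|constructor 2].
have H4 : nm Il <= M * (y2 - y1).
  apply: isint_bound HIl => // t tt; rewrite nmM nm_i mul1r; apply: fM.
  by split; [split => //=; lra|constructor 1].
have := nmB (Ib + Ir - It) Il; have := nmB (Ib + Ir) It; have := nmD Ib Ir.
lra.
Qed.

Lemma RintD f g x1 x2 y1 y2 I J : Rint f x1 x2 y1 y2 I -> Rint g x1 x2 y1 y2 J ->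
  Rint (fun z => f z + g z) x1 x2 y1 y2 (I + J).
Proof.
move=> [Ib [Ir [It [Il [h1 h2 h3 h4 ->]]]]] [Jb [Jr [Jt [Jl [k1 k2 k3 k4 ->]]]]].
exists (Ib + Jb), (Ir + Jr), (It + Jt), (Il + Jl); split; last by ring.
- exact: isintD.
- by apply: isint_ext (isintD h2 k2) => t _; rewrite /vside mulrDr.
- exact: isintD.
- by apply: isint_ext (isintD h4 k4) => t _; rewrite /vside mulrDr.
Qed.

Lemma RintZ c f x1 x2 y1 y2 I : Rint f x1 x2 y1 y2 I ->
  Rint (fun z => c * f z) x1 x2 y1 y2 (c * I).
Proof.
move=> [Ib [Ir [It [Il [h1 h2 h3 h4 ->]]]]].
exists (c * Ib), (c * Ir), (c * It), (c * Il); split; last by ring.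
- exact: isintZ.
- by apply: isint_ext (isintZ c h2) => t _; rewrite /vside mulrCA.
- exact: isintZ.
- by apply: isint_ext (isintZ c h4) => t _; rewrite /vside mulrCA.
Qed.

Lemma Rint_primitive f g x1 x2 y1 y2 : (forall z, cder g z (f z)) ->
  Rint f x1 x2 y1 y2 0.
Proof.
move=> dg.
have hs y a b : isint (hside f y) a b (g (b +i* y)%C - g (a +i* y)%C).
  exists (fun t => g (t +i* y)%C) => // t _ e e0.
  have [d d0 H] := cderP (dg (t +i* y)%C) e0; exists d => // s _ sd.
  have E : ((s +i* y) - (t +i* y))%C = (s - t)%:C%C.
    by apply: ReImP => /=; rewrite ?subrr.
  have := H (s +i* y)%C; rewrite dCC /dC E nm_real; exact.
have vs x a b : isint (vside f x) a b (g (x +i* b)%C - g (x +i* a)%C).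
  exists (fun t => g (x +i* t)%C) => // t _ e e0.
  have [d d0 H] := cderP (dg (x +i* t)%C) e0; exists d => // s _ sd.
  have E : ((x +i* s) - (x +i* t))%C = (0 +i* 1)%C * (s - t)%:C%C.
    by apply: ReImP; rewrite ?(ReM, ImM) /= ?subrr; ring.
  have := H (x +i* s)%C; rewrite dCC /dC E nmM nm_i nm_real mul1r /vside.
  by rewrite mulrA [_ * (0 +i* 1)%C]mulrC; exact.
exists (g (x2 +i* y1)%C - g (x1 +i* y1)%C), (g (x2 +i* y2)%C - g (x2 +i* y1)%C),
  (g (x2 +i* y2)%C - g (x1 +i* y2)%C), (g (x1 +i* y2)%C - g (x1 +i* y1)%C).
by split; try exact: hs; try exact: vs; ring.
Qed.

(** The bound eta (w + h)^2 is additive under quartering, so by [cousin] it only has to hold for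
    small rectangles around a given point. There f is affine up to an error eta / 2 (w + h), which
    is integrated over a perimeter 2 (w + h). *)
Lemma goursat f x1 x2 y1 y2 I : x1 <= x2 -> y1 <= y2 ->
  (forall z, inrect x1 x2 y1 y2 z -> cdiff_at f z) ->
  Rint f x1 x2 y1 y2 I -> I = 0.
Proof.
move=> x12 y12 df HI; apply/eqP; rewrite -nm_eq0 eq_le nm_ge0 andbT.
apply/ler_addgt0Pl => e e0; rewrite addr0.
pose L := (x2 - x1) + (y2 - y1).
pose eta := e / (L ^+ 2 + 1).
have L1 : 0 < L ^+ 2 + 1 by have := sqr_ge0 L; lra.
have eta0 : 0 < eta by rewrite divr_gt0.
suff : nm I <= eta * L ^+ 2.
  move=> h; apply: le_trans h _; rewrite /eta mulrAC ler_pdivrMr // ler_pM2l //; lra.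
clearbody eta; clear e0 L1.
pose P (x y w h : R) := forall I, Rint f x (x + w) y (y + h) I -> nm I <= eta * (w + h) ^+ 2.
suff : P x1 y1 (x2 - x1) (y2 - y1).
  by apply; rewrite !(addrC _ (_ - _)) !subrK.
have cf z : inrect x1 x2 y1 y2 z -> ccont f z by move=> /df /cdiff_cont.
apply: cousin; [lra|lra| |].
  move=> x y w h w0 h0 xl xr yl yr p1 p2 p3 p4 J HJ.
  have [xa xb] : x <= x + w / 2 /\ x + w / 2 <= x + w by split; lra.
  have [ya yb yc] : [/\ y <= y + h / 2, y + h / 2 <= y + h & y <= y + h] by split; lra.
  have := @Rint_cutx f x (x + w / 2) (x + w) y (y + h) J.
  move=> /(_ xa xb yc _ HJ) [|J1 [J2 [HJ1 HJ2 ->]]].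
    by move=> t tt; apply: cf; split => /=; lra.
  have := @Rint_cuty f x (x + w / 2) y (y + h / 2) (y + h) J1.
  move=> /(_ ya yb xa _ HJ1) [|J3 [J4 [HJ3 HJ4 ->]]].
    by move=> t tt; apply: cf; split => /=; lra.
  have := @Rint_cuty f (x + w / 2) (x + w) y (y + h / 2) (y + h) J2.
  move=> /(_ ya yb xb _ HJ2) [|J5 [J6 [HJ5 HJ6 ->]]].
    by move=> t tt; apply: cf; split => /=; lra.
  have w2 : w = w / 2 + w / 2 by lra.
  have h2 : h = h / 2 + h / 2 by lra.
  have q3 := p1 _ HJ3.
  have q4 : nm J4 <= eta * (w / 2 + h / 2) ^+ 2.
    by apply: p3; rewrite -addrA -h2.
  have q5 : nm J5 <= eta * (w / 2 + h / 2) ^+ 2.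
    by apply: p2; rewrite -addrA -w2.
  have q6 : nm J6 <= eta * (w / 2 + h / 2) ^+ 2.
    by apply: p4; rewrite -!addrA -w2 -h2.
  have := nmD (J3 + J4) (J5 + J6); have := nmD J3 J4; have := nmD J5 J6.
  have -> : eta * (w + h) ^+ 2 = 4 * (eta * (w / 2 + h / 2) ^+ 2) by field.
  lra.
move=> X Y Xr Yr.
have zin : inrect x1 x2 y1 y2 (X +i* Y)%C by split => /=; lra.
have /cdiff_atP [l dl] := df _ zin.
set z := (X +i* Y)%C in zin dl.
have eta2 : 0 < eta / 2 by lra.
have [d d0 Hd] := cderP dl eta2.
exists (d / 2); first lra.
move=> x y w h wd hd Xx Yy xl xr yl yr J HJ.
have [w0 h0] : 0 <= w /\ 0 <= h by lra.
(* The affine approximation has a primitive, so subtracting it does not change the boundary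
   integral. *)
have aff : Rint (fun w => - (f z + l * (w - z))) x (x + w) y (y + h) 0.
  apply: (@Rint_primitive _ (fun w => - (f z * w + l / 2 * (w - z) ^+ 2))) => u.
  pose k w := - (f z + l / 2 * ((u - z) + (w - z))).
  have -> : - (f z + l * (u - z)) = k u by rewrite /k; field.
  apply: cder_slope_all.
    apply: ccontN; apply: ccontD; first exact: ccont_cst.
    apply: ccontM; first exact: ccont_cst.
    apply: ccontD; first exact: ccont_cst.
    by apply: ccontB; [exact: mcont_id|exact: ccont_cst].
  by move=> v; rewrite /k; field.
have := RintD HJ aff; rewrite addr0 => {}HJ.
have := @Rint_bound _ _ _ _ _ _ (eta / 2 * (w + h)) _ _ _ HJ.
have -> : eta / 2 * (w + h) * (2 * (x + w - x + (y + h - y))) = eta * (w + h) ^+ 2.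
  by field.
apply; [lra|lra|].
move=> v [[vx vy] _].
have nv : nm (v - z) <= w + h.
  apply: (le_trans (nm_le_ReIm _)); rewrite ReD ImD ReN ImN /=.
  by apply: lerD; rewrite ler_norml; lra.
have := Hd v; rewrite dCC /dC => /(_ ltac:(lra)).
have -> : f v - f z - l * (v - z) = f v - (f z + l * (v - z)) by ring.
move=> h1; apply: (le_trans h1); rewrite ler_wpM2l //; lra.
Qed.

(** The quotient is differentiable away from z0 and continuous at z0. Goursat's theorem removes
    everything outside a small square about z0, and there a bounded integrand has a small
    integral. *)
Lemma cauchy_slope f x1 x2 y1 y2 z0 l I :
  x1 < Re z0 < x2 -> y1 < Im z0 < y2 ->
  (forall z, inrect x1 x2 y1 y2 z -> cdiff_at f z) -> cder f z0 l ->
  Rint (slope f z0 l) x1 x2 y1 y2 I -> I = 0.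
Proof.
move=> Xx Yy df dl HI; set k := slope f z0 l in HI.
set X := Re z0 in Xx; set Y := Im z0 in Yy.
have dk z : inrect x1 x2 y1 y2 z -> z <> z0 -> cdiff_at k z.
  by move=> zin /eqP zz0; apply: cdiff_slope => //; exact: df.
have ck z : inrect x1 x2 y1 y2 z -> ccont k z.
  move=> zin; have [->|/eqP zz0] := eqVneq z z0; first exact: dl.
  exact/cdiff_cont/dk.
apply/eqP; rewrite -nm_eq0 eq_le nm_ge0 andbT; apply/ler_addgt0Pl => e e0; rewrite addr0.
have [d d0 Hd] := dl 1 ltr01; rewrite slopexx in Hd.
pose B := nm l + 1.
have B0 : 0 < B by have := nm_ge0 l; rewrite /B; lra.
pose m := Num.min (Num.min (X - x1) (x2 - X)) (Num.min (Y - y1) (y2 - Y)).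
(* d / 4 keeps the square in the disc where the quotient is at most [B], e / (8 B) compensates its
   perimeter 8 s, and m / 2 keeps it in the rectangle. *)
pose s := Num.min (Num.min (d / 4) (e / (8 * B))) (m / 2).
have m0 : 0 < m by rewrite !lt_min; apply/andP; split; apply/andP; split; lra.
have [ma mb mc md] : [/\ m <= X - x1, m <= x2 - X, m <= Y - y1 & m <= y2 - Y].
  by rewrite !ge_min !lexx !orbT; split.
have s0 : 0 < s by rewrite !lt_min !divr_gt0 ?mulr_gt0.
have [sa sb sc] : [/\ s <= d / 4, s <= e / (8 * B) & s <= m / 2].
  by rewrite !ge_min !lexx !orbT; split.
have [xa xb] : x1 <= X - s /\ X + s <= x2 by split; lra.
have [ya yb] : y1 <= Y - s /\ Y + s <= y2 by split; lra.
have sd : s + s < d by lra.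
clearbody s; clear m m0 ma mb mc md sc sa e0 Xx Yy.
have [xc xs] : X - s <= x2 /\ X - s <= X + s by split; lra.
have [yc ys y12] : [/\ Y - s <= y2, Y - s <= Y + s & y1 <= y2] by split; lra.
have := @Rint_cutx k x1 (X - s) x2 y1 y2 I.
move=> /(_ xa xc y12 _ HI) [|I1 [I2 [HI1 HI2 ->]]].
  by move=> t tt; apply: ck; split => /=; lra.
have -> : I1 = 0.
  apply: (goursat xa y12 _ HI1) => z [zx zy]; apply: dk; first by split; lra.
  by move=> E; move: zx; rewrite E -/X; lra.
have := @Rint_cutx k (X - s) (X + s) x2 y1 y2 I2.
move=> /(_ xs xb y12 _ HI2) [|I3 [I4 [HI3 HI4 ->]]].
  by move=> t tt; apply: ck; split => /=; lra.
have -> : I4 = 0.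
  apply: (goursat xb y12 _ HI4) => z [zx zy]; apply: dk; first by split; lra.
  by move=> E; move: zx; rewrite E -/X; lra.
have := @Rint_cuty k (X - s) (X + s) y1 (Y - s) y2 I3.
move=> /(_ ya yc xs _ HI3) [|I5 [I6 [HI5 HI6 ->]]].
  by move=> t tt; apply: ck; split => /=; lra.
have -> : I5 = 0.
  apply: (goursat xs ya _ HI5) => z [zx zy]; apply: dk; first by split; lra.
  by move=> E; move: zy; rewrite E -/Y; lra.
have := @Rint_cuty k (X - s) (X + s) (Y - s) (Y + s) y2 I6.
move=> /(_ ys yb xs _ HI6) [|I7 [I8 [HI7 HI8 ->]]].
  by move=> t tt; apply: ck; split => /=; lra.
have -> : I8 = 0.
  apply: (goursat xs yb _ HI8) => z [zx zy]; apply: dk; first by split; lra.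
  by move=> E; move: zy; rewrite E -/Y; lra.
rewrite !add0r !addr0.
have := @Rint_bound k _ _ _ _ _ B _ _ _ HI7.
have -> : B * (2 * (X + s - (X - s) + (Y + s - (Y - s)))) = s * (8 * B) by ring.
move=> H; apply: (le_trans (H xs ys _)).
  move=> z [[zx zy] _].
  have : dC z0 z < d.
    rewrite dCC /dC; apply: (le_lt_trans (nm_le_ReIm _)).
    rewrite ReD ImD ReN ImN -/X -/Y.
    have : `|Re z - X| <= s by rewrite ler_norml; lra.
    have : `|Im z - Y| <= s by rewrite ler_norml; lra.
    lra.
  move=> /Hd; rewrite /dC nm_dist -/k => h1; have := nm_lower (k z) l; rewrite /B; lra.
by rewrite -ler_pdivlMr // mulr_gt0.
Qed.

End CauchyTheory.

(** * The maximum principle on squares *)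

Section MaximumPrinciple.
Variable R : realType.
Local Notation C := (R[i]).
Local Notation nm := (@Normc.normc R).
Local Notation ccont := (mcont (@dC R) (@dC R)).
Local Notation Re := (@complex.Re R).
Local Notation Im := (@complex.Im R).
Implicit Types (f g : C -> C) (z w : C).

Lemma ReV z : Re z^-1 = Re z / nm z ^+ 2.
Proof. by rewrite nm_sq; case: z. Qed.

Lemma ImV z : Im z^-1 = - Im z / nm z ^+ 2.
Proof. by rewrite nm_sq mulNr; case: z. Qed.

(** Each of the four sides contributes a positive imaginary part, because z0 lies strictly to its
    left: at distance at least [m] from the line of the side and at most [D] from its points. *)
Lemma Rint_winding x1 x2 y1 y2 z0 : x1 < Re z0 < x2 -> y1 < Im z0 < y2 ->
  exists2 c, Rint (fun z => (z - z0)^-1) x1 x2 y1 y2 c & c != 0.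
Proof.
move=> Xx Yy; set X := Re z0 in Xx; set Y := Im z0 in Yy.
have [|||c Hc] := @Rint_exists _ (fun z => (z - z0)^-1) x1 x2 y1 y2; [lra|lra| |].
  move=> z [_ zb]; apply: ccontV.
    by apply: ccontB; [exact: mcont_id|exact: ccont_cst].
  by rewrite subr_eq0; apply/eqP => E; move: zb; rewrite E -/X -/Y => -[]; lra.
exists c => //.
pose m := Num.min (Num.min (X - x1) (x2 - X)) (Num.min (Y - y1) (y2 - Y)).
have m0 : 0 < m by rewrite !lt_min; apply/andP; split; apply/andP; split; lra.
have [ma mb mc md] : [/\ m <= X - x1, m <= x2 - X, m <= Y - y1 & m <= y2 - Y].
  by rewrite !ge_min !lexx !orbT; split.
pose D := (x2 - x1) + (y2 - y1).
have D0 : 0 < D by rewrite /D; lra.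
have key u v r : inrect x1 x2 y1 y2 (u +i* v)%C -> (u +i* v)%C != z0 -> m <= r ->
  m / D ^+ 2 <= r / nm ((u +i* v)%C - z0) ^+ 2.
  move=> [/= ux vy] nz mr.
  have n0 : 0 < nm ((u +i* v)%C - z0) by rewrite nm_gt0 subr_eq0.
  have nD : nm ((u +i* v)%C - z0) <= D.
    apply: (le_trans (nm_le_ReIm _)); rewrite ReD ImD ReN ImN -/X -/Y /=.
    by apply: lerD; rewrite ler_norml; lra.
  rewrite ler_pdivlMr ?exprn_gt0 // mulrAC ler_pdivrMr ?exprn_gt0 //.
  apply: ler_pM => //; [by rewrite ltW|by rewrite exprn_ge0 // ltW|].
  by rewrite ler_pXn2r ?nnegrE ?nm_ge0 ?(ltW D0).
have nz u v : inrect x1 x2 y1 y2 (u +i* v)%C -> [\/ u = x1, u = x2, v = y1 | v = y2] -> (u +i* v)%C != z0.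
  move=> _ h; apply/eqP => E; have := congr1 Re E; have := congr1 Im E; rewrite /= -/X -/Y => e1 e2.
  by case: h; lra.
case: Hc => Ib [Ir [It [Il [HIb HIr /(isintZ (-1)) HIt /(isintZ (-1)) HIl ->]]]].
have b1 : m / D ^+ 2 * (x2 - x1) <= Im Ib.
  apply: isint_Im HIb; first lra.
  move=> t tt; rewrite /hside ImV ImD ImN /= -/Y opprB.
  by apply: key; [split => /=; lra|apply: nz; [split => /=; lra|constructor 3]|lra].
have b2 : m / D ^+ 2 * (x2 - x1) <= Im (-1 * It).
  apply: isint_Im HIt; first lra.
  move=> t tt; rewrite /hside mulN1r ImN ImV ImD ImN /= -/Y mulNr opprK.
  by apply: key; [split => /=; lra|apply: nz; [split => /=; lra|constructor 4]|lra].
have b3 : m / D ^+ 2 * (y2 - y1) <= Im Ir.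
  apply: isint_Im HIr; first lra.
  move=> t tt; rewrite /vside ImM /= mul0r mul1r add0r ReV ReD ReN /= -/X.
  by apply: key; [split => /=; lra|apply: nz; [split => /=; lra|constructor 2]|lra].
have b4 : m / D ^+ 2 * (y2 - y1) <= Im (-1 * Il).
  apply: isint_Im HIl; first lra.
  move=> t tt; rewrite /vside mulN1r ImN ImM [Im (_ +i* _)%C]/= [Re (_ +i* _)%C]/=.
  rewrite mul0r mul1r add0r ReV ReD ReN /= -/X -mulNr opprB.
  by apply: key; [split => /=; lra|apply: nz; [split => /=; lra|constructor 1]|lra].
have : 0 < Im (Ib + Ir - It - Il).
  rewrite !mulN1r in b2 b4; rewrite !ImD.
  have : 0 < m / D ^+ 2 * (x2 - x1) by rewrite mulr_gt0 ?divr_gt0 ?exprn_gt0 //; lra.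
  have : 0 < m / D ^+ 2 * (y2 - y1) by rewrite mulr_gt0 ?divr_gt0 ?exprn_gt0 //; lra.
  lra.
by move=> h; apply/eqP => E; rewrite E ltxx in h.
Qed.

(** The constant K disappears in the n-th root: if a > M > 0, Bernoulli's inequality makes (a / M)^n
    unbounded. *)
Lemma le_of_pow (a M K : R) : 0 <= a -> 0 <= M -> (forall n, a ^+ n <= K * M ^+ n) -> a <= M.
Proof.
move=> a0 M0 H; rewrite leNgt; apply/negP => Ma.
have [M00|Mn0] := eqVneq M 0.
  by have := H 1%N; rewrite !expr1 M00 mulr0; lra.
have Mp : 0 < M by rewrite lt_neqAle eq_sym Mn0.
pose q := a / M.
have q1 : 0 < q - 1 by rewrite subr_gt0 ltr_pdivlMr // mul1r.
have qn n : 1 + n%:R * (q - 1) <= q ^+ n.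
  elim: n => [|n IH]; first by rewrite mul0r addr0 expr0.
  rewrite exprS -natr1.
  have n0 : 0 <= n%:R * (q - 1) ^+ 2 :> R by rewrite mulr_ge0 ?ler0n ?sqr_ge0.
  have q0 : 0 <= q by lra.
  apply: le_trans (ler_wpM2l q0 IH).
  have -> : q * (1 + n%:R * (q - 1)) = 1 + (n%:R + 1) * (q - 1) + n%:R * (q - 1) ^+ 2.
    by ring.
  lra.
have qK n : q ^+ n <= K by rewrite /q expr_div_n ler_pdivrMr ?exprn_gt0.
have := archi_boundP (normr_ge0 (K / (q - 1))); set n := Num.bound _ => hn.
have := lt_trans (le_lt_trans (ler_norm _) hn); have := qn n; have := qK n.
have : K < n%:R * (q - 1).
  by rewrite -ltr_pdivrMr //; apply: le_lt_trans (ler_norm _) hn.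
lra.
Qed.

(** Cauchy's formula for f^n: the quotient of f^n has integral 0, so f^n(z0) times the winding
    integral is the integral of f^n(z) / (z - z0). This gives |f(z0)|^n <= K M^n with K independent
    of n, and [le_of_pow] removes K. *)
Lemma max_modulus_rect f x1 x2 y1 y2 z0 M :
  x1 < Re z0 < x2 -> y1 < Im z0 < y2 ->
  (forall z, inrect x1 x2 y1 y2 z -> cdiff_at f z) ->
  (forall z, onbd x1 x2 y1 y2 z -> nm (f z) <= M) -> nm (f z0) <= M.
Proof.
move=> Xx Yy df fM.
have M0 : 0 <= M.
  apply: le_trans (fM (x1 +i* y1)%C _); first exact: nm_ge0.
  by split; [split => /=; lra|constructor 1].
have [c Hc c0] := Rint_winding Xx Yy.
set X := Re z0 in Xx; set Y := Im z0 in Yy.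
pose m := Num.min (Num.min (X - x1) (x2 - X)) (Num.min (Y - y1) (y2 - Y)).
have m0 : 0 < m by rewrite !lt_min; apply/andP; split; apply/andP; split; lra.
have [ma mb mc md] : [/\ m <= X - x1, m <= x2 - X, m <= Y - y1 & m <= y2 - Y].
  by rewrite !ge_min !lexx !orbT; split.
have far z : onbd x1 x2 y1 y2 z -> m <= nm (z - z0).
  move=> [_ zb].
  case: zb => E; [have := Re_le_nm (z - z0)|have := Re_le_nm (z - z0)|
    have := Im_le_nm (z - z0)|have := Im_le_nm (z - z0)]; rewrite ?ReD ?ImD ?ReN ?ImN E -/X -/Y ler_norml; lra.
pose K := 2 * ((x2 - x1) + (y2 - y1)) / m / nm c.
apply: (@le_of_pow _ _ K) => //; first exact: nm_ge0.
move=> n; rewrite -nmX.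
pose g z := f z ^+ n.
have dg z : inrect x1 x2 y1 y2 z -> cdiff_at g z by move=> /df; exact: cdiffX.
have z0in : inrect x1 x2 y1 y2 z0 by split; rewrite -/X -/Y; lra.
have /cdiff_atP [l dl] := dg z0 z0in.
have [|||I HI] := @Rint_exists _ (slope g z0 l) x1 x2 y1 y2; [lra|lra| |].
  move=> z zb; apply: cdiff_cont; apply: cdiff_slope; last by apply: dg; case: zb.
  by apply/eqP => E; have := far z zb; rewrite E subrr nm0; lra.
have I0 := cauchy_slope Xx Yy dg dl HI.
have := RintD HI (RintZ (g z0) Hc); rewrite I0 add0r => H.
have := Rint_bound (M := M ^+ n / m) _ _ _ H.
rewrite nmM => /(_ ltac:(lra) ltac:(lra)) hb.
rewrite -/(g z0) /K -ler_pdivlMr ?nm_gt0 // in hb *.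
have -> : 2 * (x2 - x1 + (y2 - y1)) / m / nm c * M ^+ n =
  M ^+ n / m * (2 * (x2 - x1 + (y2 - y1))) / nm c by field; rewrite !gt_eqF ?nm_gt0.
apply: hb => z zb; have mz := far z zb.
have zz : z != z0 by apply/eqP => E; rewrite E subrr nm0 in mz; lra.
rewrite /slope (negbTE zz) -mulrDl subrK nmM nmV nmX.
apply: ler_pM; rewrite ?exprn_ge0 ?nm_ge0 ?invr_ge0 ?nm_ge0 //.
  by apply: lerXn2r; rewrite ?nnegrE ?nm_ge0 //; exact: fM.
by rewrite lef_pV2 ?posrE //; lra.
Qed.

(** The closed square of half side s. Squares play the part of discs, because the integrals above
    are taken over rectangles. *)
Definition csq (z1 : C) (s : R) (z : C) := `|Re (z - z1)| <= s /\ `|Im (z - z1)| <= s.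
Definition csqbd z1 s z := csq z1 s z /\ (`|Re (z - z1)| = s \/ `|Im (z - z1)| = s).

Lemma csq_nm z1 s z : csq z1 s z -> nm (z - z1) <= 2 * s.
Proof. by move=> [h1 h2]; apply: (le_trans (nm_le_ReIm _)); lra. Qed.

Lemma nm_csq z1 s z : nm (z - z1) <= s -> csq z1 s z.
Proof. by split; [have := Re_le_nm (z - z1)|have := Im_le_nm (z - z1)]; lra. Qed.

Lemma csqbd_nm z1 s z : csqbd z1 s z -> s <= nm (z - z1).
Proof. by move=> [_ [<-|<-]]; [exact: Re_le_nm|exact: Im_le_nm]. Qed.

Lemma csq_le z1 s t z : s <= t -> csq z1 s z -> csq z1 t z.
Proof. by move=> st [h1 h2]; split; lra. Qed.

Lemma csqxx z1 s : 0 <= s -> csq z1 s z1.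
Proof. by move=> s0; apply: nm_csq; rewrite subrr nm0. Qed.

Lemma csqbd_ex z1 s : 0 <= s -> exists z, csqbd z1 s z.
Proof.
move=> s0; exists (z1 + s%:C%C).
by split; [split|left]; rewrite (addrC z1) addrK /= ?normr0 ?ger0_norm.
Qed.

Lemma max_modulus f z1 s M : 0 < s ->
  (forall z, csq z1 s z -> cdiff_at f z) ->
  (forall z, csqbd z1 s z -> nm (f z) <= M) ->
  forall z, csq z1 s z -> nm (f z) <= M.
Proof.
move=> s0 df fM z0 z0in.
have [E|nR] := eqVneq `|Re (z0 - z1)| s; first by apply: fM; split => //; left.
have [E|nI] := eqVneq `|Im (z0 - z1)| s; first by apply: fM; split => //; right.
case: z0in => h1 h2.
have [{}h1 {}h2] : `|Re (z0 - z1)| < s /\ `|Im (z0 - z1)| < s by rewrite !lt_neqAle nR nI h1 h2.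
rewrite !(ReD, ImD, ReN, ImN) !ltr_norml in h1 h2.
apply: (@max_modulus_rect f (Re z1 - s) (Re z1 + s) (Im z1 - s) (Im z1 + s)); [lra|lra| |].
  by move=> z [zx zy]; apply: df; split; rewrite !(ReD, ImD, ReN, ImN) ler_norml; lra.
move=> z [[zx zy] zb]; apply: fM; split.
  by split; rewrite !(ReD, ImD, ReN, ImN) ler_norml; lra.
rewrite !(ReD, ImD, ReN, ImN); case: zb => ->; [left|left|right|right].
- by rewrite addrAC subrr sub0r normrN gtr0_norm.
- by rewrite addrAC subrr add0r gtr0_norm.
- by rewrite addrAC subrr sub0r normrN gtr0_norm.
- by rewrite addrAC subrr add0r gtr0_norm.
Qed.

Lemma seq_isolated (E : seq C) z : exists2 d, 0 < d &
  forall w, 0 < nm (w - z) < d -> w \notin E.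
Proof.
elim: E => [|e E [d d0 H]]; first by exists 1.
have [->|ez] := eqVneq e z.
  exists d => // w wd; rewrite inE negb_or H // andbT.
  by case/andP: wd; rewrite nm_gt0 subr_eq0.
exists (Num.min d (nm (e - z))); first by rewrite lt_min d0 nm_gt0 subr_eq0.
move=> w /andP[w0]; rewrite lt_min => /andP[wd we].
rewrite inE negb_or H ?w0 // andbT; apply/eqP => E1.
by rewrite E1 ltxx in we.
Qed.

(* A point e where f is only continuous costs nothing: (w - e) f^n is
   differentiable there, and letting n grow removes the factor w - e. *)
Lemma max_modulus_except (E : seq C) f z1 s M : 0 < s ->
  (forall z, csq z1 s z -> ccont f z) ->
  (forall z, csq z1 s z -> z \notin E -> cdiff_at f z) ->
  (forall z, csqbd z1 s z -> nm (f z) <= M) ->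
  forall z, csq z1 s z -> nm (f z) <= M.
Proof.
move=> s0 cf df fM.
have M0 : 0 <= M.
  by have [z /fM] := csqbd_ex z1 (ltW s0); apply: le_trans; exact: nm_ge0.
pose p (F : seq C) z := \prod_(e <- F) (z - e).
have pdiff F z : cdiff_at (p F) z.
  elim: F => [|e F IH]; rewrite /p.
    by under [fun z => _]eq_fun => w do rewrite big_nil; exact: cdiff_cst.
  under [fun z => _]eq_fun => w do rewrite big_cons.
  by apply: cdiffM => //; apply: cdiffB; [exact: cdiff_id|exact: cdiff_cst].
have pfdiff n F z : ccont f z -> z \in F -> cdiff_at (fun w => p F w * f w ^+ n) z.
  move=> cfz; elim: F => // e F IH; rewrite inE.
  have Ee : (fun w => p (e :: F) w * f w ^+ n) = (fun w => (w - e) * (p F w * f w ^+ n)).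
    by apply: funext => w; rewrite /p big_cons mulrA.
  have [E0|ze] /= := eqVneq z e.
    move=> _; rewrite Ee -E0; apply/cdiff_atP; exists (p F z * f z ^+ n).
    apply: (@cder_slope_all _ _ _ (fun w => p F w * f w ^+ n)).
      by apply: ccontM; [exact/cdiff_cont/pdiff|exact: ccontX].
    by move=> w; rewrite subrr mul0r add0r mulrC.
  move=> zF; rewrite Ee; apply: cdiffM; last exact: IH.
  by apply: cdiffB; [exact: cdiff_id|exact: cdiff_cst].
have pbd F : exists2 B, 0 <= B & forall z, csq z1 s z -> nm (p F z) <= B.
  elim: F => [|e F [B B0 HB]].
    by exists 1 => // z _; rewrite /p big_nil nm1.
  exists ((2 * s + nm (z1 - e)) * B); first by rewrite mulr_ge0 // addr_ge0 ?nm_ge0 //; lra.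
  move=> z zin; rewrite /p big_cons nmM; apply: ler_pM; rewrite ?nm_ge0 ?HB //.
  by have := nm_tri z1 z e; have := csq_nm zin; lra.
have p0 F z : z \notin F -> p F z != 0.
  elim: F => [|e F IH]; first by rewrite /p big_nil oner_eq0.
  rewrite inE negb_or /p big_cons => /andP[ze zF].
  by rewrite mulf_neq0 ?subr_eq0 ?IH.
have main z : csq z1 s z -> z \notin E -> nm (f z) <= M.
  move=> zin zE; have [B B0 HB] := pbd E.
  apply: (@le_of_pow _ _ (B / nm (p E z))); rewrite ?nm_ge0 // => n.
  rewrite mulrAC ler_pdivlMr ?nm_gt0 ?p0 // -nmX mulrC -nmM.
  apply: (max_modulus (f := fun w => p E w * f w ^+ n) s0 _ _ zin).
    move=> w win; have [wE|wE] := boolP (w \in E); first by apply: pfdiff => //; exact: cf.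
    by apply: cdiffM; [exact: pdiff|apply: cdiffX; exact: df].
  move=> w wb; rewrite nmM nmX; apply: ler_pM; rewrite ?nm_ge0 ?exprn_ge0 ?nm_ge0 //.
    by apply: HB; case: wb.
  by apply: lerXn2r; rewrite ?nnegrE ?nm_ge0 //; exact: fM.
move=> z zin; have [zE|] := boolP (z \in E); last exact: main.
have [E1|nR] := eqVneq `|Re (z - z1)| s; first by apply: fM; split => //; left.
have [E1|nI] := eqVneq `|Im (z - z1)| s; first by apply: fM; split => //; right.
have [h1 h2] := zin.
have {}h1 : `|Re (z - z1)| < s by rewrite lt_neqAle nR h1.
apply: (le_lim_mcont (cf z zin)) => d d0.
have [r r0 Hr] := seq_isolated E z.
pose t := Num.min (Num.min d r) (s - `|Re (z - z1)|) / 2.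
have t0 : 0 < t by rewrite divr_gt0 // !lt_min d0 r0 /=; lra.
have [td tr ts] : [/\ t < d, t < r & t < s - `|Re (z - z1)|].
  have : Num.min (Num.min d r) (s - `|Re (z - z1)|) <= d by rewrite !ge_min lexx.
  have : Num.min (Num.min d r) (s - `|Re (z - z1)|) <= r by rewrite !ge_min lexx orbT.
  have : Num.min (Num.min d r) (s - `|Re (z - z1)|) <= s - `|Re (z - z1)|.
    by rewrite !ge_min lexx !orbT.
  by rewrite /t in t0 *; split; lra.
have nt : nm (z + t%:C%C - z) = t by rewrite (addrC z) addrK nm_real gtr0_norm.
exists (z + t%:C%C); first by rewrite dCC /dC nt.
apply: main; last by apply: Hr; rewrite nt t0.
have E2 : z + t%:C%C - z1 = (z - z1) + t%:C%C by ring.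
split; rewrite E2 ?(ReD (z - z1)) ?(ImD (z - z1)) /= ?addr0 //.
by apply: (le_trans (ler_normD _ _)); rewrite (gtr0_norm t0); lra.
Qed.

End MaximumPrinciple.

(** * Extreme values, removable points, derivative estimates and the derivative of a derivative *)

Section Regularity.
Variable R : realType.
Local Notation C := (R[i]).
Local Notation nm := (@Normc.normc R).
Local Notation ccont := (mcont (@dC R) (@dC R)).
Local Notation Re := (@complex.Re R).
Local Notation Im := (@complex.Im R).
Implicit Types (f g : C -> C) (z w : C) (s : R).

(** Without a maximum, every small rectangle carries values of u that are strictly below some other
    value of u on S. This property merges under quartering, so by [cousin] it holds for all of S,
    and some value is strictly below itself. *)
Lemma extreme_value (S : C -> Prop) (u : C -> R) :
  (exists B, forall z, S z -> nm z <= B) ->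
  (forall z, ~ S z -> exists2 d, 0 < d & forall w, dC z w < d -> ~ S w) ->
  (exists z, S z) -> (forall z, S z -> mcont (@dC R) (@dR R) u z) ->
  exists2 z, S z & forall w, S w -> u w <= u z.
Proof.
move=> [B SB] Sc [a Sa] cu; apply: contrapT => no.
have no' z : S z -> exists2 w, S w & u z < u w.
  move=> Sz; apply: contrapT => h; apply: no; exists z => // w Sw.
  by rewrite leNgt; apply/negP => uw; apply: h; exists w.
pose P (x y w h : R) := exists2 c, S c & forall z, S z -> inrect x (x + w) y (y + h) z -> u z < u c.
have B0 : 0 <= B by apply: le_trans (SB a Sa); exact: nm_ge0.
have [||||c Sc1 Hc] := @cousin R (- B) (- B) (2 * B) (2 * B) P; [lra|lra| | |].
- move=> x y w h w0 h0 _ _ _ _ [c1 S1 H1] [c2 S2 H2] [c3 S3 H3] [c4 S4 H4].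
  have mx p q : S p -> S q -> exists r, [/\ S r, u p <= u r & u q <= u r].
    by move=> Sp Sq; case: (leP (u p) (u q)) => h'; [exists q|exists p]; split => //; apply: ltW.
  have [c12 [S12 l1 l2]] := mx _ _ S1 S2; have [c34 [S34 l3 l4]] := mx _ _ S3 S4.
  have [c [Sc' l5 l6]] := mx _ _ S12 S34.
  exists c => // z Sz [zx zy].
  case: (leP (Re z) (x + w / 2)) => hx; case: (leP (Im z) (y + h / 2)) => hy.
  + have := H1 z Sz; have : inrect x (x + w / 2) y (y + h / 2) z by split; lra.
    by move=> h' /(_ h'); lra.
  + have := H3 z Sz; have : inrect x (x + w / 2) (y + h / 2) (y + h / 2 + h / 2) z by split; lra.
    by move=> h' /(_ h'); lra.
  + have := H2 z Sz; have : inrect (x + w / 2) (x + w / 2 + w / 2) y (y + h / 2) z by split; lra.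
    by move=> h' /(_ h'); lra.
  + have := H4 z Sz.
    have : inrect (x + w / 2) (x + w / 2 + w / 2) (y + h / 2) (y + h / 2 + h / 2) z by split; lra.
    by move=> h' /(_ h'); lra.
- move=> X Y _ _; pose z0 : C := (X +i* Y)%C.
  have near (x y w h d : R) z : 0 <= w < d / 2 -> 0 <= h < d / 2 -> x <= X <= x + w ->
      y <= Y <= y + h -> inrect x (x + w) y (y + h) z -> dC z0 z < d.
    move=> w0 h0 Xx Yy [zx zy]; rewrite dCC /dC; apply: (le_lt_trans (nm_le_ReIm _)).
    rewrite ReD ImD ReN ImN /=.
    have : `|Re z - X| <= w by rewrite ler_norml; lra.
    have : `|Im z - Y| <= h by rewrite ler_norml; lra.
    lra.
  have [Sz|nSz] := pselect (S z0).
    have [c Sc' uc] := no' _ Sz.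
    have [d d0 Hd] := cu _ Sz (u c - u z0) ltac:(lra).
    exists (d / 2); first lra.
    move=> x y w h w0 h0 Xx Yy _ _ _ _; exists c => // z Sz' zin.
    have := Hd z (near _ _ _ _ _ _ w0 h0 Xx Yy zin).
    by rewrite /dR ltr_norml; lra.
  have [d d0 Hd] := Sc _ nSz.
  exists (d / 2); first lra.
  move=> x y w h w0 h0 Xx Yy _ _ _ _; exists a => // z Sz' zin.
  by case: (Hd z (near _ _ _ _ _ _ w0 h0 Xx Yy zin)).
have : u c < u c.
  apply: Hc => //; have := SB c Sc1; have := Re_le_nm c; have := Im_le_nm c.
  by rewrite !ler_norml => h1 h2 h3; split; lra.
by rewrite ltxx.
Qed.

Lemma csq_closed z1 s z : ~ csq z1 s z ->
  exists2 d, 0 < d & forall w, dC z w < d -> ~ csq z1 s w.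
Proof.
move=> nz.
have [h|h] : s < `|Re (z - z1)| \/ s < `|Im (z - z1)|.
  case: (ltP s `|Re (z - z1)|) => h1; first by left.
  by case: (ltP s `|Im (z - z1)|) => h2; [right|case: nz].
- exists (`|Re (z - z1)| - s); first lra.
  move=> w wd [h1 _]; have := Re_le_nm (z - w); rewrite -/(dC z w).
  have -> : z - w = (z - z1) - (w - z1) by ring.
  rewrite ReD ReN; have := ler_distD 0 (Re (z - z1)) (Re (w - z1)).
  have := lerB_normD (Re (z - z1)) (- Re (w - z1)); rewrite normrN; lra.
- exists (`|Im (z - z1)| - s); first lra.
  move=> w wd [_ h1]; have := Im_le_nm (z - w); rewrite -/(dC z w).
  have -> : z - w = (z - z1) - (w - z1) by ring.
  rewrite ImD ImN.
  have := lerB_normD (Im (z - z1)) (- Im (w - z1)); rewrite normrN; lra.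
Qed.

Lemma csq_bounded z1 s z : csq z1 s z -> nm z <= nm z1 + 2 * s.
Proof. by move=> /csq_nm h; have := nmD (z - z1) z1; rewrite subrK; lra. Qed.

Lemma csqbd_closed z1 s z : ~ csqbd z1 s z ->
  exists2 d, 0 < d & forall w, dC z w < d -> ~ csqbd z1 s w.
Proof.
move=> nz; have [zin|zin] := pselect (csq z1 s z); last first.
  have [d d0 H] := csq_closed zin; exists d => // w /H wn [win _]; exact: wn.
have [h1 h2] := zin.
have {}h1 : `|Re (z - z1)| < s.
  by rewrite lt_neqAle h1 andbT; apply/eqP => E; apply: nz; split => //; left.
have {}h2 : `|Im (z - z1)| < s.
  by rewrite lt_neqAle h2 andbT; apply/eqP => E; apply: nz; split => //; right.
exists (Num.min (s - `|Re (z - z1)|) (s - `|Im (z - z1)|)).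
  by rewrite lt_min; apply/andP; split; lra.
move=> w; rewrite lt_min dCC => /andP[w1 w2] [_ wb].
have E : w - z1 = (w - z) + (z - z1) by ring.
have := Re_le_nm (w - z); have := Im_le_nm (w - z); rewrite -/(dC w z) => k1 k2.
move: wb; rewrite E ReD ImD => -[k|k].
  by have := ler_normD (Re (w - z)) (Re (z - z1)); lra.
by have := ler_normD (Im (w - z)) (Im (z - z1)); lra.
Qed.

Lemma csq_bound f z1 s : 0 <= s -> (forall z, csq z1 s z -> ccont f z) ->
  exists2 B, 0 <= B & forall z, csq z1 s z -> nm (f z) <= B.
Proof.
move=> s0 cf.
have [||||z zin H] := @extreme_value (csq z1 s) (fun z => nm (f z)).
- by exists (nm z1 + 2 * s) => z; exact: csq_bounded.
- exact: csq_closed.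
- by exists z1; exact: csqxx.
- by move=> z /cf; exact: cont_nm.
by exists (nm (f z)) => //; exact: nm_ge0.
Qed.

Lemma csq_far z0 s z w : csqbd z0 s z -> csq z0 (s / 2) w -> s / 2 <= nm (z - w).
Proof.
have -> : z - w = (z - z0) - (w - z0) by ring.
move=> [_ [E|E]] [h1 h2].
  have := Re_le_nm ((z - z0) - (w - z0)); rewrite ReD ReN.
  have := lerB_normD (Re (z - z0)) (- Re (w - z0)); rewrite normrN; lra.
have := Im_le_nm ((z - z0) - (w - z0)); rewrite ImD ImN.
have := lerB_normD (Im (z - z0)) (- Im (w - z0)); rewrite normrN; lra.
Qed.

Lemma ccont_slope f z l w : w != z -> ccont f w -> ccont (slope f z l) w.
Proof.
move=> wz cf; apply: (@mcont_near _ _ _ _ _ (fun w => (f w - f z) / (w - z))).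
- by rewrite /slope (negbTE wz).
- exists (nm (w - z)); first by rewrite nm_gt0 subr_eq0.
  by move=> v; rewrite /slope; case: eqVneq => // ->; rewrite /dC ltxx.
apply: ccont_div; last by rewrite subr_eq0.
  by apply: ccontB => //; exact: ccont_cst.
by apply: ccontB; [exact: mcont_id|exact: ccont_cst].
Qed.

(** For the real and the imaginary part p, the value is that of McShane's extension of p o Q at z0,
    the supremum of p (Q z) - B |z - z0|. The two parts account for the factor 2. *)
Lemma lipschitz_limit (Q : C -> C) (S : C -> Prop) z0 B : (exists z, S z) -> 0 <= B ->
  (forall z w, S z -> S w -> nm (Q z - Q w) <= B * nm (z - w)) ->
  exists l, forall z, S z -> nm (Q z - l) <= 2 * B * nm (z - z0).
Proof.
move=> [a Sa] B0 H.
have part (p : C -> R) : (forall z, `|p z| <= nm z) -> (forall z w, p (z - w) = p z - p w) ->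
    exists l, forall z, S z -> `|p (Q z) - l| <= B * nm (z - z0).
  move=> pn pB.
  pose T := [set p (Q z) - B * nm (z - z0) | z in S].
  have ub z : S z -> ubound T (p (Q z) + B * nm (z - z0)).
    move=> Sz _ [w Sw <-]; have := H w z Sw Sz; have := pn (Q w - Q z).
    rewrite pB ler_norml => /andP[_ h1] h2.
    have := ler_wpM2l B0 (nm_tri z0 w z); rewrite mulrDr (nm_dist z0 z); lra.
  exists (sup T) => z Sz.
  have T0 : T !=set0 by exists (p (Q a) - B * nm (a - z0)), a.
  have := ge_sup T0 (ub z Sz).
  have : p (Q z) - B * nm (z - z0) <= sup T.
    by apply: ub_le_sup; [exists (p (Q a) + B * nm (a - z0)); exact: ub|exists z].
  by rewrite ler_norml; lra.
have ReB z w : Re (z - w) = Re z - Re w by rewrite ReD ReN.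
have ImB z w : Im (z - w) = Im z - Im w by rewrite ImD ImN.
have [l1 h1] := part Re (@Re_le_nm R) ReB.
have [l2 h2] := part Im (@Im_le_nm R) ImB.
exists (l1 +i* l2)%C => z Sz; apply: (le_trans (nm_le_ReIm _)).
by rewrite ReB ImB /=; have := h1 z Sz; have := h2 z Sz; lra.
Qed.

(** The quotient based at z0 is not yet known to be continuous there, so quotients are based at w !=
    z0. The maximum principle with exceptional points bounds first and second quotients uniformly in
    w; letting w tend to z0 makes the quotient at z0 Lipschitz, hence convergent. *)
Lemma removable f z0 s : 0 < s -> (forall z, csq z0 s z -> ccont f z) ->
  (forall z, csq z0 s z -> z != z0 -> cdiff_at f z) -> cdiff_at f z0.
Proof.
move=> s0 cf df.
have [B B0 HB] := csq_bound (ltW s0) cf.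
have half z : csq z0 (s / 2) z -> csq z0 s z by apply: csq_le; lra.
have B2 : 0 <= 16 * B / s ^+ 2 by apply: divr_ge0; [lra|exact: sqr_ge0].
have D1 w l : csq z0 (s / 2) w -> w != z0 -> cder f w l ->
    forall z, csq z0 s z -> nm (slope f w l z) <= 4 * B / s.
  move=> win wz0 dl; apply: (@max_modulus_except _ [:: w; z0]) => //.
  - move=> z zin; have [->|zw] := eqVneq z w; first exact: dl.
    by apply: ccont_slope => //; exact: cf.
  - move=> z zin; rewrite !inE negb_or => /andP[zw zz0].
    by apply: cdiff_slope => //; exact: df.
  - move=> z zb; have zw := csq_far zb win.
    have zw0 : 0 < nm (z - w) by lra.
    rewrite /slope; case: eqVneq => [E|_]; first by rewrite E subrr nm0 ltxx in zw0.
    rewrite nmM nmV ler_pdivrMr //.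
    have := nmB (f z) (f w); have := HB z zb.1; have := HB w (half _ win).
    have : 4 * B / s * (s / 2) <= 4 * B / s * nm (z - w).
      by rewrite ler_wpM2l // divr_ge0 ?mulr_ge0 // ltW.
    have -> : 4 * B / s * (s / 2) = 2 * B by field; rewrite gt_eqF.
    lra.
have D2 w l v z : csq z0 (s / 2) w -> w != z0 -> cder f w l ->
    csq z0 (s / 2) v -> v != z0 -> v != w -> csq z0 s z ->
    nm (slope f w l z - slope f w l v) <= 16 * B / s ^+ 2 * nm (z - v).
  move=> win wz0 dl vin vz0 vw.
  have /cdiff_atP [m dm] : cdiff_at (slope f w l) v.
    by apply: cdiff_slope => //; apply: df => //; exact: half.
  move=> zin; have -> : slope f w l z - slope f w l v =
     slope (slope f w l) v m z * (z - v).
    by rewrite {1}(slopeE (slope f w l) v m z) addrAC subrr add0r.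
  rewrite nmM ler_wpM2r ?nm_ge0 //; move: z zin.
  apply: (@max_modulus_except _ [:: w; v; z0]) => //.
  - move=> z zin; have [->|zv] := eqVneq z v; first exact: dm.
    apply: ccont_slope => //; have [->|zw] := eqVneq z w; first exact: dl.
    by apply: ccont_slope => //; exact: cf.
  - move=> z zin; rewrite !inE !negb_or => /and3P[zw zv zz0].
    by do 2 apply: cdiff_slope => //; exact: df.
  - move=> z zb; have zv := csq_far zb vin.
    have zv0 : 0 < nm (z - v) by lra.
    rewrite [slope (slope _ _ _) _ _ _]/slope.
    case: eqVneq => [E|_]; first by rewrite E subrr nm0 ltxx in zv0.
    rewrite nmM nmV ler_pdivrMr //.
    have := nmB (slope f w l z) (slope f w l v).
    have := D1 w l win wz0 dl z zb.1; have := D1 w l win wz0 dl v (half _ vin).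
    have : 16 * B / s ^+ 2 * (s / 2) <= 16 * B / s ^+ 2 * nm (z - v).
      by rewrite ler_wpM2l.
    have -> : 16 * B / s ^+ 2 * (s / 2) = 2 * (4 * B / s) by field; rewrite gt_eqF.
    lra.
pose Q z := (f z - f z0) / (z - z0).
pose S z := csq z0 (s / 2) z /\ z != z0.
have QL z v : S z -> S v -> nm (Q z - Q v) <= 16 * B / s ^+ 2 * nm (z - v).
  move=> [zin zz0] [vin vz0].
  (* Off z and v this is the difference bounded in [D2], written so as to be visibly continuous in w
     at z0. *)
  pose E w := (f z - f w) / (z - w) - (f v - f w) / (v - w).
  have z0in : csq z0 s z0 by apply: csqxx; lra.
  have cq u : u != z0 -> ccont (fun w => (f u - f w) / (u - w)) z0.
    move=> uz0; apply: ccont_div; last by rewrite subr_eq0.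
      by apply: ccontB; [exact: ccont_cst|exact: cf].
    by apply: ccontB; [exact: ccont_cst|exact: mcont_id].
  have cE : ccont E z0 by apply: ccontB; exact: cq.
  apply: (le_lim_mcont cE) => d d0.
  have [r r0 Hr] := seq_isolated [:: z; v] z0.
  pose t := Num.min (Num.min d r) (s / 2) / 2.
  have t0 : 0 < t by rewrite divr_gt0 // !lt_min d0 r0 /=; lra.
  have [td tr ts] : [/\ t < d, t < r & t < s / 2].
    have : Num.min (Num.min d r) (s / 2) <= d by rewrite !ge_min lexx.
    have : Num.min (Num.min d r) (s / 2) <= r by rewrite !ge_min lexx orbT.
    have : Num.min (Num.min d r) (s / 2) <= s / 2 by rewrite !ge_min lexx !orbT.
    by rewrite /t in t0 *; split; lra.
  have nt : nm (z0 + t%:C%C - z0) = t by rewrite (addrC z0) addrK nm_real gtr0_norm.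
  exists (z0 + t%:C%C); first by rewrite dCC /dC nt.
  set w := z0 + t%:C%C in nt *.
  have : w \notin [:: z; v] by apply: Hr; rewrite nt t0.
  rewrite !inE negb_or => /andP[wz wv].
  have win : csq z0 (s / 2) w by apply: nm_csq; rewrite nt ltW.
  have wz0 : w != z0 by rewrite -subr_eq0 -nm_eq0 nt gt_eqF.
  have /cdiff_atP [l dl] := df w (half _ win) wz0.
  have := D2 w l v z win wz0 dl vin vz0; rewrite eq_sym => /(_ wv (half _ zin)).
  by rewrite /slope /E eq_sym (negbTE wz) eq_sym (negbTE wv).
have Sne : exists z, S z.
  exists (z0 + (s / 2)%:C%C); have h : nm (z0 + (s / 2)%:C%C - z0) = s / 2.
    by rewrite (addrC z0) addrK nm_real gtr0_norm //; lra.
  split; first by apply: nm_csq; rewrite h.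
  by rewrite -subr_eq0 -nm_eq0 h gt_eqF //; lra.
have [l Hl] := lipschitz_limit z0 Sne B2 QL.
apply/cdiff_atP; exists l => e e0.
pose K := 2 * (16 * B / s ^+ 2).
exists (Num.min (s / 2) (e / (K + 1))).
  by rewrite lt_min; apply/andP; split; [lra|rewrite divr_gt0 // /K; lra].
move=> z; rewrite lt_min dCC => /andP[z1 z2]; rewrite slopexx.
have [->|zz0] := eqVneq z z0; first by rewrite slopexx dCxx.
have Sz : S z by split => //; apply: nm_csq; rewrite ltW.
rewrite /slope (negbTE zz0) dCC; apply: (le_lt_trans (Hl z Sz)); rewrite -/K.
rewrite ltr_pdivlMr in z2; last by rewrite /K; lra.
rewrite /dC in z2; have := nm_ge0 (z - z0); rewrite mulrDr mulr1 in z2.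
have z3 : 0 < nm (z - z0) by rewrite nm_gt0 subr_eq0.
by rewrite mulrC; lra.
Qed.

Definition der f z : C := xget 0 [set l | cder f z l].

Lemma derP f z : cdiff_at f z -> cder f z (der f z).
Proof.
by move=> /cdiff_atP [l dl]; rewrite /der; case: xgetP => // /(_ l).
Qed.

Lemma der_eq f z l : cder f z l -> der f z = l.
Proof.
by move=> dl; apply: (@cder_unique _ f z) => //; apply: derP; apply/cdiff_atP; exists l.
Qed.

(** Division by z - z0 stays within the differentiable functions, so it can be iterated: Taylor
    expansions and orders of zeros rest on this. *)
Lemma slope_cdiff f z0 s z : 0 < s -> (forall z, csq z0 s z -> cdiff_at f z) ->
  csq z0 s z -> cdiff_at (slope f z0 (der f z0)) z.
Proof.
move=> s0 df zin; have [->|zz0] := eqVneq z z0; last by apply: cdiff_slope => //; exact: df.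
apply: (removable s0) => w win; last by move=> wz; apply: cdiff_slope => //; exact: df.
have [->|wz] := eqVneq w z0; last exact/cdiff_cont/cdiff_slope/df.
by apply: derP; apply: df; apply: csqxx; lra.
Qed.

(** The maximum principle for the quotient at z: on the boundary its numerator is at most 2 M and
    its denominator at least s. *)
Lemma cauchy_estimate f z s M l : 0 < s -> (forall w, csq z s w -> cdiff_at f w) ->
  (forall w, csq z s w -> nm (f w) <= M) -> cder f z l -> nm l <= 2 * M / s.
Proof.
move=> s0 df fM dl; rewrite -(slopexx f z l).
apply: (@max_modulus_except _ [:: z] (slope f z l) z s) => //.
- move=> w win; have [->|wz] := eqVneq w z; first exact: dl.
  exact/cdiff_cont/cdiff_slope/df.
- by move=> w win; rewrite inE => wz; apply: cdiff_slope => //; exact: df.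
- move=> w wb; have sw := csqbd_nm wb; have w0 : 0 < nm (w - z) by lra.
  rewrite /slope; case: eqVneq => [E|_]; first by rewrite E subrr nm0 ltxx in w0.
  rewrite nmM nmV ler_pdivrMr //; have := nmB (f w) (f z).
  have := fM w wb.1; have zin : csq z s z by apply: csqxx; lra.
  have := fM z zin; have := nm_ge0 (f z).
  have : 2 * M / s * s = 2 * M by field; rewrite gt_eqF.
  move=> h1 h2 h3 h4 h5.
  have : 2 * M / s * s <= 2 * M / s * nm (w - z).
    by apply: ler_wpM2l => //; apply: divr_ge0; lra.
  lra.
by apply: csqxx; lra.
Qed.

Lemma lipschitz_estimate f z0 s M : 0 < s -> (forall z, csq z0 s z -> cdiff_at f z) ->
  (forall z, csq z0 s z -> nm (f z) <= M) ->
  forall z w, csq z0 (s / 2) z -> csq z0 (s / 2) w -> nm (f z - f w) <= 4 * M / s * nm (z - w).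
Proof.
move=> s0 df fM z w zin win.
have half u : csq z0 (s / 2) u -> csq z0 s u by apply: csq_le; lra.
rewrite {1}(slopeE f w (der f w) z) addrAC subrr add0r nmM ler_wpM2r ?nm_ge0 //.
apply: (@max_modulus_except _ [:: w] (slope f w (der f w)) z0 s) => //; last exact: half.
- move=> u uin; have [->|uw] := eqVneq u w; first exact/derP/df/half.
  exact/cdiff_cont/cdiff_slope/df.
- by move=> u uin; rewrite inE => uw; apply: cdiff_slope => //; exact: df.
- move=> u ub; have uw := csq_far ub win; have u0 : 0 < nm (u - w) by lra.
  rewrite /slope; case: eqVneq => [E|_]; first by rewrite E subrr nm0 ltxx in u0.
  rewrite nmM nmV ler_pdivrMr //; have := nmB (f u) (f w).
  have := fM u ub.1; have := fM w (half _ win); have := nm_ge0 (f w).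
  have : 4 * M / s * (s / 2) = 2 * M by field; rewrite gt_eqF.
  move=> h1 h2 h3 h4 h5.
  have : 4 * M / s * (s / 2) <= 4 * M / s * nm (u - w).
    by apply: ler_wpM2l => //; apply: divr_ge0; lra.
  lra.
Qed.

Lemma taylor2 f z0 s : 0 < s -> (forall z, csq z0 s z -> cdiff_at f z) ->
  exists2 g, (forall z, csq z0 s z -> cdiff_at g z) &
    forall z, f z = f z0 + der f z0 * (z - z0) + g z * (z - z0) ^+ 2.
Proof.
move=> s0 df; pose f1 := slope f z0 (der f z0).
have df1 z : csq z0 s z -> cdiff_at f1 z by exact: slope_cdiff.
exists (slope f1 z0 (der f1 z0)); first by move=> z; exact: slope_cdiff.
move=> z; rewrite {1}(slopeE f z0 (der f z0) z) -/f1.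
by rewrite {1}(slopeE f1 z0 (der f1 z0) z) {1}/f1 slopexx; ring.
Qed.

(** Differentiating f = f(z0) + f'(z0) (z - z0) + g (z - z0)^2 gives f' - f'(z0) = (2 g + g' (z -
    z0)) (z - z0). Cauchy's estimate bounds g' near z0, so the first factor is continuous at z0. *)
Lemma der_cdiff f z0 s : 0 < s -> (forall z, csq z0 s z -> cdiff_at f z) ->
  cdiff_at (der f) z0.
Proof.
move=> s0 df; have [g dg fE] := taylor2 s0 df.
have z0in : csq z0 s z0 by apply: csqxx; lra.
have cg z : csq z0 s z -> ccont g z by move=> /dg/cdiff_cont.
have [B B0 HB] := csq_bound (ltW s0) cg.
have dE z : csq z0 s z -> der f z = der f z0 + 2 * g z * (z - z0) + der g z * (z - z0) ^+ 2.
  move=> zin; apply: der_eq.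
  have d1 : cder (fun w => w - z0) z (1 + 0).
    by apply: cderD; [exact: cder_id|exact: cder_cst].
  have d2 := cderM d1 d1; have d3 := cderM (derP (dg z zin)) d2.
  have d4 := cderM (cder_cst (der f z0) z) d1.
  have := cderD (cderD (cder_cst (f z0) z) d4) d3.
  have -> : (fun w => f z0 + der f z0 * (w - z0) + g w * ((w - z0) * (w - z0))) = f.
    by apply: funext => w; rewrite [RHS]fE expr2.
  congr cder; ring.
apply/cdiff_atP; exists (2 * g z0).
have -> : 2 * g z0 = 2 * g z0 + der g z0 * (z0 - z0) by rewrite subrr mulr0 addr0.
apply: (@cder_slope _ _ _ (fun z => 2 * g z + der g z * (z - z0))); last first.
  exists s => // z; rewrite dCC => zs; have zin : csq z0 s z by apply: nm_csq; exact: ltW.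
  by rewrite dE //; ring.
apply: ccontD.
  by apply: ccontM; [exact: ccont_cst|exact: cg].
move=> e e0; rewrite subrr mulr0.
have dgb z : csq z0 (s / 4) z -> nm (der g z) <= 8 * B / s.
  move=> zin.
  have sub w : csq z (s / 4) w -> csq z0 s w.
    move=> [h1 h2]; case: zin => h3 h4; have E : w - z0 = (w - z) + (z - z0) by ring.
    by split; rewrite E ?(ReD (w - z)) ?(ImD (w - z)); apply: (le_trans (ler_normD _ _)); lra.
  have := @cauchy_estimate g z (s / 4) B (der g z).
  have -> : 2 * B / (s / 4) = 8 * B / s by field; rewrite gt_eqF.
  apply; [lra| | |].
  + by move=> w /sub; exact: dg.
  + by move=> w /sub; exact: HB.
  + by apply/derP/dg; apply: csq_le zin; lra.
have K1 : 0 <= 8 * B / s by apply: divr_ge0; lra.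
have K0 : 0 < 8 * B / s + 1 by lra.
exists (Num.min (s / 4) (e / (8 * B / s + 1))).
  by rewrite lt_min divr_gt0 // divr_gt0.
move=> z; rewrite lt_min dCC => /andP[zs ze].
rewrite dCC /dC subr0 nmM.
have := dgb z ltac:(by apply: nm_csq; exact: ltW).
rewrite ltr_pdivlMr // /dC in ze; have := nm_ge0 (z - z0) => h1 h2.
have : nm (der g z) * nm (z - z0) <= 8 * B / s * nm (z - z0) by rewrite ler_wpM2r.
rewrite mulrDr mulr1 in ze; rewrite (mulrC (8 * B / s)); lra.
Qed.

End Regularity.

(** * Open mapping, zeros and local inverses *)

Section LocalInverse.
Variable R : realType.
Local Notation C := (R[i]).
Local Notation nm := (@Normc.normc R).
Local Notation ccont := (mcont (@dC R) (@dC R)).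
Implicit Types (f g : C -> C) (z w : C) (s : R).

(** If a value w close to f(z0) were omitted, 1 / (f - w) would be larger at the centre than on the
    boundary, against the maximum principle. *)
Lemma open_square f z0 s : 0 < s -> (forall z, csq z0 s z -> cdiff_at f z) ->
  (forall z, csqbd z0 s z -> f z != f z0) ->
  exists2 m, 0 < m & forall w, nm (w - f z0) < m -> exists2 z, csq z0 s z & f z = w.
Proof.
move=> s0 df fn.
have [||||z1 z1b Hz1] := @extreme_value R (csqbd z0 s) (fun z => - nm (f z - f z0)).
- by exists (nm z0 + 2 * s) => z [/csq_bounded].
- exact: csqbd_closed.
- by apply: csqbd_ex; lra.
- move=> z [zin _]; apply: rcontN; apply: cont_nm; apply: ccontB; last exact: ccont_cst.
  exact/cdiff_cont/df.
pose m := nm (f z1 - f z0) / 2.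
have m0 : 0 < m by rewrite divr_gt0 // nm_gt0 subr_eq0 fn.
have mb z : csqbd z0 s z -> 2 * m <= nm (f z - f z0).
  by move=> /Hz1; rewrite lerN2 /m; lra.
exists m => // w wm; apply: contrapT => no.
have fw z : csq z0 s z -> f z - w != 0.
  by move=> zin; rewrite subr_eq0; apply/eqP => E; apply: no; exists z.
have z0in : csq z0 s z0 by apply: csqxx; lra.
have := @max_modulus R (fun z => (f z - w)^-1) z0 s m^-1 s0 _ _ z0 z0in.
have h : m^-1 < nm (f z0 - w)^-1.
  by rewrite nmV ltf_pV2 ?posrE ?nm_gt0 ?fw // nm_dist.
rewrite leNgt h => H; have : false; last by [].
apply: H.
  move=> z zin; apply: cdiffV; last exact: fw.
  by apply: cdiffB; [exact: df|exact: cdiff_cst].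
move=> z zb; rewrite nmV lef_pV2 ?posrE ?nm_gt0 ?fw //; last by case: zb.
have := mb z zb; have := nm_tri w (f z) (f z0); lra.
Qed.

(** If all iterated quotients of f - f(z0) vanished at z0, the maximum principle would bound the
    k-th one by B / s^k. As |z1 - z0| <= s / 2, then |f(z1) - f(z0)| <= B / 2^k for every k >= 1. *)
Lemma zero_order f z0 s : 0 < s -> (forall z, csq z0 s z -> cdiff_at f z) ->
  (exists2 z, nm (z - z0) <= s / 2 & f z != f z0) ->
  exists n g, [/\ forall z, csq z0 s z -> cdiff_at g z, g z0 != 0 &
    forall z, f z = f z0 + (z - z0) ^+ n.+1 * g z].
Proof.
move=> s0 df [z1 z1s fz1].
pose u k := iter k (fun g => slope g z0 (der g z0)) (fun z => f z - f z0).
have du k z : csq z0 s z -> cdiff_at (u k) z.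
  elim: k z => [|k IH] z zin; first by apply: cdiffB; [exact: df|exact: cdiff_cst].
  exact: slope_cdiff zin.
have ub k : (forall j, (j <= k)%N -> u j z0 = 0) ->
    forall z, f z = f z0 + (z - z0) ^+ k.+1 * u k.+1 z.
  elim: k => [|k IH] H z.
    have := slopeE (u 0%N) z0 (der (u 0%N) z0) z; rewrite (H 0%N) // add0r /= => h.
    by rewrite expr1 mulrC -h /u /= addrC subrK.
  rewrite IH; last by move=> j jk; apply: H; exact: leqW.
  rewrite (slopeE (u k.+1) z0 (der (u k.+1) z0) z) (H k.+1) // add0r /= .
  by rewrite [in RHS]exprSr -mulrA [X in _ = _ + _ * X]mulrC.
have [all0|] := pselect (forall k, u k z0 = 0); last first.
  move=> /existsNP [k uk0].
  have exk : exists k, u k z0 != 0 by exists k; apply/eqP.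
  case: (ex_minnP exk) => n un nmin.
  have n0 : (0 < n)%N.
    by rewrite lt0n; apply/eqP => n0; move: un; rewrite n0 /u /= subrr eqxx.
  exists n.-1, (u n); split => //; first by move=> z; exact: du.
  move=> z; have := ub n.-1; rewrite prednK //; apply => j jn.
  by apply/eqP; apply: contraTT (_ : (j < n)%N) => [/nmin|]; rewrite -?leqNgt // -ltnS prednK in jn *.
have cu0 z : csq z0 s z -> ccont (u 0%N) z by move=> /(du 0%N) /cdiff_cont.
have [B B0 HB] := csq_bound (ltW s0) cu0.
have z1in : csq z0 s z1 by apply: nm_csq; lra.
have bound k : nm (f z1 - f z0) <= B / 2 ^+ k.+1.
  have uE := ub k (fun j _ => all0 j).
  have : nm (u k.+1 z1) <= B / s ^+ k.+1.
    apply: (max_modulus s0 (du k.+1)) z1in => z zb.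
    have sz := csqbd_nm zb; have z0' : 0 < nm (z - z0) by lra.
    have -> : u k.+1 z = (f z - f z0) / (z - z0) ^+ k.+1.
      rewrite [in RHS]uE addrAC subrr add0r [in RHS]mulrC mulKf // expf_neq0 //.
      by rewrite -nm_gt0.
    rewrite nmM nmV nmX; apply: ler_pM; rewrite ?nm_ge0 ?invr_ge0 ?exprn_ge0 ?nm_ge0 //.
      exact: HB zb.1.
    rewrite lef_pV2 ?posrE ?exprn_gt0 // lerXn2r ?nnegrE //; lra.
  rewrite uE addrAC subrr add0r nmM nmX => h.
  have h2 : nm (z1 - z0) ^+ k.+1 <= (s / 2) ^+ k.+1.
    by rewrite lerXn2r ?nnegrE ?nm_ge0 //; lra.
  apply: (le_trans (ler_pM _ _ h2 h)); rewrite ?exprn_ge0 ?nm_ge0 //.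
  rewrite expr_div_n; have : s ^+ k.+1 != 0 by rewrite expf_neq0 ?gt_eqF.
  set p := s ^+ k.+1 => p0; have -> : p / 2 ^+ k.+1 * (B / p) = B / 2 ^+ k.+1 * (p / p).
    by ring.
  by rewrite mulfV // mulr1.
have d0 : 0 < nm (f z1 - f z0) by rewrite nm_gt0 subr_eq0.
have [k hk] := half_pow_small B d0.
have := bound k; have : B / 2 ^+ k.+1 <= B / 2 ^+ k.
  apply: ler_wpM2l => //; rewrite lef_pV2 ?posrE ?exprn_gt0 //.
  by apply: ler_weXn2l => //; lra.
lra.
Qed.

(** From f = f(z0) + (z - z0)^(n+1) g one gets f' = (z - z0)^n k, where k is continuous at z0 and
    k(z0) = (n + 1) g(z0) is not 0. *)
Lemma critical_isolated f z0 s : 0 < s -> (forall z, csq z0 s z -> cdiff_at f z) ->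
  (exists2 z, nm (z - z0) <= s / 2 & f z != f z0) ->
  exists2 r, 0 < r & forall z, 0 < nm (z - z0) < r -> csq z0 s z /\ der f z != 0.
Proof.
move=> s0 df nc; have [n [g [dg g0 fE]]] := zero_order s0 df nc.
have z0in : csq z0 s z0 by apply: csqxx; lra.
pose k z := n.+1%:R * g z + (z - z0) * der g z.
have ck : ccont k z0.
  apply: ccontD; first by apply: ccontM; [exact: ccont_cst|exact/cdiff_cont/dg].
  apply: ccontM; last exact/cdiff_cont/(der_cdiff s0 dg).
  by apply: ccontB; [exact: mcont_id|exact: ccont_cst].
have k0 : k z0 != 0.
  by rewrite /k subrr mul0r addr0 mulf_neq0 // pnatr_eq0.
have [d d0 Hd] := near_neq0 ck k0.
exists (Num.min d s); first by rewrite lt_min d0.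
move=> z; rewrite lt_min => /and3P[zz0 zd zs].
have zin : csq z0 s z by apply: nm_csq; exact: ltW.
split => //.
have pw m : cder (fun w => (w - z0) ^+ m.+1) z (m.+1%:R * (z - z0) ^+ m).
  elim: m => [|m IH].
    rewrite mul1r expr0 -[1]addr0; under [fun w => _]eq_fun => w do rewrite expr1.
    by apply: cderD; [exact: cder_id|exact: cder_cst].
  under [fun w => _]eq_fun => w do rewrite exprS.
  have d1 : cder (fun w => w - z0) z (1 + 0).
    by apply: cderD; [exact: cder_id|exact: cder_cst].
  have := cderM d1 IH; congr cder; rewrite -[in RHS]natr1 exprS; ring.
have := cderD (cder_cst (f z0) z) (cderM (pw n) (derP (dg z zin))).
have -> : (fun w => f z0 + (w - z0) ^+ n.+1 * g w) = f by apply: funext => w; rewrite -fE.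
move=> /der_eq ->; rewrite add0r.
have -> : n.+1%:R * (z - z0) ^+ n * g z + (z - z0) ^+ n.+1 * der g z = (z - z0) ^+ n * k z.
  by rewrite /k exprSr; ring.
rewrite mulf_neq0 // ?expf_neq0 -?nm_gt0 //.
by have [] := Hd z; rewrite ?nm_gt0 // dCC.
Qed.

(** Open mapping makes the inverse continuous, and it is differentiable wherever the preimage is not
    critical. Critical points being isolated, only f(z0) is left in doubt, and [removable] settles
    it. *)
Lemma local_inverse f z0 s : 0 < s -> (forall z, csq z0 s z -> cdiff_at f z) ->
  (forall z w, csq z0 s z -> csq z0 s w -> f z = f w -> z = w) ->
  exists psi r, [/\ 0 < r, psi (f z0) = z0 &
    forall w, nm (w - f z0) < r -> [/\ csq z0 s (psi w), f (psi w) = w & cdiff_at psi w]].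
Proof.
move=> s0 df inj; have z0in : csq z0 s z0 by apply: csqxx; lra.
have opn z t : csq z0 (s / 2) z -> 0 < t <= s / 2 -> exists2 m, 0 < m & forall w, nm (w - f z) < m ->
    exists2 z', csq z t z' & f z' = w.
  move=> zin t0.
  have sub v : csq z t v -> csq z0 s v.
    move=> [h1 h2]; case: zin => h3 h4; have E : v - z0 = (v - z) + (z - z0) by ring.
    by split; rewrite E ?(ReD (v - z)) ?(ImD (v - z)); apply: (le_trans (ler_normD _ _)); lra.
  apply: open_square; first lra.
    by move=> v /sub; exact: df.
  move=> v vb; apply/eqP => /inj E; have := csqbd_nm vb.
  have zin' : csq z0 s z by apply: csq_le zin; lra.
  by rewrite E ?subrr ?nm0 //; [lra|apply: sub; case: vb].
have [||r r0 Hr] := opn z0 (s / 2); [by apply: csqxx; lra|lra|].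
have ex w : exists z, nm (w - f z0) < r -> csq z0 (s / 2) z /\ f z = w.
  have [/Hr [z zin fz]|] := pselect (nm (w - f z0) < r); first by exists z.
  by move=> n; exists z0.
have [psi psiP] := choice ex.
have half z : csq z0 (s / 2) z -> csq z0 s z by apply: csq_le; lra.
have psi0 : psi (f z0) = z0.
  have [|h1 h2] := psiP (f z0); first by rewrite subrr nm0.
  by apply: inj => //; exact: half.
have cpsi w : nm (w - f z0) < r -> ccont psi w.
  move=> wr e e0; have [p1 p2] := psiP w wr.
  pose t := Num.min (s / 2) (e / 4).
  have t0 : 0 < t by rewrite lt_min; apply/andP; split; lra.
  have [ts te] : t <= s / 2 /\ t <= e / 4 by rewrite !ge_min !lexx orbT.
  have [|m m0 Hm] := opn (psi w) t p1; first by rewrite t0.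
  exists (Num.min m (r - nm (w - f z0))); first by rewrite lt_min m0 subr_gt0.
  move=> v; rewrite lt_min dCC => /andP[vm vr].
  have vr' : nm (v - f z0) < r by have := nm_tri w v (f z0); rewrite /dC in vr; lra.
  have [q1 q2] := psiP v vr'.
  have [|z' z'in fz'] := Hm v; first by rewrite p2.
  have -> : psi v = z'.
    apply: inj; [exact: half| |by rewrite q2 fz'].
    case: z'in => h1 h2; case: p1 => h3 h4.
    have E : z' - z0 = (z' - psi w) + (psi w - z0) by ring.
    by split; rewrite E ?(ReD (z' - _)) ?(ImD (z' - _)); apply: (le_trans (ler_normD _ _)); lra.
  by rewrite dCC; apply: (le_lt_trans (csq_nm z'in)); lra.
have nc : exists2 z, nm (z - z0) <= s / 2 & f z != f z0.
  have h : nm (z0 + (s / 2)%:C%C - z0) = s / 2.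
    by rewrite (addrC z0) addrK nm_real gtr0_norm //; lra.
  exists (z0 + (s / 2)%:C%C); first by rewrite h.
  apply/eqP => /inj E; have := h; rewrite E ?subrr ?nm0 //; first lra.
  by apply: nm_csq; rewrite h; lra.
have [q q0 Hq] := critical_isolated s0 df nc.
have dpsi w : nm (w - f z0) < r -> der f (psi w) != 0 -> cdiff_at psi w.
  move=> wr dn0; have [p1 p2] := psiP w wr.
  have dfw := derP (df _ (half _ p1)).
  pose k v := (slope f (psi w) (der f (psi w)) (psi v))^-1.
  apply/cdiff_atP; exists (k w); apply: cder_slope.
    apply: ccontV; last by rewrite slopexx.
    by apply: (mcont_comp (g := slope f (psi w) _)); [exact: cpsi|exact: dfw].
  exists (r - nm (w - f z0)); first by rewrite subr_gt0.
  move=> v; rewrite dCC => vr.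
  have vr' : nm (v - f z0) < r by have := nm_tri w v (f z0); rewrite /dC in vr; lra.
  have [q1 q2] := psiP v vr'.
  have [->|vw] := eqVneq v w; first by rewrite subrr mulr0 addr0.
  have pn : psi v != psi w by apply: contra_neq vw => E; rewrite -q2 -p2 E.
  rewrite /k /slope (negbTE pn) q2 p2 invf_div divfK ?subr_eq0 //.
  by rewrite addrC subrK.
have [d d0 Hd] := cpsi (f z0) ltac:(by rewrite subrr nm0) q q0.
pose t := Num.min r d / 4.
have t0 : 0 < t by rewrite divr_gt0 // lt_min r0.
have [tr td] : 2 * t < r /\ 2 * t < d.
  have : Num.min r d <= r by rewrite ge_min lexx.
  have : Num.min r d <= d by rewrite ge_min lexx orbT.
  by rewrite /t in t0 *; split; lra.
have off w : csq (f z0) t w -> w != f z0 -> cdiff_at psi w.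
  move=> /csq_nm h wn; have wr : nm (w - f z0) < r by lra.
  have [p1 p2] := psiP w wr.
  apply: dpsi => //; have [] := Hq (psi w); last by [].
  rewrite nm_gt0 subr_eq0; apply/andP; split.
    by apply: contra_neq wn => E; rewrite -p2 E.
  by have := Hd w; rewrite psi0 dCC => /(_ ltac:(rewrite /dC; lra)); rewrite dCC.
exists psi, t; split => // w wt.
have [|p1 p2] := psiP w; first lra.
split => //; first exact: half.
have [->|wn] := eqVneq w (f z0); last by apply: off => //; apply: nm_csq; exact: ltW.
by apply: (removable t0) => // v /csq_nm h; apply: cpsi; lra.
Qed.

End LocalInverse.

(** * Second order expansions and a discrete Laplacian *)

Section SecondOrderJets.
Variable R : realType.
Local Notation C := (R[i]).
Local Notation nm := (@Normc.normc R).
Local Notation Re := (@complex.Re R).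
Local Notation Im := (@complex.Im R).
Implicit Types (f g : R -> R) (x a b : R).

Lemma rderD f g x a b : is_derive x 1 f a -> is_derive x 1 g b ->
  is_derive x 1 (fun y => f y + g y) (a + b).
Proof. exact: is_deriveD. Qed.

Lemma rderM f g x a b : is_derive x 1 f a -> is_derive x 1 g b ->
  is_derive x 1 (fun y => f y * g y) (a * g x + f x * b).
Proof.
move=> df dg; apply: is_derive_eq (is_deriveM df dg) _.
by rewrite /GRing.scale /= addrC mulrC.
Qed.

Lemma rder_comp f g x a b : is_derive x 1 g b -> is_derive (g x) 1 f a ->
  is_derive x 1 (fun y => f (g y)) (a * b).
Proof. by move=> dg df; exact: (is_derive1_comp df dg). Qed.

Lemma rderV f x a : f x != 0 -> is_derive x 1 f a ->
  is_derive x 1 (fun y => (f y)^-1) (- a / f x ^+ 2).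
Proof.
move=> fx df; apply: is_derive_eq (is_deriveV fx df) _.
by rewrite /GRing.scale /= mulrC mulrN mulNr.
Qed.

Lemma rder_cst c x : is_derive x 1 (fun=> c) (0 : R).
Proof. exact: is_derive_cst. Qed.

Lemma rder_id x : is_derive x 1 (fun y => y) (1 : R).
Proof. exact: is_derive_id. Qed.

Lemma rder_eps f x a : is_derive x 1 f a -> forall e, 0 < e -> exists2 d, 0 < d &
  forall y, `|y - x| < d -> `|f y - f x - a * (y - x)| <= e * `|y - x|.
Proof.
move=> [] /cvg_ex [l hl] dE e e0.
have lE : l = a by rewrite -dE; apply/esym; apply: cvg_lim.
move: hl; rewrite lE => /cvgrPdist_le /(_ e e0) [d /= d0 H].
exists d => // y yd.
have [->|yx] := eqVneq y x; first by rewrite !subrr mulr0 subrr normr0 mulr0.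
have := H (y - x); rewrite /ball_ /= sub0r normrN => /(_ yd).
rewrite subr_eq0 => /(_ yx); rewrite /GRing.scale /= mulr1 subrK => h.
have yx0 : 0 < `|y - x| by rewrite normr_gt0 subr_eq0.
have -> : f y - f x - a * (y - x) = - ((a - (y - x)^-1 * (f y - f x)) * (y - x)).
  by field; rewrite subr_eq0.
by rewrite normrN normrM ler_pM2r.
Qed.

Lemma rder_cont f x a : is_derive x 1 f a -> mcont (@dR R) (@dR R) f x.
Proof.
move=> [df _]; apply/mcont_cvg; apply: differentiable_continuous.
exact/derivable1_diffP.
Qed.

Definition jet2 f x (f1 f2 : R) := forall e, 0 < e -> exists2 d, 0 < d &
  forall h, `|h| < d -> `|f (x + h) - f x - f1 * h - f2 / 2 * h ^+ 2| <= e * h ^+ 2.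

(** The remainder [g] has derivative f1 y - f1 x - f2 (y - x), which is o(y - x); the mean value
    theorem adds one more factor h. *)
Lemma jet2_of_derive f f1 x (f2 d0 : R) : 0 < d0 ->
  (forall y, `|y - x| < d0 -> is_derive y 1 f (f1 y)) -> is_derive x 1 f1 f2 ->
  jet2 f x (f1 x) f2.
Proof.
move=> d00 df df1 e e0; have [d d1 H] := rder_eps df1 e0.
exists (Num.min d0 d); first by rewrite lt_min d00.
move=> h; rewrite lt_min => /andP[h0 hd].
pose g y := f y + (- f x + (- f1 x * (y + - x) + - (f2 / 2) * ((y + - x) * (y + - x)))).
have dlin (y : R) : is_derive y 1 (fun y : R => y + - x) (1 + 0 : R).
  by apply: rderD; first [exact: rder_id|exact: rder_cst].
have dg y : `|y - x| < d0 -> is_derive y 1 g (f1 y - f1 x - f2 * (y - x)).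
  move=> yd.
  apply: (@is_derive_eq _ _ _ _ _ _ _ (f1 y + (0 + ((0 * (y + - x) + - f1 x * (1 + 0)) +
    (0 * ((y + - x) * (y + - x)) + - (f2 / 2) * ((1 + 0) * (y + - x) + (y + - x) * (1 + 0))))))); last by field.
  have dq := rderM (dlin y) (dlin y).
  have dl1 := rderM (rder_cst (- f1 x) y) (dlin y).
  have dq1 := rderM (rder_cst (- (f2 / 2)) y) dq.
  exact: rderD (df y yd) (rderD (rder_cst (- f x) y) (rderD dl1 dq1)).
have gx : g x = 0 by rewrite /g; ring.
have gb a b : a <= b -> `|a - x| < d0 -> `|b - x| < d0 ->
    exists2 c, a <= c <= b & g b - g a = (f1 c - f1 x - f2 * (c - x)) * (b - a).
  move=> ab ad bd.
  have mid c : a <= c <= b -> `|c - x| < d0.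
    by move: ad bd; rewrite !ltr_norml; lra.
  have [||c] := @MVT_segment R g (fun y => f1 y - f1 x - f2 * (y - x)) a b ab.
  - by move=> y; rewrite in_itv /= => /andP[y1 y2]; apply: dg; apply: mid; lra.
  - apply: derivable_within_continuous => y; rewrite in_itv /= => yab.
    by have [] := dg y (mid _ yab).
  by rewrite in_itv /= => cab E; exists c.
have -> : f (x + h) - f x - f1 x * h - f2 / 2 * h ^+ 2 = g (x + h) - g x.
  by rewrite gx subr0 /g; field.
have xd : `|x - x| < d0 by rewrite subrr normr0.
have xhd : `|x + h - x| < d0 by rewrite addrAC subrr add0r.
suff [c cx ->] : exists2 c, `|c - x| <= `|h| &
    g (x + h) - g x = (f1 c - f1 x - f2 * (c - x)) * h.
  rewrite normrM -(real_normK (num_real h)) expr2 mulrA ler_wpM2r //.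
  by apply: (le_trans (H c (le_lt_trans cx hd))); rewrite ler_wpM2l // ltW.
have [h0'|h0'] := leP 0 h.
  have [|c ch E] := gb x (x + h) _ xd xhd; first lra.
  exists c; last by rewrite E; congr (_ * _); ring.
  by rewrite (ger0_norm h0') ler_norml; lra.
have [|c ch E] := gb (x + h) x _ xhd xd; first lra.
exists c; last by rewrite -opprB E; ring.
by rewrite (ltr0_norm h0') ler_norml; lra.
Qed.

(** The class o(t^2) as t decreases to 0. *)
Definition osq (f : R -> R) := forall e, 0 < e -> exists2 d, 0 < d &
  forall t, 0 < t < d -> `|f t| <= e * t ^+ 2.

Lemma osqD f g : osq f -> osq g -> osq (fun t => f t + g t).
Proof.
move=> of_ og e e0; have [d d0 h] := of_ (e / 2) ltac:(lra).
have [d' d'0 h'] := og (e / 2) ltac:(lra).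
exists (Num.min d d'); first by rewrite lt_min d0.
move=> t; rewrite lt_min => /and3P[t0 td td'].
have := h t; have := h' t; rewrite t0 td td' => /(_ isT) h1 /(_ isT) h2.
by apply: (le_trans (ler_normD _ _)); lra.
Qed.

Lemma osqZ c f : osq f -> osq (fun t => c * f t).
Proof.
move=> of_ e e0; have c0 : 0 < `|c| + 1 by have := normr_ge0 c; lra.
have [d d0 h] := of_ (e / (`|c| + 1)) ltac:(by rewrite divr_gt0).
exists d => // t /h h1; rewrite normrM.
apply: (le_trans (ler_wpM2l (normr_ge0 c) h1)); rewrite mulrA.
apply: ler_wpM2r; first exact: sqr_ge0.
by rewrite mulrA ler_pdivrMr // mulrC ler_pM2l //; lra.
Qed.

Lemma osq_ext f g : (forall t, f t = g t) -> osq f -> osq g.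
Proof. by move=> /funext ->. Qed.

Section Expansion.
Variables (dl : R -> R) (al be : R).
Hypothesis hd : osq (fun t => dl t - al * t - be * t ^+ 2).

Lemma expansion_bound : exists2 d, 0 < d & forall t, 0 < t < d ->
  `|dl t - al * t| <= (`|be| + 1) * t ^+ 2 /\ `|dl t| <= (`|al| + `|be| + 1) * t.
Proof.
have [d d0 h] := hd ltr01.
exists (Num.min d 1); first by rewrite lt_min d0 ltr01.
move=> t; rewrite lt_min => /and3P[t0 td t1].
have := h t; rewrite t0 td mul1r => /(_ isT) h1.
have t2 : t ^+ 2 <= t by rewrite expr2; apply: ler_piMr; exact: ltW.
have a1 : `|dl t - al * t| <= (`|be| + 1) * t ^+ 2.
  have -> : dl t - al * t = (dl t - al * t - be * t ^+ 2) + be * t ^+ 2 by ring.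
  apply: (le_trans (ler_normD _ _)); rewrite normrM (ger0_norm (sqr_ge0 t)); lra.
split => //; have -> : dl t = (dl t - al * t) + al * t by ring.
apply: (le_trans (ler_normD _ _)); rewrite normrM (gtr0_norm t0).
have : (`|be| + 1) * t ^+ 2 <= (`|be| + 1) * t.
  by apply: ler_wpM2l => //; have := normr_ge0 be; lra.
lra.
Qed.

Lemma osq_square : osq (fun t => dl t ^+ 2 - al ^+ 2 * t ^+ 2).
Proof.
have [d d0 h] := expansion_bound => e e0.
pose K := (`|be| + 1) * (2 * `|al| + `|be| + 1).
have K0 : 0 < K.
  by apply: mulr_gt0; have := normr_ge0 be; have := normr_ge0 al; lra.
exists (Num.min d (e / K)); first by rewrite lt_min d0 divr_gt0.
move=> t; rewrite lt_min => /and3P[t0 td te].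
have [|h1 h2] := h t; first by rewrite t0.
have -> : dl t ^+ 2 - al ^+ 2 * t ^+ 2 = (dl t - al * t) * (dl t + al * t) by ring.
rewrite normrM; have h3 : `|dl t + al * t| <= (2 * `|al| + `|be| + 1) * t.
  by apply: (le_trans (ler_normD _ _)); rewrite normrM (gtr0_norm t0); lra.
apply: (le_trans (ler_pM (normr_ge0 _) (normr_ge0 _) h1 h3)).
have -> : (`|be| + 1) * t ^+ 2 * ((2 * `|al| + `|be| + 1) * t) = K * t * t ^+ 2 by rewrite /K; ring.
apply: ler_wpM2r; first exact: sqr_ge0.
by rewrite mulrC -ler_pdivlMr // ltW.
Qed.

Lemma osq_jet (tau : R -> R) x t1 t2 : jet2 tau x t1 t2 ->
  osq (fun t => tau (x + dl t) - tau x - t1 * dl t - t2 / 2 * dl t ^+ 2).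
Proof.
have [d d0 h] := expansion_bound => ht e e0.
pose K := `|al| + `|be| + 1.
have K0 : 0 < K by have := normr_ge0 be; have := normr_ge0 al; rewrite /K; lra.
have [d' d'0 h'] := ht (e / K ^+ 2) ltac:(by rewrite divr_gt0 ?exprn_gt0).
exists (Num.min d (d' / K)); first by rewrite lt_min d0 divr_gt0.
move=> t; rewrite lt_min => /and3P[t0 td te].
have [|_] := h t; first by rewrite t0.
rewrite -/K => h2; rewrite ltr_pdivlMr // in te.
apply: (le_trans (h' _ _)); first by apply: (le_lt_trans h2); rewrite mulrC.
have : dl t ^+ 2 <= (K * t) ^+ 2.
  by rewrite -(real_normK (num_real (dl t))) lerXn2r ?nnegrE // mulr_ge0 // ltW.
rewrite exprMn => h3; apply: (le_trans (ler_wpM2l _ h3)).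
  by rewrite divr_ge0 ?sqr_ge0 // ltW.
by rewrite mulrA divfK // expf_neq0 // gt_eqF.
Qed.

End Expansion.

(** The five-point Laplacian: t^2 times the Laplacian of u at w, up to o(t^2). It is at most 0 at a
    local maximum once t is small. *)
Definition sum4 (u : C -> R) (w : C) (t : R) :=
  u (w + t%:C%C) + u (w + t%:C%C * (0 +i* 1)%C) + u (w - t%:C%C)
  + u (w - t%:C%C * (0 +i* 1)%C) - 4 * u w.

(** The quadratic part Re (k h^2) has trace 0: up to second order u is harmonic at w. *)
Definition logjet (u : C -> R) (w a k : C) := forall e, 0 < e -> exists2 d, 0 < d &
  forall h, nm h < d -> `|u (w + h) - u w - Re (a * h) - Re (k * h ^+ 2)| <= e * nm h ^+ 2.

(* The second order terms of a harmonic function cancel over the four points. *)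
Lemma sum4_comp u w (a k : C) tau t1 t2 : logjet u w a k -> jet2 tau (u w) t1 t2 ->
  osq (fun t => sum4 (fun z => tau (u z)) w t - t2 * nm a ^+ 2 * t ^+ 2).
Proof.
move=> hu ht.
pose dl (i : C) t := u (w + t%:C%C * i) - u w.
have hd i : nm i = 1 -> osq (fun t => dl i t - Re (a * i) * t - Re (k * i ^+ 2) * t ^+ 2).
  move=> ni e e0; have [d d0 h] := hu e e0; exists d => // t /andP[t0 td].
  have nt : nm (t%:C%C * i) = t by rewrite nmM ni mulr1 nm_real gtr0_norm.
  have := h (t%:C%C * i); rewrite nt => /(_ td); congr (`|_| <= _).
  rewrite /dl; congr (_ - _ - _).
    by rewrite mulrCA ReM /= mul0r subr0 mulrC.
  rewrite exprMn mulrCA -rmorphXn ReM /= mul0r subr0 mulrC //.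
have n1 : nm 1 = 1 by exact: nm1.
have ni : nm (0 +i* 1)%C = 1 by exact: nm_i.
have nN1 : nm (-1) = 1 by rewrite nmN nm1.
have nNi : nm (- (0 +i* 1)%C) = 1 by rewrite nmN nm_i.
have all i : nm i = 1 -> osq (fun t => tau (u (w + t%:C%C * i)) - tau (u w)
    - t1 * (Re (a * i) * t + Re (k * i ^+ 2) * t ^+ 2) - t2 / 2 * (Re (a * i) ^+ 2 * t ^+ 2)).
  move=> nni; have o1 := osq_jet (hd i nni) ht.
  have o2 := osqZ t1 (hd i nni); have o3 := osqZ (t2 / 2) (osq_square (hd i nni)).
  apply: osq_ext (osqD o1 (osqD o2 o3)) => t.
  have -> : u w + dl i t = u (w + t%:C%C * i) by rewrite /dl addrC subrK.
  ring.
have := osqD (osqD (all 1 n1) (all _ ni)) (osqD (all _ nN1) (all _ nNi)).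
apply: osq_ext => t; rewrite /sum4 nm_sq !mulr1 !mulrN !mulr1.
have E : (0 +i* 1)%C ^+ 2 = -1 :> C by apply: ReImP; rewrite expr2 ?ReM ?ImM /=; ring.
rewrite !sqrrN E expr1n !mulr1 !mulrN !mulr1 !ReN.
rewrite [Re (a * (0 +i* 1)%C)]ReM /=.
by field.
Qed.

Lemma osq_max q (S : R -> R) : osq (fun t => S t - q * t ^+ 2) ->
  (exists2 d, 0 < d & forall t, 0 < t < d -> S t <= 0) -> q <= 0.
Proof.
move=> os [d d0 hS]; rewrite leNgt; apply/negP => q0.
have [d' d'0 h] := os (q / 2) ltac:(lra).
pose t := Num.min d d' / 2.
have t0 : 0 < t by rewrite divr_gt0 // lt_min d0.
have [td td'] : t < d /\ t < d'.
  have : Num.min d d' <= d by rewrite ge_min lexx.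
  have : Num.min d d' <= d' by rewrite ge_min lexx orbT.
  by rewrite /t in t0 *; split; lra.
have := h t; rewrite t0 td' => /(_ isT); have := hS t; rewrite t0 td => /(_ isT).
have t2 : 0 < q * t ^+ 2 by rewrite mulr_gt0 // exprn_gt0.
rewrite ler_norml; lra.
Qed.

Lemma jet2_ln x : 0 < x -> jet2 (@ln R) x x^-1 (- (x ^+ 2)^-1).
Proof.
move=> x0; apply: (@jet2_of_derive _ (fun y => y^-1) _ _ x x0).
  move=> y; rewrite ltr_norml => yx; apply: is_derive1_ln; lra.
have := rderV (f := fun y => y) (lt0r_neq0 x0) (rder_id x).
by rewrite mulNr mul1r.
Qed.

(** ln |1 + z| is ln (1 + y) / 2 with y = 2 Re z + |z|^2, so the real expansion of ln at 1 is
    enough. The constants 3 and 9 come from |y| <= 3 |z|. *)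
Lemma ln_nm_jet e : 0 < e -> exists2 d, 0 < d & forall z : C, nm z < d ->
  `|ln (nm (1 + z)) - Re (z - z ^+ 2 / 2)| <= e * nm z ^+ 2.
Proof.
move=> e0; have e9 : 0 < e / 9 by lra.
have [d d0 H] := jet2_ln ltr01 e9.
rewrite invr1 expr1n invr1 in H.
exists (Num.min (Num.min (1 / 2) (d / 3)) (e / 4)).
  by rewrite !lt_min !divr_gt0.
move=> z; rewrite !lt_min => /andP[/andP[z1 zd] ze].
pose y := 2 * Re z + nm z ^+ 2.
have n0 := nm_ge0 z.
have zz : nm z ^+ 2 <= nm z by rewrite expr2; apply: ler_piMr => //; lra.
have rz := Re_le_nm z; have yb : `|y| <= 3 * nm z.
  apply: (le_trans (ler_normD _ _)); rewrite normrM (ger0_norm (sqr_ge0 _)) (ger0_norm (_ : 0 <= 2)) //; lra.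
have y2 : y ^+ 2 <= 9 * nm z ^+ 2.
  rewrite -(real_normK (num_real y)) (_ : 9 * nm z ^+ 2 = (3 * nm z) ^+ 2); last by ring.
  by rewrite lerXn2r ?nnegrE ?mulr_ge0.
have E1 : nm (1 + z) ^+ 2 = 1 + y.
  by rewrite /y !nm_sq ReD ImD /=; ring.
have p1 : 0 < nm (1 + z).
  by have := nm_lower 1 (- z); rewrite nm1 nmN opprK; lra.
have -> : ln (nm (1 + z)) = ln (1 + y) / 2.
  by rewrite -E1 lnXn // mulr2n; field.
have := H y ltac:(lra); rewrite ln1 subr0 mul1r => h.
have -> : ln (1 + y) / 2 - Re (z - z ^+ 2 / 2) =
  (ln (1 + y) - y - -1 / 2 * y ^+ 2) / 2 - (Re z * nm z ^+ 2 + nm z ^+ 2 * nm z ^+ 2 / 4).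
  have -> : z - z ^+ 2 / 2 = z - z * z * (2^-1)%:C%C.
    by rewrite expr2 fmorphV /= rmorph_nat.
  rewrite ReD ReN !ReM ImM /= mulr0 subr0 /y !nm_sq; by field.
apply: (le_trans (ler_normB _ _)); rewrite normrM (ger0_norm (_ : 0 <= 2^-1)) ?invr_ge0 //.
have k1 : `|Re z * nm z ^+ 2 + nm z ^+ 2 * nm z ^+ 2 / 4| <= (2 * nm z) * nm z ^+ 2.
  have -> : Re z * nm z ^+ 2 + nm z ^+ 2 * nm z ^+ 2 / 4 = (Re z + nm z ^+ 2 / 4) * nm z ^+ 2 by field.
  rewrite normrM (ger0_norm (sqr_ge0 (nm z))); apply: ler_wpM2r; first exact: sqr_ge0.
  apply: (le_trans (ler_normD _ _)); rewrite (ger0_norm (_ : 0 <= nm z ^+ 2 / 4)); last first.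
    by rewrite divr_ge0 ?sqr_ge0.
  lra.
have k2 : 2 * nm z * nm z ^+ 2 <= e / 2 * nm z ^+ 2.
  by apply: ler_wpM2r; [exact: sqr_ge0|lra].
have k3 : e / 9 * y ^+ 2 <= e / 9 * (9 * nm z ^+ 2) by apply: ler_wpM2l => //; lra.
lra.
Qed.

(** With N(w + h) = N(w) (1 + m h) and m = a + b h, the real part of the expansion of log (1 + m h)
    has quadratic coefficient g(w) / N(w) - a^2 / 2. *)
Lemma logjet_ln (N : C -> C) w s : 0 < s -> (forall z, csq w s z -> cdiff_at N z) ->
  N w != 0 -> exists k, logjet (fun z => ln (nm (N z))) w (der N w / N w) k.
Proof.
move=> s0 dN Nw; have [g dg NE] := taylor2 s0 dN.
have win : csq w s w by apply: csqxx; lra.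
pose a := der N w / N w.
pose b h := g (w + h) / N w.
pose m h := a + b h * h.
pose k := g w / N w - a ^+ 2 / 2.
have NwE h : N (w + h) = N w * (1 + m h * h).
  rewrite NE /m /b /a; have -> : w + h - w = h by ring.
  by field.
have cshift : mcont (@dC R) (@dC R) (fun h => w + h) 0.
  by apply: ccontD; [exact: ccont_cst|exact: mcont_id].
have cb : mcont (@dC R) (@dC R) b 0.
  apply: ccontM; last exact: ccont_cst.
  apply: (mcont_comp (g := g) cshift); rewrite addr0.
  exact/cdiff_cont/dg.
have cm : mcont (@dC R) (@dC R) m 0.
  by apply: ccontD; [exact: ccont_cst|apply: ccontM => //; exact: mcont_id].
pose q h := b h - m h ^+ 2 / 2 - k.
have cq : mcont (@dC R) (@dC R) q 0.
  apply: ccontB; last exact: ccont_cst.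
  by apply: ccontB => //; apply: ccontM; [exact: ccontX|exact: ccont_cst].
have q0 : q 0 = 0 by rewrite /q /m /b /k !(addr0, mulr0); ring.
exists k => e e0.
have K0 : 0 < (nm a + 1) ^+ 2 by rewrite exprn_gt0 //; have := nm_ge0 a; lra.
have [d1 d10 H1] := @ln_nm_jet (e / 2 / (nm a + 1) ^+ 2) ltac:(by rewrite !divr_gt0).
have [d2 d20 H2] := cq (e / 2) ltac:(lra).
have [d3 d30 H3] := cm 1 ltr01.
have a0 := nm_ge0 a; have a1 : 0 < nm a + 1 by lra.
exists (Num.min (Num.min d2 d3) (Num.min (d1 / (nm a + 1)) (1 / (2 * (nm a + 1))))).
  by rewrite !lt_min d20 d30 !divr_gt0 ?mulr_gt0.
move=> h; rewrite !lt_min => /andP[/andP[h2 h3] /andP[h1 h4]].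
rewrite ltr_pdivlMr // in h1; rewrite ltr_pdivlMr ?mulr_gt0 // in h4.
have dh : dC 0 h = nm h by rewrite /dC sub0r nmN.
have := H2 h; rewrite dh q0 {1}/dC sub0r nmN => /(_ h2) hq.
have m1 : nm (m h) <= nm a + 1.
  have := H3 h; rewrite dh dCC /dC {2}/m mulr0 addr0 => /(_ h3).
  by have := nm_lower (m h) a; lra.
set z := m h * h.
have nz : nm z <= (nm a + 1) * nm h by rewrite /z nmM ler_wpM2r ?nm_ge0.
have hz := H1 z ltac:(lra).
have z1 : 0 < nm (1 + z).
  by have := nm_lower 1 (- z); rewrite nm1 nmN opprK; lra.
have Nw0 : 0 < nm (N w) by rewrite nm_gt0.
rewrite NwE -/z nmM lnM ?posrE //.
have -> : ln (nm (N w)) + ln (nm (1 + z)) - ln (nm (N w)) - Re (a * h) - Re (k * h ^+ 2) =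
  (ln (nm (1 + z)) - Re (z - z ^+ 2 / 2)) + Re (q h * h ^+ 2).
  have -> : q h * h ^+ 2 = (z - z ^+ 2 / 2) - a * h - k * h ^+ 2.
    by rewrite /z /q {2}/m; field.
  by rewrite !(ReD, ReN); ring.
apply: (le_trans (ler_normD _ _)).
have c1 : `|Re (q h * h ^+ 2)| <= e / 2 * nm h ^+ 2.
  apply: (le_trans (Re_le_nm _)); rewrite nmM nmX ler_wpM2r ?sqr_ge0 //; exact: ltW.
have c2 : e / 2 / (nm a + 1) ^+ 2 * nm z ^+ 2 <= e / 2 * nm h ^+ 2.
  have : nm z ^+ 2 <= (nm a + 1) ^+ 2 * nm h ^+ 2.
    by rewrite -exprMn lerXn2r ?nnegrE ?nm_ge0 // mulr_ge0 ?nm_ge0 // ltW.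
  move=> c; apply: (le_trans (ler_wpM2l _ c)); first by rewrite !divr_ge0 ?sqr_ge0 ?ltW.
  by rewrite mulrA divfK // gt_eqF.
lra.
Qed.

(** Since ln |N| is harmonic, the Laplacian of tau (ln |N|) is tau'' (ln |N|) times |N' / N|^2. *)
Lemma log_sum4 (N : C -> C) w s tau t1 t2 : 0 < s -> (forall z, csq w s z -> cdiff_at N z) ->
  N w != 0 -> jet2 tau (ln (nm (N w))) t1 t2 ->
  osq (fun t => sum4 (fun z => tau (ln (nm (N z)))) w t
    - t2 * (nm (der N w) / nm (N w)) ^+ 2 * t ^+ 2).
Proof.
move=> s0 dN Nw ht; have [k hk] := logjet_ln s0 dN Nw.
by have := sum4_comp hk ht; rewrite nmM nmV.
Qed.

End SecondOrderJets.

(** * A metric of negative curvature on the plane punctured at 0 and 1 *)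

Section Ahlfors.
Variable R : realType.
Local Notation C := (R[i]).
Local Notation nm := (@Normc.normc R).
Local Notation dC := (@dC R).
Local Notation dR := (@dR R).
Implicit Types (x y s p r H : R).

(* exp (tau (ln |z|) + tau (ln |z - 1|)) |dz| is a metric on the plane punctured
   at 0 and 1 whose curvature is bounded above by a negative constant. *)
Definition tau s := ln (1 + expR (s / 3)) / 2 - 5 / 6 * s.

Lemma rder_div3 y : is_derive y 1 (fun s : R => s / 3) 3^-1.
Proof.
apply: is_derive_eq (rderM (rder_id y) (rder_cst 3^-1 y)) _.
by rewrite mul1r mulr0 addr0.
Qed.

Lemma rder_exp3 y : is_derive y 1 (fun s : R => 1 + expR (s / 3)) (expR (y / 3) / 3).
Proof.
apply: is_derive_eq (rderD (rder_cst 1 y)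
  (rder_comp (f := expR) (rder_div3 y) (is_derive_expR _))) _.
by rewrite add0r.
Qed.

Lemma exp3_gt0 y : 0 < 1 + expR (y / 3). Proof. by have := expR_gt0 (y / 3); lra. Qed.

Lemma rder_tau y : is_derive y 1 tau (expR (y / 3) / (1 + expR (y / 3)) / 6 - 5 / 6).
Proof.
have d1 := rder_comp (f := @ln R) (rder_exp3 y) (is_derive1_ln (exp3_gt0 y)).
have d2 := rderM d1 (rder_cst 2^-1 y).
have d3 := rderM (rder_cst (- (5 / 6)) y) (rder_id y).
have -> : tau = (fun s => ln (1 + expR (s / 3)) * 2^-1 + - (5 / 6) * s).
  by apply: funext => s; rewrite /tau mulNr.
apply: is_derive_eq (rderD d2 d3) _.
by have := exp3_gt0 y => ?; field; rewrite gt_eqF.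
Qed.

Lemma jet2_tau x : exists t1, jet2 tau x t1 (expR (x / 3) / (1 + expR (x / 3)) ^+ 2 / 18).
Proof.
pose f1 y := expR (y / 3) / (1 + expR (y / 3)) / 6 - 5 / 6.
exists (f1 x); apply: (jet2_of_derive (d0 := 1) ltr01); first by move=> y _; exact: rder_tau.
have n0 := exp3_gt0 x.
have d1 := rder_comp (f := expR) (rder_div3 x) (is_derive_expR _).
have d2 := rderV (f := fun s => 1 + expR (s / 3)) (lt0r_neq0 n0) (rder_exp3 x).
have d3 := rderM (rderM d1 d2) (rder_cst 6^-1 x).
apply: is_derive_eq (rderD d3 (rder_cst (- (5 / 6)) x)) _.
by field; rewrite gt_eqF.
Qed.

(** At s = ln |w| this is minus the logarithm of the comparison density 1 / (|w| (H^2 - t^2)) on the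
    annulus. *)
Definition sig s0 H s := s + ln (H ^+ 2 - (s - s0) ^+ 2).

Lemma jet2_sig s0 H x : `|x - s0| < H -> exists t1,
  jet2 (sig s0 H) x t1 (- 2 * (H ^+ 2 + (x - s0) ^+ 2) / (H ^+ 2 - (x - s0) ^+ 2) ^+ 2).
Proof.
move=> xs.
have pos y : `|y - s0| < H -> 0 < H ^+ 2 - (y - s0) ^+ 2.
  move=> yh; rewrite subr_gt0 -(real_normK (num_real (y - s0))).
  by rewrite ltr_pXn2r ?nnegrE //; apply: le_trans (ltW yh).
have dlin (y : R) : is_derive y 1 (fun s : R => s + - s0) (1 : R).
  by apply: is_derive_eq (rderD (rder_id y) (rder_cst (- s0) y)) _; rewrite addr0.
have dq (y : R) : is_derive y 1 (fun s : R => H ^+ 2 + -1 * ((s + - s0) * (s + - s0))) (- 2 * (y - s0)).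
  apply: is_derive_eq (rderD (rder_cst (H ^+ 2) y)
    (rderM (rder_cst (-1) y) (rderM (dlin y) (dlin y)))) _; by ring.
have qE : (fun s : R => H ^+ 2 + -1 * ((s + - s0) * (s + - s0))) = fun s => H ^+ 2 - (s - s0) ^+ 2.
  by apply: funext => s; ring.
rewrite qE in dq.
pose f1 y := 1 + (H ^+ 2 - (y - s0) ^+ 2)^-1 * (- 2 * (y - s0)).
exists (f1 x); apply: (jet2_of_derive (d0 := H - `|x - s0|)); first by rewrite subr_gt0.
  move=> y yx; have yH : `|y - s0| < H by have := ler_distD x y s0; lra.
  by apply: rderD (rder_id y) (rder_comp (f := @ln R) (dq y) (is_derive1_ln (pos y yH))).
have d1 := rderV (f := fun s => H ^+ 2 - (s - s0) ^+ 2) (lt0r_neq0 (pos x xs)) (dq x).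
have d2 := rderM (rder_cst (- 2) x) (dlin x).
apply: is_derive_eq (rderD (rder_cst 1 x) (rderM d1 d2)) _.
by have := pos x xs => ?; field; rewrite gt_eqF.
Qed.

(** For |z| = p^3 and |z - 1| = r^3 the left side is the squared density over 54^2, the right side
    the Laplacian of its logarithm. The smaller variable's term suffices: if it is p, then r >= 1/2,
    so 1 + p and 1 + r are at most 3 r, and (3 r)^4 = 81 r^4 <= 162 r^5, where 162 = 54^2 / 18. *)
Lemma curvature_ineq p r : 0 < p -> 0 < r -> 1 <= p ^+ 3 + r ^+ 3 ->
  (1 + p) * (1 + r) / (p ^+ 5 * r ^+ 5) / (54 * 54) <=
  p / (1 + p) ^+ 2 / 18 / p ^+ 6 + r / (1 + r) ^+ 2 / 18 / r ^+ 6.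
Proof.
have main p' r' : 0 < p' -> p' <= r' -> 1 <= p' ^+ 3 + r' ^+ 3 ->
  (1 + p') * (1 + r') / (p' ^+ 5 * r' ^+ 5) / (54 * 54) <= p' / (1 + p') ^+ 2 / 18 / p' ^+ 6.
  move=> p0 pr sum.
  have r0 : 0 < r' by lra.
  have r2 : 1 / 2 <= r'.
    rewrite leNgt; apply/negP => r2.
    have : r' ^+ 3 <= (1 / 2) ^+ 3 by rewrite lerXn2r ?nnegrE; lra.
    have : p' ^+ 3 <= (1 / 2) ^+ 3 by rewrite lerXn2r ?nnegrE; lra.
    lra.
  have h : (1 + p') ^+ 3 * (1 + r') <= (3 * 54) * r' ^+ 5.
    apply: (@le_trans _ _ ((3 * r') ^+ 3 * (3 * r'))).
      by apply: ler_pM; rewrite ?exprn_ge0 ?lerXn2r ?nnegrE; lra.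
    have -> : (3 * r') ^+ 3 * (3 * r') = 81 * r' ^+ 4 by ring.
    rewrite (exprS r' 4); have : 0 <= r' ^+ 4 by rewrite exprn_ge0 // ltW.
    by nra.
  have -> : (1 + p') * (1 + r') / (p' ^+ 5 * r' ^+ 5) / (54 * 54) =
     ((1 + p') ^+ 3 * (1 + r')) * ((p' ^+ 5 * r' ^+ 5)^-1 / (54 * 54) / (1 + p') ^+ 2).
    by field; rewrite !gt_eqF //; lra.
  have -> : p' / (1 + p') ^+ 2 / 18 / p' ^+ 6 =
     ((3 * 54) * r' ^+ 5) * ((p' ^+ 5 * r' ^+ 5)^-1 / (54 * 54) / (1 + p') ^+ 2).
    by field; rewrite !gt_eqF //; lra.
  apply: ler_wpM2r h; apply: divr_ge0; last by apply: exprn_ge0; lra.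
  apply: divr_ge0; last lra.
  by rewrite invr_ge0; apply: mulr_ge0; apply: exprn_ge0; lra.
have nn p' : 0 < p' -> 0 <= p' / (1 + p') ^+ 2 / 18 / p' ^+ 6.
  move=> p0; apply: divr_ge0; last by apply: exprn_ge0; lra.
  by apply: divr_ge0; [apply: divr_ge0; [lra|apply: exprn_ge0; lra]|lra].
move=> p0 r0 sum; case: (leP p r) => pr.
  by have := main p r p0 pr sum; have := nn r r0; lra.
rewrite addrC in sum; have := main r p r0 (ltW pr) sum; have := nn p p0.
by rewrite (mulrC (1 + r)) (mulrC (r ^+ 5)); lra.
Qed.

(** The density is at least 1 / (32 (1 + |z|^2)), a multiple of the spherical one. This converts a
    bound in the punctured metric into one for spherical derivatives. *)
Lemma density_ineq p r : 0 < p -> 0 < r -> r ^+ 3 <= 1 + p ^+ 3 ->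
  1 <= (32 * (1 + p ^+ 6)) ^+ 2 * ((1 + p) * (1 + r) / (p ^+ 5 * r ^+ 5)).
Proof.
move=> p0 r0 h.
have rp : r <= 1 + p.
  rewrite leNgt; apply/negP => rp.
  have : (1 + p) ^+ 3 <= r ^+ 3 by rewrite lerXn2r ?nnegrE; lra.
  have -> : (1 + p) ^+ 3 = 1 + p ^+ 3 + (3 * p + 3 * p ^+ 2) by ring.
  have : 0 < p ^+ 2 by rewrite exprn_gt0.
  lra.
have a1 : (1 + p) ^+ 5 <= 32 * (1 + p ^+ 6).
  have : 0 < p ^+ 6 by rewrite exprn_gt0.
  case: (leP p 1) => p1 h6.
    have : (1 + p) ^+ 5 <= 2 ^+ 5 by rewrite lerXn2r ?nnegrE; lra.
    lra.
  have : (1 + p) ^+ 5 <= (2 * p) ^+ 5 by rewrite lerXn2r ?nnegrE; lra.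
  have : p ^+ 5 <= p ^+ 6 by rewrite ler_eXn2l //; lra.
  rewrite exprMn; lra.
have pr0 : 0 < p ^+ 5 * r ^+ 5 by rewrite mulr_gt0 ?exprn_gt0.
rewrite mulrA ler_pdivlMr // mul1r.
apply: (@le_trans _ _ ((1 + p) ^+ 5 * (1 + p) ^+ 5)).
  by apply: ler_pM; rewrite ?exprn_ge0 ?lerXn2r ?nnegrE; lra.
apply: (@le_trans _ _ ((32 * (1 + p ^+ 6)) ^+ 2)).
  by rewrite expr2; apply: ler_pM; rewrite ?exprn_ge0 //; lra.
rewrite ler_peMr ?sqr_ge0 //.
have -> : (1 + p) * (1 + r) = 1 + (p + r + p * r) by ring.
by have := mulr_gt0 p0 r0; lra.
Qed.

(** The substitution x = p^3 makes the squared density algebraic. *)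
Lemma exp_tau x : 0 < x -> exists2 p, 0 < p & [/\ x = p ^+ 3,
  p = expR (ln x / 3) & expR (tau (ln x)) ^+ 2 = (1 + p) / p ^+ 5].
Proof.
move=> x0; have p0 := expR_gt0 (ln x / 3); exists (expR (ln x / 3)) => //.
have E3 n : expR (ln x / 3) ^+ n = expR (n%:R * (ln x / 3)) by rewrite expRM_natl.
split => //.
  by rewrite E3 mulrC divfK // lnK.
have -> : expR (tau (ln x)) ^+ 2 = expR (2%:R * tau (ln x)) by rewrite expRM_natl.
rewrite E3 /tau.
have -> : 2%:R * (ln (1 + expR (ln x / 3)) / 2 - 5 / 6 * ln x) =
  ln (1 + expR (ln x / 3)) - 5%:R * (ln x / 3) by field.
by rewrite expRB lnK // posrE; exact: exp3_gt0.
Qed.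

End Ahlfors.

(** * Ahlfors' lemma on an annulus *)

Section AhlforsLemma.
Variable R : realType.
Local Notation C := (R[i]).
Local Notation nm := (@Normc.normc R).
Local Notation dc := (@dC R).
Local Notation dr := (@dR R).

Lemma rcont_ln (x : R) : 0 < x -> mcont dr dr (@ln R) x.
Proof. by move=> /is_derive1_ln; exact: rder_cont. Qed.

Lemma cont_ln_nm (N : C -> C) w : mcont dc dc N w -> N w != 0 ->
  mcont dc dr (fun z => ln (nm (N z))) w.
Proof.
move=> cN Nw; apply: (mcont_comp (dY := dr) (cont_nm cN)); apply: rcont_ln.
by rewrite nm_gt0.
Qed.

Variables (F : C -> C) (s0 H H' : R).
Hypotheses (H0 : 0 < H) (HH' : H < H').
Hypothesis dF : forall w, w != 0 -> `|ln (nm w) - s0| < H' ->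
  [/\ cdiff_at F w, F w != 0 & F w != 1].

(** Closed, and strictly inside the annulus of logarithmic half width H' on which F is holomorphic,
    so that a continuous function attains its maximum on it. *)
Let ann w := w != 0 /\ `|ln (nm w) - s0| <= H.

Lemma ann_near w : w != 0 -> `|ln (nm w) - s0| < H' ->
  exists2 s, 0 < s & forall z, csq w s z -> z != 0 /\ `|ln (nm z) - s0| < H'.
Proof.
move=> w0 wH; have ci := mcont_id dc w.
have [d d0 h] := near_neq0 ci w0.
have cl : mcont dc dr (fun z => ln (nm z)) w by exact: cont_ln_nm ci w0.
have [d' d'0 h'] := cl (H' - `|ln (nm w) - s0|) ltac:(lra).
exists (Num.min d d' / 4); first by rewrite divr_gt0 // lt_min d0.
move=> z /csq_nm zw.
have [zd zd'] : dC w z < d /\ dC w z < d'.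
  have : 0 < Num.min d d' by rewrite lt_min d0.
  have : Num.min d d' <= d by rewrite ge_min lexx.
  have : Num.min d d' <= d' by rewrite ge_min lexx orbT.
  by rewrite dCC /dC; split; lra.
split; first by have [] := h z zd.
have := h' z zd'; rewrite dRC /dR => h1.
by have := ler_distD (ln (nm w)) (ln (nm z)) s0; lra.
Qed.

(** The quotient of the density pulled back by F and the comparison density of the annulus; it
    vanishes on the two boundary circles. *)
Let Theta w := expR (tau (ln (nm (F w))) + tau (ln (nm (F w - 1)))) * nm (der F w) * nm w
  * (H ^+ 2 - (ln (nm w) - s0) ^+ 2).

Lemma annP w : expR (s0 - H) <= nm w <= expR (s0 + H) -> ann w.
Proof.
move=> /andP[h1 h2]; have w0 : 0 < nm w by apply: lt_le_trans h1; exact: expR_gt0.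
split; first by rewrite -nm_gt0.
rewrite -[nm w](lnK w0) !ler_expR in h1 h2; rewrite ler_norml; lra.
Qed.

Lemma Pann w : ann w -> expR (s0 - H) <= nm w <= expR (s0 + H).
Proof.
move=> [w0]; rewrite -nm_gt0 in w0; rewrite ler_norml => h.
by rewrite -[nm w](lnK w0) !ler_expR; lra.
Qed.

Lemma F_hol w : ann w -> exists2 s, 0 < s & forall z, csq w s z ->
  [/\ cdiff_at F z, F z != 0, F z != 1 & cdiff_at (der F) z].
Proof.
move=> [w0 wH]; have [s s0' h] := ann_near w0 (le_lt_trans wH HH').
exists s => // z /h [z0 zH]; have [h1 h2 h3] := dF z0 zH; split => //.
have [s' s'0 h'] := ann_near z0 zH.
by apply: (der_cdiff s'0) => v /h' [v0 /(dF v0) []].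
Qed.

Lemma Theta_cont w : ann w -> mcont dc dr Theta w.
Proof.
move=> aw; have [w0 wH] := aw; have [s s0' h] := F_hol aw.
have [h1 h2 h3 h4] := h w (csqxx w (ltW s0')).
have ct (N : C -> C) : mcont dc dc N w -> N w != 0 -> mcont dc dr (fun z => tau (ln (nm (N z)))) w.
  by move=> cN Nw; apply: (mcont_comp (cont_ln_nm cN Nw)); apply: rder_cont (rder_tau _).
have ci := mcont_id dc w.
apply: rcontM; last first.
  have ch : mcont dc dr (fun w => ln (nm w) - s0) w.
    by apply: rcontB; [exact: cont_ln_nm|exact: rcont_cst].
  apply: rcontB; first exact: rcont_cst.
  by under [fun y => _]eq_fun => y do rewrite expr2; exact: rcontM.
apply: rcontM; last exact: cont_nm.
apply: rcontM; last exact/cont_nm/cdiff_cont.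
apply: (mcont_comp (dY := dr)); last exact: rder_cont (is_derive_expR _).
apply: rcontD; apply: ct => //; first exact: cdiff_cont.
  by apply: ccontB; [exact: cdiff_cont|exact: ccont_cst].
by rewrite subr_eq0.
Qed.

(** A positive maximum lies off the boundary circles and the critical points, so ln Theta is defined
    around w and its [sum4] is at most 0. The curvature inequality then gives Theta(w)^2 <= 54^2 * 2
    (H^2 + t^2), and t^2 <= H^2. *)
Lemma Theta_max_bound w : ann w -> (forall z, ann z -> Theta z <= Theta w) ->
  0 < Theta w -> Theta w <= 2 * (54 * H).
Proof.
move=> aw mx T0; have [w0 wH] := aw; have [s s0' h] := F_hol aw.
have [h1 Fw Fw1 h4] := h w (csqxx w (ltW s0')).
have Fw1' : F w - 1 != 0 by rewrite subr_eq0.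
pose t := ln (nm w) - s0.
have tH : `|t| < H.
  rewrite lt_neqAle wH andbT; apply/eqP => E; move: T0.
  by rewrite /Theta -/t -(real_normK (num_real t)) E subrr mulr0 ltxx.
have T2 : 0 < H ^+ 2 - t ^+ 2.
  by rewrite subr_gt0 -(real_normK (num_real t)) ltr_pXn2r ?nnegrE // ltW.
have nw : 0 < nm w by rewrite nm_gt0.
have dn0 : der F w != 0.
  by apply/eqP => E; move: T0; rewrite /Theta E nm0 mulr0 !mul0r ltxx.
pose Lam z := tau (ln (nm (F z))) + tau (ln (nm (F z - 1))) + ln (nm (der F z)) +
  sig s0 H (ln (nm z)).
have LamE z : der F z != 0 -> z != 0 -> 0 < H ^+ 2 - (ln (nm z) - s0) ^+ 2 ->
    Lam z = ln (Theta z) /\ 0 < Theta z.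
  rewrite -!nm_gt0 => a b c; rewrite /Theta.
  have e0 := expR_gt0 (tau (ln (nm (F z))) + tau (ln (nm (F z - 1)))).
  split; last by rewrite !mulr_gt0.
  by rewrite !lnM ?posrE ?mulr_gt0 // expRK /Lam /sig; ring.
have [r r0 near] : exists2 r, 0 < r & forall z, dC w z < r -> Lam z <= Lam w.
  have cd : mcont dc dc (der F) w by exact: cdiff_cont.
  have [d1 d10 k1] := near_neq0 cd dn0.
  have [d2 d20 k2] := near_neq0 (mcont_id dc w) w0.
  have cl : mcont dc dr (fun z => ln (nm z)) w by exact: cont_ln_nm (mcont_id dc w) w0.
  have [d3 d30 k3] := cl (H - `|t|) ltac:(lra).
  exists (Num.min d1 (Num.min d2 d3)); first by rewrite !lt_min d10 d20.
  move=> z; rewrite !lt_min => /and3P[/k1 [z1 _] /k2 [z2 _] /k3 z3].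
  have tz : `|ln (nm z) - s0| < H.
    rewrite dRC /dR in z3; have := ler_distD (ln (nm w)) (ln (nm z)) s0; rewrite -/t; lra.
  have tz2 : 0 < H ^+ 2 - (ln (nm z) - s0) ^+ 2.
    rewrite subr_gt0 -(real_normK (num_real (_ - s0))) ltr_pXn2r ?nnegrE //; exact: ltW.
  have [-> Tz] := LamE z z1 z2 tz2; have [-> _] := LamE w dn0 w0 T2.
  by rewrite ler_ln ?posrE //; apply: mx; split => //; exact: ltW.
have [t1 j1] := jet2_tau (ln (nm (F w))).
have [t2 j2] := jet2_tau (ln (nm (F w - 1))).
have [t3 j3] := jet2_sig tH.
(* ln |F'| is harmonic: here the outer function is the identity, with second derivative 0. *)
have j4 : jet2 id (ln (nm (der F w))) 1 0.
  move=> e e0; exists 1 => // x _; have -> : ln (nm (der F w)) + x - ln (nm (der F w)) - 1 * x - 0 / 2 * x ^+ 2 = 0 by ring.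
  by rewrite normr0 mulr_ge0 ?sqr_ge0 // ltW.
have o1 := log_sum4 s0' (fun z zin => let: And4 a _ _ _ := h z zin in a) Fw j1.
have dF1 z : csq w s z -> cdiff_at (fun z => F z - 1) z.
  by move=> /h [a _ _ _]; apply: cdiffB => //; exact: cdiff_cst.
have o2 := log_sum4 (N := fun z => F z - 1) s0' dF1 Fw1' j2.
have o3 := log_sum4 (N := id) s0' (fun z _ => cdiff_id z) w0 j3.
have o4 := log_sum4 s0' (fun z zin => let: And4 _ _ _ a := h z zin in a) dn0 j4.
have dE1 : der (fun z => F z - 1) w = der F w.
  by apply: der_eq; have := cderD (derP h1) (cder_cst (-1) w); rewrite addr0.
have dE2 : der id w = 1 by apply: der_eq; exact: cder_id.
rewrite dE1 in o2; rewrite dE2 nm1 in o3.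
have [p p0 [pE pE' pe]] : exists2 p, 0 < p & [/\ nm (F w) = p ^+ 3,
  p = expR (ln (nm (F w)) / 3) & expR (tau (ln (nm (F w)))) ^+ 2 = (1 + p) / p ^+ 5].
  by apply: exp_tau; rewrite nm_gt0.
have [q q0 [qE qE' qe]] : exists2 p, 0 < p & [/\ nm (F w - 1) = p ^+ 3,
  p = expR (ln (nm (F w - 1)) / 3) & expR (tau (ln (nm (F w - 1)))) ^+ 2 = (1 + p) / p ^+ 5].
  by apply: exp_tau; rewrite nm_gt0.
rewrite -pE' pE in o1; rewrite -qE' qE in o2; rewrite -/t in o3.
have key := osqD (osqD o1 o2) (osqD o4 o3).
set D := nm (der F w) in key; set W := nm w in key nw.
pose Q := p / (1 + p) ^+ 2 / 18 * (D / p ^+ 3) ^+ 2 + q / (1 + q) ^+ 2 / 18 * (D / q ^+ 3) ^+ 2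
   + - 2 * (H ^+ 2 + t ^+ 2) / (H ^+ 2 - t ^+ 2) ^+ 2 * (1 / W) ^+ 2.
have Q0 : Q <= 0.
  apply: (@osq_max _ Q (fun x => sum4 Lam w x)).
    by apply: osq_ext key => x; rewrite /sum4 /Lam /Q; ring.
  exists r => // x /andP[x0 xr]; rewrite /sum4.
  have nx : nm (x%:C%C) = x by rewrite nm_real gtr0_norm.
  have nxi : nm (x%:C%C * (0 +i* 1)%C) = x by rewrite nmM nm_i mulr1.
  have near' v : nm v = x -> Lam (w + v) <= Lam w.
    by move=> nv; apply: near; rewrite dCC /dC addrAC subrr add0r nv.
  have := near' _ nx; have := near' _ nxi.
  have := near' (- x%:C%C); rewrite nmN => /(_ nx).
  have := near' (- (x%:C%C * (0 +i* 1)%C)); rewrite nmN => /(_ nxi).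
  lra.
have sum1 : 1 <= p ^+ 3 + q ^+ 3.
  rewrite -pE -qE; have := nmB (F w) (F w - 1).
  by rewrite opprB addrC subrK nm1.
have cv := curvature_ineq p0 q0 sum1.
have D0 : 0 < D by rewrite /D nm_gt0.
set T := H ^+ 2 - t ^+ 2 in T2 Q Q0 *.
have ThE : Theta w ^+ 2 = (1 + p) * (1 + q) / (p ^+ 5 * q ^+ 5) * (D * W * T) ^+ 2.
  rewrite /Theta -/D -/W -/t -/T expRD !exprMn pe qe.
  by field; rewrite !gt_eqF.
have b54 : 0 <= 2 * (54 * H) by rewrite !mulr_ge0 // ltW.
suff le2 : Theta w ^+ 2 <= (2 * (54 * H)) ^+ 2.
  by rewrite -(ler_pXn2r (n := 2)) ?nnegrE ?(ltW T0).
have K0 : 0 <= 54 * 54 * (D * W * T) ^+ 2 :> R.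
  by rewrite mulr_ge0 ?sqr_ge0 ?mulr_ge0.
have {}cv := ler_wpM2l K0 cv.
have -> : Theta w ^+ 2 = 54 * 54 * (D * W * T) ^+ 2 * ((1 + p) * (1 + q) / (p ^+ 5 * q ^+ 5) / (54 * 54)).
  by rewrite ThE; field; rewrite !gt_eqF.
apply: (le_trans cv).
have -> : 54 * 54 * (D * W * T) ^+ 2 * (p / (1 + p) ^+ 2 / 18 / p ^+ 6 + q / (1 + q) ^+ 2 / 18 / q ^+ 6) =
   54 * 54 * ((W * T) ^+ 2 * Q + 2 * (H ^+ 2 + t ^+ 2)).
  rewrite /Q; field; rewrite !gt_eqF //; lra.
have : (W * T) ^+ 2 * Q <= 0 by rewrite mulr_ge0_le0 ?sqr_ge0.
have : t ^+ 2 <= H ^+ 2 by rewrite -subr_ge0 ltW.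
have -> : (2 * (54 * H)) ^+ 2 = 54 * 54 * (4 * H ^+ 2) by ring.
clear; lra.
Qed.

Lemma ahlfors w : ann w ->
  nm (der F w) * nm w * (H ^+ 2 - (ln (nm w) - s0) ^+ 2) <=
  32 * (2 * (54 * H)) * (1 + nm (F w) ^+ 2).
Proof.
move=> aw.
have [||||w1 aw1 Hw1] := @extreme_value R ann Theta.
- by exists (expR (s0 + H)) => z /Pann /andP[].
- move=> z nz; pose u : C -> R := fun z => Num.max (expR (s0 - H) - nm z) (nm z - expR (s0 + H)).
  have uz : 0 < u z.
    rewrite ltNge; apply/negP; rewrite /u ge_max !subr_le0 => /annP; exact: nz.
  exists (u z) => // v vz /Pann av.
  have := nm_lower z v; have := nm_lower v z; rewrite (nm_dist v z) -/(dC z v) => k1 k2.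
  by move: vz; rewrite /u; case: (leP (expR (s0 - H) - nm z)) => ?; lra.
- by exists w.
- exact: Theta_cont.
have b54 : 0 <= 2 * (54 * H) by have := H0; lra.
have TB : Theta w <= 2 * (54 * H).
  apply: (le_trans (Hw1 w aw)).
  have [T0|T0] := leP (Theta w1) 0; first exact: le_trans b54.
  exact: Theta_max_bound.
have [w0 wH] := aw; have [s s0' h] := F_hol aw.
have [h1 Fw Fw1 h4] := h w (csqxx w (ltW s0')).
have Fw1' : F w - 1 != 0 by rewrite subr_eq0.
have [p p0 [pE pE' pe]] : exists2 p, 0 < p & [/\ nm (F w) = p ^+ 3,
  p = expR (ln (nm (F w)) / 3) & expR (tau (ln (nm (F w)))) ^+ 2 = (1 + p) / p ^+ 5].
  by apply: exp_tau; rewrite nm_gt0.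
have [q q0 [qE qE' qe]] : exists2 p, 0 < p & [/\ nm (F w - 1) = p ^+ 3,
  p = expR (ln (nm (F w - 1)) / 3) & expR (tau (ln (nm (F w - 1)))) ^+ 2 = (1 + p) / p ^+ 5].
  by apply: exp_tau; rewrite nm_gt0.
have qp : q ^+ 3 <= 1 + p ^+ 3.
  by rewrite -pE -qE; have := nmB (F w) 1; rewrite nm1; lra.
have dn := density_ineq p0 q0 qp.
set rho := expR (tau (ln (nm (F w))) + tau (ln (nm (F w - 1)))).
have rho0 : 0 < rho by exact: expR_gt0.
have rE : rho ^+ 2 = (1 + p) * (1 + q) / (p ^+ 5 * q ^+ 5).
  by rewrite /rho expRD exprMn pe qe; field; rewrite !gt_eqF.
rewrite -rE -exprMn in dn.
have F2 : nm (F w) ^+ 2 = p ^+ 6 by rewrite pE -exprM.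
have p6 : 0 < p ^+ 6 by exact: exprn_gt0.
have d1 : 1 <= 32 * (1 + p ^+ 6) * rho.
  rewrite leNgt; apply/negP => lt1; move: dn; rewrite leNgt => /negP; apply.
  rewrite expr_lte1 // mulr_ge0 ?ltW //; lra.
have wn0 : 0 <= nm (der F w) * nm w * (H ^+ 2 - (ln (nm w) - s0) ^+ 2).
  rewrite !mulr_ge0 ?nm_ge0 // subr_ge0 -(real_normK (num_real (_ - s0))).
  by rewrite lerXn2r ?nnegrE // ltW.
rewrite F2.
have -> : 32 * (2 * (54 * H)) * (1 + p ^+ 6) = 32 * (1 + p ^+ 6) * (2 * (54 * H)) by ring.
have c0 : 0 <= 32 * (1 + p ^+ 6) by lra.
apply: (@le_trans _ _ (32 * (1 + p ^+ 6) * Theta w)); last exact: ler_wpM2l.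
have -> : 32 * (1 + p ^+ 6) * Theta w = (32 * (1 + p ^+ 6) * rho) *
    (nm (der F w) * nm w * (H ^+ 2 - (ln (nm w) - s0) ^+ 2)).
  by rewrite /Theta -/rho; ring.
by rewrite ler_peMl.
Qed.

End AhlforsLemma.

(** * The chordal metric in homogeneous coordinates *)

Section ChordalMetric.
Variable R : realType.
Local Notation C := (R[i]).
Local Notation nm := (@Normc.normc R).
Local Notation dc := (@dC R).
Local Notation d := (@chordal R).
Implicit Types (u v w : C * C) (s t : sphere R).

(** Points of the sphere are lines in C^2, and their chordal distance is 2 |det(v, w)| / (|v| |w|);
    infinity then needs no separate cases. *)
Definition hdet v w := v.1 * w.2 - w.1 * v.2.
Definition hn v : R := Num.sqrt (nm v.1 ^+ 2 + nm v.2 ^+ 2).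
Definition proj v : sphere R := if v.2 == 0 then None else Some (v.1 / v.2).
Definition lift s : C * C := if s is Some z then (z, 1) else (1, 0).
Definition scl (c : C) v := (c * v.1, c * v.2).

Lemma hn_ge0 v : 0 <= hn v. Proof. exact: sqrtr_ge0. Qed.

Lemma hn_sq v : hn v ^+ 2 = nm v.1 ^+ 2 + nm v.2 ^+ 2.
Proof. by rewrite sqr_sqrtr // addr_ge0 ?sqr_ge0. Qed.

Lemma hn_eq0 v : (hn v == 0) = (v == (0, 0)).
Proof.
rewrite sqrtr_eq0 le_eqVlt ltNge addr_ge0 ?sqr_ge0 // orbF paddr_eq0 ?sqr_ge0 //.
by rewrite !sqrf_eq0 !nm_eq0; case: v.
Qed.

Lemma hn_gt0 v : (0 < hn v) = (v != (0, 0)).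
Proof. by rewrite lt_neqAle hn_ge0 andbT eq_sym hn_eq0. Qed.

Lemma hn_scl c v : hn (scl c v) = nm c * hn v.
Proof.
rewrite /hn !nmM !exprMn -mulrDr sqrtrM ?sqr_ge0 //.
by rewrite sqrtr_sqr ger0_norm ?nm_ge0.
Qed.

Lemma hn_le v : hn v <= nm v.1 + nm v.2.
Proof.
have h1 := nm_ge0 v.1; have h2 := nm_ge0 v.2.
rewrite -(ler_pXn2r (n := 2)) ?nnegrE ?hn_ge0 ?addr_ge0 // hn_sq.
have -> : (nm v.1 + nm v.2) ^+ 2 = nm v.1 ^+ 2 + nm v.2 ^+ 2 + 2 * (nm v.1 * nm v.2) by ring.
by rewrite lerDl !mulr_ge0.
Qed.

Lemma hn_cauchy (a b x y : R) : 0 <= a -> 0 <= b -> 0 <= x -> 0 <= y ->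
  a * x + b * y <= Num.sqrt (a ^+ 2 + b ^+ 2) * Num.sqrt (x ^+ 2 + y ^+ 2).
Proof.
move=> a0 b0 x0 y0; rewrite -sqrtrM ?addr_ge0 ?sqr_ge0 //.
rewrite -(ler_pXn2r (n := 2)) ?nnegrE ?sqrtr_ge0 ?addr_ge0 ?mulr_ge0 //.
rewrite sqr_sqrtr ?mulr_ge0 ?addr_ge0 ?sqr_ge0 //.
have -> : (a ^+ 2 + b ^+ 2) * (x ^+ 2 + y ^+ 2) =
  (a * x + b * y) ^+ 2 + (a * y - b * x) ^+ 2 by ring.
by rewrite lerDl sqr_ge0.
Qed.

Lemma hdet_le v w : nm (hdet v w) <= hn v * hn w.
Proof.
apply: (le_trans (nmB _ _)); rewrite !nmM /hn [nm w.1 ^+ 2 + _]addrC.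
by rewrite (mulrC (nm w.1)); apply: hn_cauchy; exact: nm_ge0.
Qed.

Lemma hnD v w : hn (v.1 + w.1, v.2 + w.2) <= hn v + hn w.
Proof.
rewrite -(ler_pXn2r (n := 2)) ?nnegrE ?addr_ge0 ?hn_ge0 // hn_sq /=.
have : nm (v.1 + w.1) ^+ 2 <= (nm v.1 + nm w.1) ^+ 2.
  by rewrite lerXn2r ?nnegrE ?addr_ge0 ?nm_ge0 ?nmD.
have : nm (v.2 + w.2) ^+ 2 <= (nm v.2 + nm w.2) ^+ 2.
  by rewrite lerXn2r ?nnegrE ?addr_ge0 ?nm_ge0 ?nmD.
have := hn_cauchy (nm_ge0 v.1) (nm_ge0 v.2) (nm_ge0 w.1) (nm_ge0 w.2).
have sq (a b : R) : (a + b) ^+ 2 = a ^+ 2 + b ^+ 2 + 2 * (a * b) by ring.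
rewrite -/(hn v) -/(hn w) !sq !hn_sq; lra.
Qed.

Lemma lift_nz s : lift s != (0, 0).
Proof. by case: s => [z|]; rewrite /= xpair_eqE ?oner_eq0 ?andbF. Qed.

Lemma chordalE s t : d s t = 2 * nm (hdet (lift s) (lift t)) / (hn (lift s) * hn (lift t)).
Proof.
have h1 z : hn (z, 1) = Num.sqrt (1 + nm z ^+ 2) by rewrite /hn [(_, _).1]/= [(_, _).2]/= nm1 expr1n addrC.
have h0 : hn (1, 0) = 1.
  by rewrite /hn [(_, _).1]/= [(_, _).2]/= nm1 nm0 expr1n expr0n addr0 sqrtr1.
have pr (x y : C) : ((x, y).1 = x) * ((x, y).2 = y) by [].
case: s => [z|]; case: t => [w|]; rewrite /chordal /lift /hdet !pr ?h1 ?h0.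
- by rewrite !mulr1 sqrtrM // addr_ge0 ?sqr_ge0.
- by rewrite mulr0 mul1r sub0r nmN nm1 !mulr1.
- by rewrite mulr0 subr0 mulr1 nm1 mulr1 mul1r.
- by rewrite mulr0 subrr nm0 mulr0 mul0r.
Qed.

Lemma proj_lift s : proj (lift s) = s.
Proof. by case: s => [z|]; rewrite /proj /= ?eqxx // oner_eq0 divr1. Qed.

Lemma lift_proj v : v != (0, 0) -> exists2 c, c != 0 & v = scl c (lift (proj v)).
Proof.
case: v => p q; rewrite /proj /= xpair_eqE negb_and; case: (eqVneq q 0) => [->|q0] h.
  by exists p; [rewrite orbF in h|rewrite /scl /= mulr1 mulr0].
by exists q => //; rewrite /scl /= mulr1 mulrC divfK.
Qed.

Lemma hdet_scl a b v w : hdet (scl a v) (scl b w) = a * b * hdet v w.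
Proof. by rewrite /hdet /=; ring. Qed.

Lemma chordal_proj v w : v != (0, 0) -> w != (0, 0) ->
  d (proj v) (proj w) = 2 * nm (hdet v w) / (hn v * hn w).
Proof.
move=> v0 w0; have [a a0 Ea] := lift_proj v0; have [b b0 Eb] := lift_proj w0.
rewrite chordalE {3 4}Ea {3 4}Eb hdet_scl !hn_scl !nmM.
have := lift_nz (proj v); have := lift_nz (proj w); rewrite -!hn_gt0 => h1 h2.
by field; rewrite !gt_eqF // nm_gt0.
Qed.

Lemma chordalC s t : d s t = d t s.
Proof.
by rewrite !chordalE (mulrC (hn _)) -[in RHS]nmN; congr (2 * nm _ / _); rewrite /hdet; ring.
Qed.

Lemma chordalxx s : d s s = 0.
Proof. by rewrite chordalE /hdet subrr nm0 mulr0 mul0r. Qed.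

Lemma chordal_ge0 s t : 0 <= d s t.
Proof. by rewrite chordalE divr_ge0 ?mulr_ge0 ?nm_ge0 ?hn_ge0. Qed.

Lemma chordal_le2 s t : d s t <= 2.
Proof.
rewrite chordalE; have := lift_nz s; have := lift_nz t; rewrite -!hn_gt0 => h1 h2.
by rewrite ler_pdivrMr ?mulr_gt0 // ler_pM2l // hdet_le.
Qed.

Lemma chordal_eq0 s t : d s t = 0 -> s = t.
Proof.
rewrite chordalE; have := lift_nz s; have := lift_nz t; rewrite -!hn_gt0 => h1 h2 /eqP.
rewrite mulf_eq0 invr_eq0 !mulf_eq0 (gt_eqF h1) (gt_eqF h2) !orbF pnatr_eq0 /= nm_eq0.
rewrite /hdet; case: s {h1 h2} => [z|]; case: t => [w|] //=.
- by rewrite !mulr1 subr_eq0 => /eqP ->.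
- by rewrite mulr0 mulr1 sub0r oppr_eq0 oner_eq0.
- by rewrite mulr0 subr0 mulr1 oner_eq0.
Qed.

(* Pluecker: det(u,w) v = det(v,w) u + det(u,v) w. *)
Lemma chordal_tri t s r : d s r <= d s t + d t r.
Proof.
have := lift_nz s; have := lift_nz t; have := lift_nz r; rewrite -!hn_gt0.
rewrite !chordalE; set u := lift s; set v := lift t; set w := lift r => w0 v0 u0.
have : nm (hdet u w) * hn v <= nm (hdet v w) * hn u + nm (hdet u v) * hn w.
  rewrite -!hn_scl; have := hnD (scl (hdet v w) u) (scl (hdet u v) w).
  by congr (hn _ <= _); rewrite /scl /hdet /=; congr (_, _); ring.
move=> h; rewrite ler_pdivrMr ?mulr_gt0 //.
have -> : (2 * nm (hdet u v) / (hn u * hn v) + 2 * nm (hdet v w) / (hn v * hn w)) *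
    (hn u * hn w) = 2 * (nm (hdet v w) * hn u + nm (hdet u v) * hn w) / hn v.
  by field; rewrite !gt_eqF.
by rewrite ler_pdivlMr // -mulrA ler_pM2l.
Qed.

(** The determinant against the value at x tends to 0, while the norm of (p y, q y) stays above half
    of its value at x. *)
Lemma mcont_proj (X : Type) (dX : X -> X -> R) (p q : X -> C) x :
  mcont dX dc p x -> mcont dX dc q x -> (p x, q x) != (0, 0) ->
  mcont dX d (fun y => proj (p y, q y)) x.
Proof.
move=> cp cq nz; set v := (p x, q x); have v0 : 0 < hn v by rewrite hn_gt0.
pose D y := hdet v (p y, q y).
have cD : mcont dX dc D x.
  rewrite /D /hdet /=; apply: ccontB; apply: ccontM => //; exact: ccont_cst.
have Dx : D x = 0 by rewrite /D /hdet subrr.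
move=> e e0.
have [d1 d10 h1] := cD (e * hn v ^+ 2 / 8) ltac:(by rewrite divr_gt0 // mulr_gt0 // exprn_gt0).
have [d2 d20 h2] := cp (hn v / 4) ltac:(by rewrite divr_gt0).
have [d3 d30 h3] := cq (hn v / 4) ltac:(by rewrite divr_gt0).
exists (Num.min d1 (Num.min d2 d3)); first by rewrite !lt_min d10 d20.
move=> y; rewrite !lt_min => /and3P[/h1 k1 /h2 k2 /h3 k3].
set w := (p y, q y); have hw : hn v / 2 <= hn w.
  have := hnD (p x - p y, q x - q y) w; rewrite /= !subrK -/v.
  by have := hn_le (p x - p y, q x - q y) => /=; rewrite /dC in k2 k3; lra.
have w0 : 0 < hn w by lra.
rewrite chordal_proj -?hn_gt0 // ltr_pdivrMr ?mulr_gt0 //.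
rewrite Dx dCC /dC subr0 -/w in k1.
apply: (@lt_le_trans _ _ (e * (hn v * (hn v / 2)))).
  have -> : e * (hn v * (hn v / 2)) = 4 * (e * hn v ^+ 2 / 8) by field.
  have := nm_ge0 (D y); have : 0 < e * hn v ^+ 2 / 8 by rewrite divr_gt0 // mulr_gt0 // exprn_gt0.
  rewrite -/(D y); lra.
by apply: ler_wpM2l; [exact: ltW|apply: ler_wpM2l; [exact: ltW|]].
Qed.

Definition sinv s : sphere R := proj ((lift s).2, (lift s).1).
(** [true] selects the chart z -> 1/z at infinity. Inversion is an isometry, so metric statements
    about that chart reduce to the finite one. *)
Definition chart (b : bool) (z : C) : sphere R := if b then sinv (Some z) else Some z.

Lemma swap_nz v : v != (0, 0) -> (v.2, v.1) != (0, 0).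
Proof. by case: v => p q /=; rewrite !xpair_eqE andbC. Qed.

Lemma chordal_sinv s t : d (sinv s) (sinv t) = d s t.
Proof.
rewrite chordal_proj ?swap_nz ?lift_nz // chordalE -[in RHS]nmN.
have hs v : hn (v.2, v.1) = hn v by rewrite /hn addrC.
by rewrite !hs; congr (2 * nm _ / _); rewrite /hdet /=; ring.
Qed.

Lemma sinvK s : sinv (sinv s) = s.
Proof.
case: s => [z|]; rewrite /sinv /= /proj /=; last by rewrite oner_eq0 /= mul0r eqxx.
case: (eqVneq z 0) => [->|z0] /=; first by rewrite oner_eq0 mul0r.
by rewrite !mul1r invr_eq0 (negbTE z0) invrK.
Qed.

Lemma chartE b z : chart b z = if b then proj (1, z) else proj (z, 1).
Proof. by case: b; rewrite /chart // /proj /= oner_eq0 divr1. Qed.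

Lemma chart_true z : chart true z = if z == 0 then None else Some z^-1.
Proof. by rewrite chartE /proj /=; case: eqP => //; rewrite mul1r. Qed.

Lemma chart_cont b z : mcont dc d (chart b) z.
Proof.
have -> : chart b = fun z => if b then proj (1, z) else proj (z, 1).
  by apply: funext => w; rewrite chartE.
by case: b; apply: mcont_proj; rewrite ?xpair_eqE ?oner_eq0 ?andbF //;
   first [exact: mcont_id|exact: ccont_cst].
Qed.

Lemma chart_surj s : exists b z, nm z <= 1 /\ s = chart b z.
Proof.
case: s => [z|]; last by exists true, 0; rewrite nm0 chart_true eqxx.
have [z1|z1] := leP (nm z) 1; first by exists false, z.
have z0 : z != 0 by rewrite -nm_gt0; lra.
exists true, z^-1; rewrite chart_true invr_eq0 (negbTE z0) invrK; split => //.
by rewrite nmV invf_le1 ?nm_gt0 // ltW.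
Qed.

Lemma chart_inj b : injective (chart b).
Proof.
case: b => z w; last by case.
by move=> /(congr1 sinv); rewrite /chart !sinvK => -[].
Qed.

Lemma chart_inv b z0 e : 0 < e -> exists2 r, 0 < r &
  forall s, d (chart b z0) s < r -> exists2 z, dc z0 z < e & s = chart b z.
Proof.
move=> e0; suff [r r0 H] : exists2 r, 0 < r &
    forall s, d (Some z0) s < r -> exists2 z, dc z0 z < e & s = Some z.
  exists r => // s; case: b; last exact: H.
  rewrite /chart -(sinvK s) chordal_sinv => /H [z ze ->]; by exists z.
have h0 : 0 < hn (z0, 1) by rewrite hn_gt0 xpair_eqE oner_eq0 andbF.
have n0 := nm_ge0 z0.
(* The factor 2 / hn cancels the normalisation of the distance. The bound 1/2 excludes infinity and
   absorbs half of |z0 - z|; the other entry makes the rest at most e / 4. *)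
pose r := Num.min (1 / 2) (e / (4 * (nm z0 + 1))) * (2 / hn (z0, 1)).
have r0 : 0 < r by rewrite mulr_gt0 ?divr_gt0 // lt_min !divr_gt0 // mulr_gt0 //; lra.
exists r => // s; rewrite chordalE; set v := lift s.
have v0 : 0 < hn v by rewrite hn_gt0 lift_nz.
rewrite /r [lift (Some z0)]/= => hs.
have : nm (hdet (z0, 1) v) < Num.min (1 / 2) (e / (4 * (nm z0 + 1))) * hn v.
  have E : 2 * nm (hdet (z0, 1) v) / (hn (z0, 1) * hn v) =
     nm (hdet (z0, 1) v) / hn v * (2 / hn (z0, 1)) by field; rewrite !gt_eqF.
  by rewrite E ltr_pM2r ?divr_gt0 // ltr_pdivrMr in hs.
rewrite /v {v v0 hs}; case: s => [z|]; rewrite [lift _]/=; last first.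
  rewrite /hdet /hn [(_, _).1]/= [(_, _).2]/= [(z0, _).2]/= mulr0 sub0r mulr1 nmN nm1 nm0 expr1n expr0n addr0 sqrtr1 mulr1.
  have : Num.min (1 / 2) (e / (4 * (nm z0 + 1))) <= 1 / 2 by rewrite ge_min lexx.
  lra.
set v := (z, 1); have hv : hn v <= nm (z0 - z) + (nm z0 + 1).
  apply: (le_trans (hn_le _)); rewrite /v [(_, _).1]/= [(_, _).2]/= nm1.
  by have := nm_lower z z0; rewrite nm_dist; lra.
rewrite {1}/v /hdet [(_, _).1]/= [(z, _).1]/= [(z0, _).2]/= [(z, _).2]/= !mulr1 -/(dC z0 z) => h; exists z => //.
 rewrite -[nm (z0 - z)]/(dC z0 z) in hv.
have dn : 0 <= dc z0 z by exact: nm_ge0.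
have m1 : Num.min (1 / 2) (e / (4 * (nm z0 + 1))) <= 1 / 2 by rewrite ge_min lexx.
have m2 : Num.min (1 / 2) (e / (4 * (nm z0 + 1))) <= e / (4 * (nm z0 + 1)).
  by rewrite ge_min lexx orbT.
set m := Num.min _ _ in h m1 m2.
have a1 : m * hn v <= 1 / 2 * dc z0 z + m * (nm z0 + 1).
  have m0 : 0 <= m by rewrite le_min !divr_ge0 // ?mulr_ge0 ?ltW //; lra.
  apply: (le_trans (ler_wpM2l m0 hv)); rewrite mulrDr lerD2r.
  by apply: ler_wpM2r.
have a2 : m * (nm z0 + 1) <= e / 4.
  have -> : e / 4 = e / (4 * (nm z0 + 1)) * (nm z0 + 1) by field; rewrite gt_eqF //; lra.
  by apply: ler_wpM2r => //; lra.
lra.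
Qed.

End ChordalMetric.

(** * Comparison of the metrics, compactness of the sphere, and normality in chordal terms *)

Section SphereTopology.
Variable R : realType.
Local Notation C := (R[i]).
Local Notation nm := (@Normc.normc R).
Local Notation dc := (@dC R).
Local Notation d := (@chordal R).
Local Notation S := (sphere R).
Implicit Types (p q s t : S) (r e : R) (A B U V : set S) (F : set (S -> S)).

Lemma sin_mvt (y : R) : 0 <= y -> exists2 c, 0 <= c <= y & sin y = cos c * y.
Proof.
move=> y0; have [|c] := @MVT_segment R sin cos 0 y y0 (fun x _ => is_derive_sin x).
  by apply: continuous_subspaceT => x; exact: continuous_sin.
by rewrite in_itv /= sin0 !subr0 => cy E; exists c.
Qed.

Lemma sin_le_id (y : R) : 0 <= y -> sin y <= y.
Proof. by move=> y0; have [c _ ->] := sin_mvt y0; rewrite ler_piMl // cos_le1. Qed.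

(** Doubling the angle: sin y = 2 sin(y/2) cos(y/2), and sin(y/2) is y/2 times another cosine. Both
    cosines are at least cos(pi/4), whose square is 1/2. *)
Lemma half_le_sin (y : R) : 0 <= y <= pi / 2 -> y / 2 <= sin y.
Proof.
move=> /andP[y0 yp]; pose k : R := cos (pi / 4).
have pi0 := pi_ge0 R.
have p4 : pi / 4 + pi / 4 = pi / 2 :> R by field.
have k2 : k * k = 1 / 2.
  have := cosD (pi / 4 : R) (pi / 4); rewrite p4 cos_pihalf -/k.
  by have := cos2Dsin2 (pi / 4 : R); rewrite -/k !expr2; lra.
have kle x : 0 <= x <= pi / 4 -> k <= cos x.
  by move=> xp; rewrite /k leNgt ltr_cos ?in_itv /= -?leNgt; lra.
have k0 : 0 <= k by apply: cos_ge0_pihalf; lra.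
have y2 : 0 <= y / 2 by lra.
have [c cy E] := sin_mvt y2.
have -> : sin y = 2 * (sin (y / 2) * cos (y / 2)).
  by rewrite {1}(splitr y) sinD; ring.
rewrite E; have h1 := kle c ltac:(lra); have h2 := kle (y / 2) ltac:(lra).
have h3 : k * k <= cos c * cos (y / 2) by apply: ler_pM.
have : k * k * (y / 2) <= cos c * cos (y / 2) * (y / 2) by apply: ler_wpM2r.
rewrite k2; lra.
Qed.

Lemma chordal_half_itv s t : 0 <= d s t / 2 <= 1.
Proof. by have := chordal_ge0 s t; have := chordal_le2 s t; lra. Qed.

Lemma asin_chordal s t : 0 <= asin (d s t / 2) <= pi / 2 /\ sin (asin (d s t / 2)) = d s t / 2.
Proof.
have h := chordal_half_itv s t; have [|h1 h2] := @asin_def R (d s t / 2); first lra.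
split => //; rewrite (andP h1).2 andbT leNgt; apply/negP => neg.
have pi0 := pi_ge0 R.
have : sin (asin (d s t / 2)) < sin 0 by rewrite ltr_sin // in_itv /=; lra.
by rewrite h2 sin0; lra.
Qed.

(** Together with [sigma_le_chordal] this makes the two metrics equivalent, so open sets and normal
    families can be treated with the chordal one. *)
Lemma chordal_le_sigma s t : d s t <= sigma s t.
Proof.
have [h1 h2] := asin_chordal s t; have := @sin_le_id (asin (d s t / 2)).
by rewrite h2 /sigma => /(_ ltac:(lra)); lra.
Qed.

Lemma sigma_le_chordal s t : sigma s t <= 2 * d s t.
Proof.
have [h1 h2] := asin_chordal s t; have := half_le_sin h1.
by rewrite h2 /sigma; lra.
Qed.

Lemma sigma_ge0 s t : 0 <= sigma s t.
Proof. exact: le_trans (chordal_ge0 s t) (chordal_le_sigma s t). Qed.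

Definition dball p r : set S := [set q | d p q < r].
Definition dopen U := forall p, U p -> exists2 r, 0 < r & dball p r `<=` U.

Lemma dball_center p r : 0 < r -> dball p r p.
Proof. by move=> r0; rewrite /dball /= chordalxx. Qed.

Lemma dopen_dball p r : dopen (dball p r).
Proof.
move=> q qr; exists (r - d p q); first by rewrite subr_gt0.
by move=> t; rewrite /dball /= => tq; have := chordal_tri q p t; lra.
Qed.

Lemma dball_sub_sball p r : dball p (r / 2) `<=` sball p r.
Proof. by move=> q; rewrite /dball /sball /=; have := sigma_le_chordal p q; lra. Qed.

Lemma sball_sub_dball p r : sball p r `<=` dball p r.
Proof. by move=> q; rewrite /dball /sball /=; have := chordal_le_sigma p q; lra. Qed.

Lemma sopenP U : sopen U <-> dopen U.
Proof.
split=> H p /H [r r0 h].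
  by exists (r / 2); [lra|move=> q /dball_sub_sball /h].
by exists r => // q /sball_sub_dball /h.
Qed.

(** The triangle inequality is used for the chordal distance alone: monotonicity of the sine turns
    the condition on the angle into one on that distance. *)
Lemma dopen_sball p r : dopen (sball p r).
Proof.
move=> q; rewrite /sball /= /sigma => qr.
have [h1 h2] := asin_chordal p q; set y := asin _ in qr h1 h2.
have mono t : asin (d p t / 2) < r / 2 -> sball p r t by rewrite /sball /= /sigma; lra.
have [yp|yp] := leP (pi / 2) y.
  by exists 1 => // t _; apply: mono; have [] := asin_chordal p t; lra.
pose y' := Num.min (r / 2) (pi / 2).
have yy' : y < y' by rewrite lt_min yp andbT; lra.
have yr : y' <= r / 2 by rewrite ge_min lexx.
have yp' : y' <= pi / 2 by rewrite ge_min lexx orbT.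
have sy : sin y < sin y'.
  by rewrite ltr_sin ?in_itv /=; lra.
exists (2 * (sin y' - sin y)); first by rewrite mulr_gt0 // subr_gt0.
move=> t tq; apply: mono; have [k1 k2] := asin_chordal p t.
apply: lt_le_trans yr; rewrite ltNge; apply/negP => ge.
have : sin y' <= sin (asin (d p t / 2)) by rewrite leNgt ltr_sin ?in_itv /= -?leNgt; lra.
rewrite /dball /= in tq; rewrite k2; have := chordal_tri q p t; lra.
Qed.

Definition dnormal F U := forall h : nat -> S -> S, (forall n, F (h n)) ->
  exists (s : nat -> nat) (phi : S -> S), (forall n, (s n < s n.+1)%N) /\
    forall p, U p -> exists r, 0 < r /\ dball p r `<=` U /\
      forall e, 0 < e -> exists N, forall n, (N <= n)%N ->
        forall q, dball p r q -> d (h (s n) q) (phi q) < e.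

Lemma normal_onP F U : normal_on F U <-> dnormal F U.
Proof.
split=> H h /H [s [phi [sm c]]]; exists s, phi; split => // p /c [r [r0 [rU un]]].
  exists (r / 2); split; first lra.
  split; first by move=> q /dball_sub_sball /rU.
  move=> e /un [N hN]; exists N => n /hN hn q /dball_sub_sball /hn.
  exact: le_lt_trans (chordal_le_sigma _ _).
exists r; split => //; split; first by move=> q /sball_sub_dball /rU.
move=> e e0; have [|N hN] := un (e / 2); first lra.
exists N => n /hN hn q /sball_sub_dball /hn.
by have := sigma_le_chordal (h (s n) q) (phi q); lra.
Qed.

Lemma dnormal_sub F U V : V `<=` U -> dopen V -> dnormal F U -> dnormal F V.
Proof.
move=> VU oV H h /H [s [phi [sm c]]]; exists s, phi; split => // p Vp.
have [r [r0 [rU un]]] := c p (VU _ Vp); have [r' r'0 rV] := oV p Vp.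
exists (Num.min r r'); split; first by rewrite lt_min r0.
split; first by move=> q; rewrite /dball /= lt_min => /andP[_ /rV].
move=> e /un [N hN]; exists N => n /hN hn q.
by rewrite /dball /= lt_min => /andP[/hn].
Qed.

Lemma fatouP F p : fatou F p <-> exists2 r, 0 < r & dnormal F (dball p r).
Proof.
split=> [[r r0 /normal_onP h]|[r r0 h]].
  exists (r / 2); first lra.
  exact: dnormal_sub (@dball_sub_sball p r) (@dopen_dball _ _) h.
exists r => //; apply/normal_onP.
exact: dnormal_sub (@sball_sub_dball p r) (@dopen_sball _ _) h.
Qed.

Lemma dopen_fatou F : dopen (fatou F).
Proof.
move=> p /fatouP [r r0 h]; exists r => // q qr; apply/fatouP.
have [r' r'0 sub] := dopen_dball qr; exists r' => //.
exact: dnormal_sub sub (@dopen_dball _ _) h.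
Qed.

(** Compactness as an induction principle: a property of sets that passes to subsets and unions and
    holds locally holds for the sphere, which is covered by one square in each chart. *)
Lemma sphere_cousin (P : set S -> Prop) :
  (forall A B, A `<=` B -> P B -> P A) ->
  (forall A B, P A -> P B -> P (A `|` B)) ->
  (forall p, exists2 r, 0 < r & P (dball p r)) -> P setT.
Proof.
move=> Ps Pu Pl.
pose img b (x y w h : R) := [set chart b z | z in [set z | inrect x (x + w) y (y + h) z]].
have half b : P (img b (-1) (-1) 2 2).
  apply: (cousin (P := fun x y w h => P (img b x y w h))) => //.
    move=> x y w h w0 h0 _ _ _ _ p1 p2 p3 p4.
    apply: Ps (Pu _ _ (Pu _ _ p1 p2) (Pu _ _ p3 p4)) => _ [z [zx zy] <-].
    case: (leP (complex.Re z) (x + w / 2)) => hx; case: (leP (complex.Im z) (y + h / 2)) => hy.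
    + by left; left; exists z => //; split; lra.
    + by right; left; exists z => //; split; lra.
    + by left; right; exists z => //; split; lra.
    + by right; right; exists z => //; split; lra.
  move=> X Y _ _; have [r r0 Pr] := Pl (chart b (X +i* Y)%C).
  have [e e0 he] := chart_cont b (X +i* Y)%C r0.
  exists (e / 2); first lra.
  move=> x y w h w0 h0 Xx Yy _ _ _ _; apply: Ps Pr => _ [z [zx zy] <-]; apply: he.
  rewrite dCC /dC; apply: (le_lt_trans (nm_le_ReIm _)); rewrite ReD ImD ReN ImN /=.
  have : `|complex.Re z - X| <= w by rewrite ler_norml; lra.
  have : `|complex.Im z - Y| <= h by rewrite ler_norml; lra.
  lra.
apply: Ps (Pu _ _ (half true) (half false)) => s _.
have [b [z [z1 ->]]] := chart_surj s.
have zin : inrect (-1) (-1 + 2) (-1) (-1 + 2) z.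
  by have := Re_le_nm z; have := Im_le_nm z; rewrite !ler_norml => h1 h2; split; lra.
by case: b; [left|right]; exists z.
Qed.

Lemma scompact_closed A : dopen (~` A) -> scompact A.
Proof.
move=> cA J U oU AU.
pose P B := exists D : set J, finite_set D /\ (A `&` B `<=` \bigcup_(j in D) U j).
suff [D [fD AD]] : P setT by exists D; split => //; rewrite setIT in AD.
apply: sphere_cousin.
- move=> B B' BB' [D [fD AD]]; exists D; split => // x [Ax Bx]; apply: AD; split => //; exact: BB'.
- move=> B B' [D [fD AD]] [D' [fD' AD']]; exists (D `|` D'); split; first by rewrite finite_setU.
  by move=> x [Ax [Bx|Bx]]; [have [j Dj Uj] := AD x (conj Ax Bx)|have [j Dj Uj] := AD' x (conj Ax Bx)];
    exists j => //; [left|right].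
move=> p; have [Ap|nAp] := pselect (A p).
  have [j _ Uj] := AU p Ap; have /sopenP oj := oU j; have [r r0 rU] := oj p Uj.
  exists r => //; exists [set j]; split; first exact: finite_set1.
  by move=> x [_ /rU Ux]; exists j.
have [r r0 rA] := cA p nAp; exists r => //; exists set0; split; first exact: finite_set0.
by move=> x [Ax /rA].
Qed.

(** An infinite set of indices, standing for a subsequence until a diagonal choice is made. *)
Definition frequently (P : nat -> Prop) := forall N, exists2 n, (N <= n)%N & P n.

Lemma frequently_cluster (P : nat -> Prop) (u : nat -> S) : frequently P ->
  exists c, forall e, 0 < e -> frequently (fun n => P n /\ d c (u n) < e).
Proof.
move=> fP; apply: contrapT => no.
suff [N hN] : exists N, forall n, (N <= n)%N -> P n -> ~ [set: S] (u n).
  by have [n Nn Pn] := fP N; apply: (hN n Nn Pn).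
apply: (@sphere_cousin (fun B => exists N, forall n, (N <= n)%N -> P n -> ~ B (u n))).
- by move=> A B AB [N hN]; exists N => n Nn Pn /AB; exact: hN.
- move=> A B [N hN] [N' hN']; exists (maxn N N') => n; rewrite geq_max => /andP[n1 n2] Pn.
  by case; [exact: hN|exact: hN'].
move=> p; apply: contrapT => np; apply: no; exists p => e e0 N; apply: contrapT => ne.
by apply: np; exists e => //; exists N => n Nn Pn un; apply: ne; exists n.
Qed.

Lemma sphere_cluster (u : nat -> S) : exists p, forall e N, 0 < e ->
  exists2 n, (N <= n)%N & d p (u n) < e.
Proof.
have [|p hp] := @frequently_cluster (fun=> True) u; first by move=> N; exists N.
by exists p => e N /hp /(_ N) [n Nn [_ pn]]; exists n.
Qed.

End SphereTopology.

(** * Holomorphic maps into the sphere, rational maps, and normalisation of three points *)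

Section SphereMaps.
Variable R : realType.
Local Notation C := (R[i]).
Local Notation nm := (@Normc.normc R).
Local Notation dc := (@dC R).
Local Notation d := (@chordal R).
Local Notation S := (sphere R).
Implicit Types (p q s t : S) (f g : S -> S) (h : C -> S).

Definition shol h (z0 : C) := exists b (r : C -> C), exists2 e, 0 < e &
  forall z, dc z0 z < e -> cdiff_at r z /\ h z = chart b (r z).

Lemma shol_proj h (p q : C -> C) z0 e : 0 < e ->
  (forall z, dc z0 z < e -> [/\ cdiff_at p z, cdiff_at q z & h z = proj (p z, q z)]) ->
  (p z0, q z0) != (0, 0) -> shol h z0.
Proof.
move=> e0 H nz; have [pz qz _] := H z0 ltac:(by rewrite dCxx).
have [q0|q0] := eqVneq (q z0) 0; last first.
  have [e' e'0 h'] := near_neq0 (cdiff_cont qz) q0.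
  exists false, (fun z => p z / q z), (Num.min e e'); first by rewrite lt_min e0.
  move=> z; rewrite lt_min => /andP[/H [pz' qz' ->] /h' [qn _]].
  by split; [exact: cdiff_div|rewrite /proj /= (negbTE qn)].
have p0 : p z0 != 0 by move: nz; rewrite xpair_eqE q0 eqxx andbT.
have [e' e'0 h'] := near_neq0 (cdiff_cont pz) p0.
exists true, (fun z => q z / p z), (Num.min e e'); first by rewrite lt_min e0.
move=> z; rewrite lt_min => /andP[/H [pz' qz' ->] /h' [pn _]].
split; first exact: cdiff_div.
rewrite chart_true /proj /= mulf_eq0 invr_eq0 (negbTE pn) orbF.
by case: eqP => // _; rewrite invf_div.
Qed.

Lemma shol_cont h z0 : shol h z0 -> mcont dc d h z0.
Proof.
move=> [b [r [e e0 H]]]; have [rz hz] := H z0 ltac:(by rewrite dCxx).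
apply: (@mcont_near _ _ _ _ _ (fun z => chart b (r z))) => //.
  by exists e => // z /H [_ ->].
exact: mcont_comp (cdiff_cont rz) (chart_cont b _).
Qed.

Lemma shol_chart b z0 : shol (chart b) z0.
Proof. by exists b, (fun z => z), 1 => // z _; split => //; exact: cdiff_id. Qed.

(** In the chart at infinity the polynomials are replaced by u^n P(1/u) and u^n Q(1/u) with the same
    n, the larger degree. At u = 0 they give the coefficients of index n, which reproduce the three
    cases of [ratmap] at infinity. *)
Lemma ratmap_chart (P Q : {poly C}) b : Q != 0 -> coprimep P Q ->
  exists P' Q' : {poly C}, forall u, (P'.[u], Q'.[u]) != (0, 0) /\
    ratmap P Q (chart b u) = proj (P'.[u], Q'.[u]).
Proof.
move=> Q0 cop.
have nz u : (P.[u], Q.[u]) != (0, 0).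
  rewrite xpair_eqE negb_and; have [Pu|] := eqVneq P.[u] 0 => //=.
  by apply: (coprimep_root cop); rewrite /root Pu.
case: b; last by exists P, Q => u; split.
have sQ : (0 < size Q)%N by rewrite size_poly_gt0.
pose n := (maxn (size P) (size Q)).-1.
have nE : n.+1 = maxn (size P) (size Q) by rewrite prednK // leq_max sQ orbT.
have sP' : (size P <= n.+1)%N by rewrite nE leq_max leqnn.
have sQ' : (size Q <= n.+1)%N by rewrite nE leq_max leqnn orbT.
pose rv (p : {poly C}) := \poly_(i < n.+1) p`_(n - i).
have rv0 (p : {poly C}) : (rv p).[0] = p`_n by rewrite horner_coef0 coef_poly subn0.
have rvE (p : {poly C}) u : (size p <= n.+1)%N -> u != 0 -> (rv p).[u] = u ^+ n * p.[u^-1].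
  move=> sp u0; rewrite horner_poly (horner_coef_wide _ sp) mulr_sumr.
  rewrite [RHS](reindex_inj rev_ord_inj) /=; apply: eq_bigr => i _.
  have ni : (i <= n)%N by rewrite -ltnS.
  rewrite subSS mulrCA; congr (_ * _).
  have -> : u ^+ n = u ^+ i * u ^+ (n - i) by rewrite -exprD subnKC.
  by rewrite exprVn mulfK // expf_neq0.
exists (rv P), (rv Q) => u; have [->|u0] := eqVneq u 0; last first.
  have un : u ^+ n != 0 by rewrite expf_neq0.
  rewrite !rvE // chart_true (negbTE u0) /ratmap /proj /= mulf_eq0 (negbTE un) /=.
  split; last by case: eqP => // /eqP Qu; congr Some; field; rewrite un Qu.
  move: (nz u^-1); rewrite !xpair_eqE !mulf_eq0 (negbTE un) //.
rewrite !rv0 chart_true eqxx /ratmap.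
have [PQ|QP] := ltnP (size Q) (size P).
  have nP : n = (size P).-1 by rewrite /n (maxn_idPl _) // ltnW.
  have -> : Q`_n = 0 by rewrite nth_default // nP -ltnS prednK // (leq_ltn_trans _ PQ).
  have : P`_n != 0 by rewrite nP -/(lead_coef P) lead_coef_eq0 -size_poly_gt0 (leq_ltn_trans _ PQ).
  by move=> Pn; rewrite /proj /= eqxx xpair_eqE (negbTE Pn).
have nQ : n = (size Q).-1 by rewrite /n (maxn_idPr _).
have Qn : Q`_n != 0 by rewrite nQ -/(lead_coef Q) lead_coef_eq0.
split; first by rewrite xpair_eqE (negbTE Qn) andbF.
rewrite /proj /= (negbTE Qn); case: eqP => [E|/eqP E].
  by rewrite /lead_coef E -nQ.
rewrite (_ : P`_n = 0) ?mul0r // nth_default // nQ -ltnS prednK //.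
by rewrite ltn_neqAle E.
Qed.

Lemma shol_rational f h z0 : is_rational_map f -> shol h z0 -> shol (fun z => f (h z)) z0.
Proof.
move=> [P [Q [Q0 [cop fE]]]] [b [r [e e0 H]]].
have [P' [Q' PQ]] := ratmap_chart b Q0 cop.
apply: (@shol_proj _ (fun z => P'.[r z]) (fun z => Q'.[r z]) z0 e e0); last by have [] := PQ (r z0).
move=> z /H [rz ->]; split; try exact: cdiff_horner.
by rewrite fE; have [_ ->] := PQ (r z).
Qed.

Lemma poly_roots_finite (p : {poly C}) : p != 0 -> exists E : seq C, forall z, p.[z] = 0 -> z \in E.
Proof.
move=> p0; have [E pE] := closed_field_poly_normal p; exists E => z pz.
rewrite -root_prod_XsubC; move/eqP: pz; rewrite pE hornerZ mulf_eq0 lead_coef_eq0.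
by rewrite (negbTE p0).
Qed.

(** In homogeneous coordinates t = (a, b), solutions are roots of b P - a Q. If this polynomial were
    0, P would be a multiple of Q and f constant. *)
Lemma fiber_finite f t : is_rational_map f -> nonconstant f ->
  exists E : seq C, forall z, f (Some z) = t -> z \in E.
Proof.
move=> [P [Q [Q0 [cop fE]]]] [x [y fxy]].
have t0 := lift_nz t; have pt := proj_lift t; set a := (lift t).1; set b := (lift t).2.
have tE : lift t = (a, b) by rewrite /a /b; case: (lift t).
pose p := b *: P - a *: Q.
have sol z : f (Some z) = t -> p.[z] = 0.
  rewrite fE /ratmap -pt /proj tE [(_, _).1]/= [(_, _).2]/= !hornerE.
  case: eqP => [->|/eqP Qz]; case: eqP => [->|/eqP b0] //.
    by move=> _; rewrite mul0r mulr0 subrr.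
  move=> [E]; have -> : P.[z] = a / b * Q.[z] by rewrite -E divfK.
  by field.
suff p0 : p != 0 by have [E HE] := poly_roots_finite p0; exists E => z /sol /HE.
apply/eqP => pz; apply: fxy.
have nzQ z : Q.[z] != 0.
  apply/eqP => Qz; have := coprimep_root cop.
  have b0 : b != 0.
    apply/eqP => b0; move: pz; rewrite /p b0 scale0r sub0r => /eqP.
    by rewrite oppr_eq0 scaler_eq0 (negbTE Q0) orbF => /eqP a0; move: t0; rewrite tE a0 b0 eqxx.
  have : p.[z] = 0 by rewrite pz horner0.
  rewrite /p !hornerE Qz mulr0 subr0 => /eqP; rewrite mulf_eq0 (negbTE b0) /= => Pz.
  by move=> /(_ z Pz); rewrite Qz eqxx.
have b0 : b != 0.
  apply/eqP => b0; move: pz; rewrite /p b0 scale0r sub0r => /eqP.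
  by rewrite oppr_eq0 scaler_eq0 (negbTE Q0) orbF => /eqP a0; move: t0; rewrite tE a0 b0 eqxx.
have PQ : P = (a / b) *: Q.
  move/eqP: pz; rewrite subr_eq0 => /eqP E.
  by rewrite -[P](scalerK b0) E scalerA mulrC.
have cst s : f s = Some (a / b).
  rewrite fE; case: s => [z|]; rewrite /ratmap.
    by rewrite (negbTE (nzQ z)) PQ hornerZ mulfK.
  have [k0|k0] := eqVneq (a / b) 0.
    by rewrite PQ k0 scale0r size_poly0 ltn0 eq_sym size_poly_eq0 (negbTE Q0).
  by rewrite PQ size_scale // ltnn eqxx lead_coefZ mulfK // lead_coef_eq0.
by rewrite !cst.
Qed.

Definition open_map f := forall s e, 0 < e -> exists2 r, 0 < r &
  forall t, d (f s) t < r -> exists2 s', d s s' < e & f s' = t.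

Lemma rational_open f : is_rational_map f -> nonconstant f -> open_map f.
Proof.
move=> rf nf s e e0; have [b [z0 [_ sE]]] := chart_surj s.
have [E HE] := fiber_finite (f s) rf nf.
have [b' [r [e1 e10 H]]] := shol_rational rf (shol_chart b z0).
have [e2 e20 H2] := chart_cont b z0 e0.
(* Points to be avoided in either chart: solutions appear as themselves in the finite chart and as
   inverses in the other one, where 0 is the point at infinity. *)
have [e3 e30 H3] := seq_isolated (0 :: E ++ map (fun z => z^-1) E) z0.
pose m := Num.min e1 (Num.min e2 (Num.min e3 1)).
have m0 : 0 < m by rewrite !lt_min e10 e20 e30 ltr01.
have [m1 m2 m3] : [/\ m <= e1, m <= e2 & m <= e3] by rewrite !ge_min !lexx !orbT; split.
pose s' := m / 4; have s'0 : 0 < s' by rewrite /s'; lra.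
have near z : csq z0 s' z -> dc z0 z < m.
  by move=> /csq_nm; rewrite dCC /dC /s'; lra.
have fz0 : f (chart b z0) = chart b' (r z0) by have [] := H z0 ltac:(by rewrite dCxx).
have [||k k0 Hk] := @open_square R r z0 s' s'0.
- by move=> z /near zm; have [] := H z ltac:(lra).
- move=> z zb; have zm := near z zb.1; have [_ hz] := H z ltac:(lra).
  apply/eqP => rz; have fz : f (chart b z) = f s by rewrite hz rz -fz0 -sE.
  have := H3 z; have zn := csqbd_nm zb; rewrite dCC /dC in zm.
  have -> : (0 < nm (z - z0) < e3) = true by apply/andP; split; lra.
  move=> /(_ isT); rewrite inE mem_cat !negb_or => /and3P[zz0 zE zE'].
  case: b fz {sE fz0 H hz H2} => [|] fz; last by move/negP: zE; apply; exact: HE.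
  move: fz; rewrite chart_true (negbTE zz0) => /HE zi; move/negP: zE'; apply.
  by apply/mapP; exists z^-1; rewrite ?invrK.
have [r0 r00 Hr] := chart_inv b' (r z0) k0.
exists r0 => // t; rewrite sE fz0 => /Hr [w wk ->].
have [z zin rz] := Hk w ltac:(by rewrite nm_dist).
exists (chart b z); first by apply: H2; have := near z zin; lra.
by have [_ ->] := H z ltac:(by have := near z zin; lra); rewrite rz.
Qed.

Section SemigroupMaps.
Variables (I : Type) (g : I -> S -> S).
Hypothesis rat : forall i, is_rational_map (g i) /\ nonconstant (g i).
Let G := semigroup g.

Lemma sg_shol f h z0 : G f -> shol h z0 -> shol (fun z => f (h z)) z0.
Proof.
move=> Gf; elim: Gf h => [i|f1 f2 _ IH1 _ IH2] h hh; first exact: shol_rational (rat i).1 hh.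
exact: IH1 (IH2 _ hh).
Qed.

Lemma sg_open f : G f -> open_map f.
Proof.
elim => [i|f1 f2 _ o1 _ o2]; first by apply: rational_open; have [] := rat i.
move=> s e e0; have [r r0 H] := o2 s e e0; have [r' r'0 H'] := o1 (f2 s) r r0.
by exists r' => // t /H' [u /H [s' s'e <-] <-]; exists s'.
Qed.

(** If h_n o f converges near p, then h_n converges near f(p), as f is open. The limit is phi at a
    chosen preimage; the choice is immaterial, since at two preimages of t phi is the limit of the
    same sequence h_n(t). *)
Lemma fatou_forward f p : G f -> fatou G p -> fatou G (f p).
Proof.
move=> Gf /fatouP [r r0 nr]; apply/fatouP.
have [r' r'0 Hr] := sg_open Gf p r0.
exists r' => // h Gh.
have [|s [phi [sm c]]] := nr (fun n => h n \o f); first by move=> n; exact: sg_comp (Gh n) Gf.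
have pre q : exists x, dball (f p) r' q -> dball p r x /\ f x = q.
  by have [/Hr [x xr fx]|nq] := pselect (dball (f p) r' q); [exists x|exists p].
have [k kP] := choice pre.
exists s, (fun q => phi (k q)); split => // q qr.
have [kr fk] := kP q qr.
have [r1 [r10 [r1U un]]] := c (k q) kr.
have [r2 r20 H2] := sg_open Gf (k q) r10; rewrite fk in H2.
have [r3 r30 H3] := @dopen_dball R (f p) r' q qr.
exists (Num.min r2 r3); split; first by rewrite lt_min r20.
split; first by move=> t; rewrite /dball /= lt_min => /andP[_ /H3].
move=> e e0; have [N hN] := un e e0; exists N => n Nn t.
rewrite /dball /= lt_min => /andP[/H2 [x xk fx] /H3 tr].
have [ktr fkt] := kP t tr.
suff -> : phi (k t) = phi x by rewrite -fx; exact: hN.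
apply: chordal_eq0; apply/eqP; rewrite eq_le chordal_ge0 andbT.
apply/ler_addgt0Pl => e' e'0; rewrite addr0.
have [r4 [r40 [_ un4]]] := c (k t) ktr.
have [N1 h1] := un (e' / 2) ltac:(lra); have [N2 h2] := un4 (e' / 2) ltac:(lra).
have := h1 (maxn N1 N2) (leq_maxl _ _) x xk.
have := h2 (maxn N1 N2) (leq_maxr _ _) (k t) (dball_center _ r40).
rewrite /= fkt fx => k1 k2.
have := chordal_tri (h (s (maxn N1 N2)) t) (phi (k t)) (phi x).
by rewrite (chordalC (phi (k t)) (h _ _)); lra.
Qed.

End SemigroupMaps.

Section Moebius.
Variables (a b c : S).
Hypotheses (ab : a <> b) (bc : b <> c) (ac : a <> c).

(** The cross ratio sending a, b, c to 0, 1 and infinity. Over c the quotient has denominator 0 and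
    evaluates to 0, which is why c is excluded wherever [mob] is used. *)
Definition mob (v : C * C) : C :=
  hdet v (lift a) * hdet (lift b) (lift c) / (hdet v (lift c) * hdet (lift b) (lift a)).

Lemma hdet_lift0 (s t : S) : hdet (lift s) (lift t) = 0 -> s = t.
Proof. by move=> E; apply: chordal_eq0; rewrite chordalE E nm0 mulr0 mul0r. Qed.

Lemma hdet_neq (s t : S) : s <> t -> hdet (lift s) (lift t) != 0.
Proof. by move=> st; apply/eqP => /hdet_lift0. Qed.

Lemma mob_scl k v : k != 0 -> mob (scl k v) = mob v.
Proof.
have E w : hdet (scl k v) w = k * hdet v w by rewrite /hdet /=; ring.
move=> k0; rewrite /mob !E -(mulrA k (hdet v (lift a))) -(mulrA k (hdet v (lift c))).
by rewrite invfM mulrACA mulfV // mul1r.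
Qed.

Lemma mob_neq0 s : s <> a -> s <> c -> mob (lift s) != 0.
Proof.
move=> sa sc; rewrite /mob mulf_neq0 ?invr_neq0 // mulf_neq0 //; apply: hdet_neq => //.
exact/nesym.
Qed.

(** By the Pluecker identity, numerator minus denominator is det(s, b) det(a, c). *)
Lemma mob_neq1 s : s <> b -> s <> c -> mob (lift s) != 1.
Proof.
move=> sb sc; have h1 := hdet_neq sc; have h2 := hdet_neq (nesym ab).
have h3 := hdet_neq sb; have h4 := hdet_neq ac.
have YF : hdet (lift s) (lift c) * hdet (lift b) (lift a) != 0 by rewrite mulf_neq0.
apply/eqP => E.
have XY : hdet (lift s) (lift a) * hdet (lift b) (lift c) =
    hdet (lift s) (lift c) * hdet (lift b) (lift a).
  by rewrite -[RHS]mul1r -E /mob divfK.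
have : hdet (lift s) (lift b) * hdet (lift a) (lift c) = 0.
  have -> : hdet (lift s) (lift b) * hdet (lift a) (lift c) =
      hdet (lift s) (lift a) * hdet (lift b) (lift c) -
      hdet (lift s) (lift c) * hdet (lift b) (lift a); last by rewrite XY subrr.
  by rewrite /hdet; ring.
by move=> /eqP; rewrite mulf_eq0 (negbTE h3) (negbTE h4).
Qed.

Lemma mob_chart bb z : mob (lift (chart bb z)) = mob (if bb then (1, z) else (z, 1)).
Proof.
rewrite chartE; set v := if bb then (1, z) else (z, 1).
have -> : (if bb then proj (1, z) else proj (z, 1)) = proj v by rewrite /v; case: (bb).
have v0 : v != (0, 0) by rewrite /v; case: (bb); rewrite xpair_eqE oner_eq0 ?andbF.
by have [k k0 E] := lift_proj v0; rewrite {2}E mob_scl.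
Qed.

Lemma mob_cdiff h z0 : shol h z0 -> h z0 <> c -> cdiff_at (fun z => mob (lift (h z))) z0.
Proof.
move=> [bb [r [e e0 H]]] hc; have [rz hz] := H z0 ltac:(by rewrite dCxx).
apply: (@cdiff_near _ (fun z => mob (if bb then (1, r z) else (r z, 1)))).
  by exists e => // z /H [_ ->]; rewrite mob_chart.
have nz : hdet (if bb then (1, r z0) else (r z0, 1)) (lift c) != 0.
  have := hdet_neq hc; rewrite hz chartE.
  set v := if bb then (1, r z0) else (r z0, 1).
  have -> : (if bb then proj (1, r z0) else proj (r z0, 1)) = proj v by rewrite /v; case: (bb).
  have v0 : v != (0, 0) by rewrite /v; case: (bb); rewrite xpair_eqE oner_eq0 ?andbF.
  have [k k0 E] := lift_proj v0; apply: contra_neq.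
  rewrite {1}E (_ : hdet (scl k _) _ = k * hdet (lift (proj v)) (lift c)); last by rewrite /hdet /=; ring.
  by move/eqP; rewrite mulf_eq0 (negbTE k0) => /eqP.
have dh t : cdiff_at (fun z => hdet (if bb then (1, r z) else (r z, 1)) (lift t)) z0.
  rewrite /hdet; case: (bb) => /=; apply: cdiffB; apply: cdiffM => //; exact: cdiff_cst.
apply: cdiff_div.
- by apply: cdiffM; [exact: dh|exact: cdiff_cst].
- by apply: cdiffM; [exact: dh|exact: cdiff_cst].
- by rewrite mulf_neq0 // hdet_neq //; exact: nesym.
Qed.

(** The cross ratio is induced by the linear map [W] of C^2. [L] is the modulus of its determinant
    and [K1] bounds its norm, so distances shrink at most by the factor L / K1^2. *)
Lemma mob_chordal : exists2 K, 0 < K & forall s t, s <> c -> t <> c ->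
  d s t <= K * d (Some (mob (lift s))) (Some (mob (lift t))).
Proof.
have h1 := hdet_neq bc; have h2 := hdet_neq (nesym ab); have h3 := hdet_neq ac.
pose k := hdet (lift b) (lift c) / hdet (lift b) (lift a).
have k0 : k != 0 by rewrite mulf_neq0 ?invr_neq0.
pose K1 := nm k * hn (lift a) + hn (lift c).
have K1pos : 0 < K1.
  have : 0 < hn (lift c) by rewrite hn_gt0 lift_nz.
  by have := mulr_ge0 (nm_ge0 k) (hn_ge0 (lift a)); rewrite /K1; lra.
pose L := nm (k * hdet (lift a) (lift c)).
have L0 : 0 < L by rewrite nm_gt0 mulf_neq0.
exists (K1 ^+ 2 / L); first by rewrite divr_gt0 // exprn_gt0.
move=> s t sc tc; have s1 := hdet_neq sc; have t1 := hdet_neq tc.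
pose W x := (k * hdet (lift x) (lift a), hdet (lift x) (lift c)).
have WE x : x <> c -> W x != (0, 0) /\ Some (mob (lift x)) = proj (W x).
  move=> xc; have x1 := hdet_neq xc; split; first by rewrite xpair_eqE (negbTE x1) andbF.
  rewrite /proj /= (negbTE x1); congr Some; rewrite /mob /k; field; by rewrite x1 h2.
have [Ws Es] := WE s sc; have [Wt Et] := WE t tc; rewrite Es Et chordal_proj // chordalE.
have dW : nm (hdet (W s) (W t)) = L * nm (hdet (lift s) (lift t)).
  by rewrite /L -nmM; congr nm; rewrite /W /hdet /=; ring.
have bW x : hn (W x) <= K1 * hn (lift x).
  apply: (le_trans (hn_le _)); rewrite /W /= nmM /K1 mulrDl; apply: lerD.
    by rewrite -mulrA ler_wpM2l ?nm_ge0 // mulrC hdet_le.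
  by rewrite mulrC hdet_le.
have ps : 0 < hn (W s) by rewrite hn_gt0.
have pt : 0 < hn (W t) by rewrite hn_gt0.
have qs : 0 < hn (lift s) by rewrite hn_gt0 lift_nz.
have qt : 0 < hn (lift t) by rewrite hn_gt0 lift_nz.
rewrite dW ler_pdivrMr ?mulr_gt0 //.
have -> : K1 ^+ 2 / L * (2 * (L * nm (hdet (lift s) (lift t))) / (hn (W s) * hn (W t))) *
    (hn (lift s) * hn (lift t)) = (2 * nm (hdet (lift s) (lift t))) *
    ((K1 * hn (lift s)) * (K1 * hn (lift t)) / (hn (W s) * hn (W t))).
  by field; rewrite !gt_eqF.
rewrite ler_peMr ?mulr_ge0 ?nm_ge0 // ler_pdivlMr ?mulr_gt0 // mul1r.
by apply: ler_pM => //; exact: ltW.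
Qed.

End Moebius.

End SphereMaps.

(** * The image of the core curve is small *)

Section CoreCurve.
Variable R : realType.
Local Notation C := (R[i]).
Local Notation nm := (@Normc.normc R).
Local Notation dc := (@dC R).
Local Notation d := (@chordal R).
Local Notation S := (sphere R).

(** The quotient of the chordal distance by |z' - z| is |q(z')| for a function [q] that is
    continuous at z, and |q(z)| is the spherical derivative. *)
Lemma chordal_local (F : C -> C) z l e : cder F z l -> 0 < e -> exists2 r, 0 < r &
  forall z', dc z z' < r ->
    d (Some (F z)) (Some (F z')) <= (2 * nm l / (1 + nm (F z) ^+ 2) + e) * nm (z' - z).
Proof.
move=> dl e0; pose A z' := hn (F z', 1).
have A0 z' : 0 < A z' by rewrite hn_gt0 xpair_eqE oner_eq0 andbF.
have cF := cder_cont dl.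
have cA : mcont dc (@dR R) A z.
  move=> r /cF [r' r'0 H]; exists r' => // z' /H.
  have h x y : A x - A y <= dc (F x) (F y).
    have := hnD (F x - F y, 0) (F y, 1).
    rewrite [(F x - F y, _).1]/= [(F x - F y, _).2]/= [(F y, _).1]/= [(F y, _).2]/=.
    rewrite subrK add0r -/(A x) -/(A y).
    by have := hn_le (F x - F y, 0); rewrite [(_, _).1]/= [(_, _).2]/= nm0 addr0 /dC; lra.
  by apply: le_lt_trans; rewrite ler_norml; have := h z z'; have := h z' z; rewrite (dCC (F z')); lra.
pose q z' := 2 * slope F z l z' / (A z * A z')%:C%C.
have cq : mcont dc dc q z.
  apply: ccont_div.
  - by apply: ccontM; [exact: ccont_cst|exact: dl].
  - by apply/rcont_cplx; apply: rcontM => //; exact: rcont_cst.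
  by rewrite -nm_gt0 nm_real gtr0_norm mulr_gt0.
have Az2 : A z * A z = 1 + nm (F z) ^+ 2.
  by rewrite -expr2 hn_sq [(_, _).1]/= [(_, _).2]/= nm1 expr1n addrC.
have nmq z' : nm (q z') = 2 * nm (slope F z l z') / (A z * A z').
  rewrite /q nmM nmV nm_real gtr0_norm ?mulr_gt0 // nmM.
  by have -> : (2 : C) = (2 : R)%:C%C; [rewrite rmorph_nat|rewrite nm_real ger0_norm].
have [r r0 H] := cq e e0; exists r => // z' /H.
rewrite chordalE [lift _]/= [lift (Some (F z'))]/= -/(A z) -/(A z') => hq.
have E : hdet (F z, 1) (F z', 1) = - (slope F z l z' * (z' - z)).
  have pr (x y : C) : ((x, y).1 = x) * ((x, y).2 = y) by [].
  by rewrite /hdet !pr !mulr1 (slopeE F z l z'); ring.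
rewrite E nmN nmM.
have -> : 2 * (nm (slope F z l z') * nm (z' - z)) / (A z * A z') = nm (q z') * nm (z' - z).
  by rewrite nmq; ring.
apply: ler_wpM2r; first exact: nm_ge0.
have := nm_lower (q z') (q z); rewrite nm_dist -/(dC (q z) (q z')) (nmq z) slopexx Az2; lra.
Qed.

Lemma segment_estimate (F : C -> C) (w w' : C) M :
  (forall t : R, 0 <= t <= 1 -> cdiff_at F (w + t%:C%C * (w' - w)) /\
     2 * nm (der F (w + t%:C%C * (w' - w))) / (1 + nm (F (w + t%:C%C * (w' - w))) ^+ 2) <= M) ->
  d (Some (F w)) (Some (F w')) <= M * nm (w' - w).
Proof.
move=> H; apply/ler_addgt0Pl => e e0.
pose L := nm (w' - w); have L0 : 0 <= L by exact: nm_ge0.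
pose e' := e / (L + 1).
have e'0 : 0 < e' by rewrite divr_gt0 //; lra.
pose z (t : R) := w + t%:C%C * (w' - w).
have zB s t : z s - z t = (s - t)%:C%C * (w' - w) by rewrite /z rmorphB; ring.
apply: (@le_trans _ _ ((M + e') * L)); last first.
  have : e' * L <= e.
    by rewrite /e' mulrAC ler_pdivrMr ?ler_pM2l //; lra.
  rewrite -/L; lra.
have -> : w = z 0 by rewrite /z mul0r addr0.
have -> : w' = z 1 by rewrite /z mul1r addrC subrK.
apply: (@mean_value_ineq R S d (fun t => Some (F (z t)))).
- by move=> x y t; exact: chordal_tri.
- exact: chordalxx.
move=> t t01; have [dt bt] := H t t01; rewrite -/(z t) in dt bt.
have [r r0 Hr] := chordal_local (derP dt) e'0.
exists (r / (L + 1)); first by rewrite divr_gt0 //; lra.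
move=> s s01; rewrite ltr_pdivlMr; last lra.
move=> sr.
have nz : nm (z s - z t) = `|s - t| * L by rewrite zB nmM nm_real.
have := Hr (z s); rewrite dCC /dC nz => hh.
have : `|s - t| * L < r by have := normr_ge0 (s - t); lra.
move=> /hh {}hh.
have k : d (Some (F (z t))) (Some (F (z s))) <= (M + e') * L * `|s - t|.
  have -> : (M + e') * L * `|s - t| = (M + e') * (`|s - t| * L) by ring.
  apply: (le_trans hh); apply: ler_wpM2r; first by rewrite mulr_ge0.
  by rewrite lerD2r.
split=> st.
  by rewrite chordalC; have -> : t - s = `|s - t| by rewrite ler0_norm; lra.
by have -> : s - t = `|s - t| by rewrite ger0_norm; lra.
Qed.

(** In rho/2 <= |z| <= rho one has |t| <= ln 2 <= 1, so H^2 - t^2 >= 3/4 H^2 and the spherical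
    derivative is O(1 / (rho H)). Chords over a quarter turn, or of length at most rho, stay in this
    region and cost 12 c0 / H each; three of them join any two points of the circle. *)
Lemma circle_estimate (F : C -> C) (s0 H H' : R) : 4 <= H -> H < H' ->
  (forall w, w != 0 -> `|ln (nm w) - s0| < H' -> [/\ cdiff_at F w, F w != 0 & F w != 1]) ->
  forall w w', nm w = expR s0 -> nm w' = expR s0 ->
    d (Some (F w)) (Some (F w')) <= 36 * (32 * (2 * 54)) / H.
Proof.
move=> H4 HH' dF; have H0 : 0 < H by lra.
pose rho := expR s0; have rho0 : 0 < rho by exact: expR_gt0.
pose c0 : R := 32 * (2 * 54).
pose M := 6 * c0 / (rho * H).
have M0 : 0 <= M by apply: divr_ge0; [rewrite /c0; lra|rewrite mulr_ge0 ?ltW].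
have ln2 : ln 2 <= 1 :> R by have := @le_ln1Dx R 1; rewrite (_ : 1 + 1 = 2) //; apply; lra.
have bound z : rho / 2 <= nm z -> nm z <= rho ->
    cdiff_at F z /\ 2 * nm (der F z) / (1 + nm (F z) ^+ 2) <= M.
  move=> z1 z2; have z0 : 0 < nm z by lra.
  have zn0 : z != 0 by rewrite -nm_gt0.
  have tz : `|ln (nm z) - s0| <= 1.
    have l1 : ln (nm z) <= s0 by rewrite -[s0]expRK ler_ln ?posrE.
    have l2 : s0 - ln 2 <= ln (nm z).
      by rewrite -[s0]expRK -/rho -ln_div ?posrE // ler_ln ?posrE // divr_gt0.
    by rewrite ler_norml; lra.
  have tH : `|ln (nm z) - s0| < H' by lra.
  have [dz _ _] := dF z zn0 tH; split => //.
  have az : z != 0 /\ `|ln (nm z) - s0| <= H by split => //; lra.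
  have := ahlfors H0 HH' dF az; set D := nm (der F z); set t := ln (nm z) - s0 => ha.
  have F0 : 0 < 1 + nm (F z) ^+ 2 by have := sqr_ge0 (nm (F z)); lra.
  have t2 : t ^+ 2 <= 1.
    by rewrite -(real_normK (num_real t)) expr_le1.
  have HH : 3 / 4 * H ^+ 2 <= H ^+ 2 - t ^+ 2.
    have : 4 ^+ 2 <= H ^+ 2 by rewrite lerXn2r ?nnegrE ?(ltW H0).
    lra.
  rewrite ler_pdivrMr // /M.
  have D0 : 0 <= D by exact: nm_ge0.
  have H2 : 0 < H ^+ 2 by rewrite exprn_gt0.
  have k1 : D * (rho / 2) * (3 / 4 * H ^+ 2) <= D * nm z * (H ^+ 2 - t ^+ 2).
    apply: ler_pM => //; [by rewrite mulr_ge0 //; lra|lra|exact: ler_wpM2l].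
  have k2 := le_trans k1 ha.
  have -> : 6 * c0 / (rho * H) * (1 + nm (F z) ^+ 2) =
     32 * (2 * (54 * H)) * (1 + nm (F z) ^+ 2) * (6 / (rho * H ^+ 2)).
    by rewrite /c0; field; rewrite !gt_eqF.
  have c1 : 0 <= 6 / (rho * H ^+ 2) by rewrite divr_ge0 // mulr_ge0 // ltW.
  apply: le_trans (ler_wpM2r c1 k2).
  have -> : D * (rho / 2) * (3 / 4 * H ^+ 2) * (6 / (rho * H ^+ 2)) = 9 / 4 * D.
    by field; rewrite !gt_eqF.
  lra.
have step z1 z2 : nm z1 = rho -> nm z2 = rho ->
    (forall t : R, 0 <= t <= 1 -> rho / 2 <= nm (z1 + t%:C%C * (z2 - z1))) ->
    d (Some (F z1)) (Some (F z2)) <= 12 * c0 / H.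
  move=> n1 n2 lo.
  have : d (Some (F z1)) (Some (F z2)) <= M * nm (z2 - z1).
    apply: segment_estimate => t t01; apply: bound; first exact: lo.
    have -> : z1 + t%:C%C * (z2 - z1) = (1 - t)%:C%C * z1 + t%:C%C * z2.
      by rewrite rmorphB rmorph1; ring.
    apply: (le_trans (nmD _ _)); rewrite !nmM !nm_real n1 n2 !ger0_norm; lra.
  move=> h; apply: (le_trans h).
  have -> : 12 * c0 / H = M * (2 * rho) by rewrite /M; field; rewrite !gt_eqF.
  apply: ler_wpM2l => //; have := nmB z2 z1; lra.
pose ii : C := (0 +i* 1)%C.
have stepi z : nm z = rho -> d (Some (F z)) (Some (F (ii * z))) <= 12 * c0 / H.
  move=> nz; apply: step => //; first by rewrite nmM nm_i mul1r.
  move=> t t01.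
  have -> : z + t%:C%C * (ii * z - z) = ((1 - t) +i* t)%C * z.
    have -> : ((1 - t) +i* t)%C = 1 - t%:C%C + t%:C%C * ii.
      by apply: ReImP; rewrite !(ReD, ImD, ReN, ImN, ReM, ImM) /=; ring.
    ring.
  rewrite nmM nz mulrC; apply: ler_wpM2r; first exact: ltW.
  rewrite -(ler_pXn2r (n := 2)) ?nnegrE ?nm_ge0 // nm_sq /=; nra.
have stepc z1 z2 : nm z1 = rho -> nm z2 = rho -> nm (z2 - z1) <= rho ->
    d (Some (F z1)) (Some (F z2)) <= 12 * c0 / H.
  move=> n1 n2 n12; apply: step => // t t01.
  have [t2|t2] := leP t (1 / 2).
    have := nm_lower z1 (- (t%:C%C * (z2 - z1))); rewrite opprK nmN nmM nm_real n1.
    rewrite (ger0_norm (_ : 0 <= t)); last lra.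
    have : t * nm (z2 - z1) <= 1 / 2 * rho by apply: ler_pM; rewrite ?nm_ge0 //; lra.
    lra.
  have -> : z1 + t%:C%C * (z2 - z1) = z2 - (1 - t)%:C%C * (z2 - z1).
    by rewrite rmorphB rmorph1; ring.
  have := nm_lower z2 ((1 - t)%:C%C * (z2 - z1)); rewrite nmM nm_real n2.
  rewrite (ger0_norm (_ : 0 <= 1 - t)); last lra.
  have : (1 - t) * nm (z2 - z1) <= 1 / 2 * rho by apply: ler_pM; rewrite ?nm_ge0 //; lra.
  lra.
move=> w w' nw nw'; rewrite -/rho in nw nw'.
have nN z : nm z = rho -> nm (ii * z) = rho by rewrite nmM nm_i mul1r.
have w0 : w != 0 by rewrite -nm_gt0 nw.
pose q := w' / w.
have nq : nm q = 1 by rewrite nmM nmV nw nw' divff // gt_eqF.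
(* The condition says that the angle between u and q is at most 60 degrees; one of 1, -1, i, -i
   always satisfies it. *)
have close u : nm u = 1 -> 1 / 2 <= complex.Re u * complex.Re q + complex.Im u * complex.Im q -> nm (w' - u * w) <= rho.
  move=> nu h; have -> : w' - u * w = (q - u) * w by rewrite mulrBl divfK.
  rewrite nmM nw; suff : nm (q - u) <= 1 by move=> k; rewrite ler_piMl // ltW.
  rewrite -(ler_pXn2r (n := 2)) ?nnegrE ?nm_ge0 // nm_sq !(ReD, ImD, ReN, ImN) expr1n.
  have := nm_sq q; have := nm_sq u; rewrite nq nu expr1n; nra.
have E36 : 36 * (32 * (2 * 54)) / H = 12 * c0 / H + 12 * c0 / H + 12 * c0 / H.
  by rewrite /c0; field; rewrite gt_eqF.
rewrite E36; have p0 : 0 <= 12 * c0 / H by apply: divr_ge0; [rewrite /c0; lra|exact: ltW].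
move: (12 * c0 / H) p0 stepi stepc => K p0 stepi stepc.
clear E36 step bound M0 M ln2 dF HH' H4 H0.
have s1 := stepi w nw; have s2 := stepi _ (nN w nw); have s3 := stepi _ (nN _ (nN w nw)).
have s4 := stepi _ (nN _ (nN _ (nN w nw))).
have iiN x : ii * (ii * x) = -1 * x.
  by rewrite mulrA; congr (_ * _); apply: ReImP; rewrite ?(ReM, ImM) /=; ring.
have i4 : ii * (ii * (ii * (ii * w))) = w by rewrite !iiN !mulN1r opprK.
rewrite i4 chordalC in s4.
have i2 : ii * (ii * w) = -1 * w by exact: iiN.
have i3 : ii * (ii * (ii * w)) = - ii * w by rewrite iiN mulN1r mulNr.
have qq := nm_sq q; rewrite nq expr1n in qq.
have tri3 x y z : d x y <= K -> d y z <= K ->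
    d x z <= K + K.
  by move=> k1 k2; have := chordal_tri y x z; lra.
have fin u : nm u = 1 -> d (Some (F w)) (Some (F (u * w))) <= K + K ->
    1 / 2 <= complex.Re u * complex.Re q + complex.Im u * complex.Im q ->
    d (Some (F w)) (Some (F w')) <= K + K + K.
  move=> nu k1 k2; have nuw : nm (u * w) = rho by rewrite nmM nu mul1r.
  have := stepc _ _ nuw nw' (close u nu k2).
  by have := chordal_tri (Some (F (u * w))) (Some (F w)) (Some (F w')); lra.
case: (leP (1 / 2) (complex.Re q)) => h1.
  by apply: (fin 1); rewrite ?nm1 ?mul1r ?chordalxx /= ?mul0r ?addr0 ?mul1r //; lra.
case: (leP (1 / 2) (- complex.Re q)) => h2.
  apply: (fin (-1)); first by rewrite nmN nm1.
    by rewrite -i2; exact: tri3 s1 s2.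
  by rewrite ReN ImN /=; lra.
case: (leP (1 / 2) (complex.Im q)) => h3.
  apply: (fin ii); first exact: nm_i.
    lra.
  by rewrite /=; lra.
apply: (fin (- ii)); first by rewrite nmN nm_i.
  by rewrite -i3; lra.
by rewrite ReN ImN /=; nra.
Qed.

Lemma core_estimate (a b c : S) : a <> b -> b <> c -> a <> c ->
  exists2 K, 0 < K & forall (h : C -> S) (s0 H H' : R), 4 <= H -> H < H' ->
  (forall w, w != 0 -> `|ln (nm w) - s0| < H' -> [/\ shol h w, h w <> a, h w <> b & h w <> c]) ->
  forall w w', nm w = expR s0 -> nm w' = expR s0 -> d (h w) (h w') <= K / H.
Proof.
move=> ab bc ac; have [K K0 HK] := mob_chordal ab bc ac.
pose c1 : R := 36 * (32 * (2 * 54)).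
have c10 : 0 < c1 by rewrite /c1; lra.
exists (K * c1); first exact: mulr_gt0.
move=> h s0 H H' H4 HH' hh w w' nw nw'.
pose F z := mob a b c (lift (h z)).
have H0 : 0 < H by lra.
have ins z : nm z = expR s0 -> z != 0 /\ `|ln (nm z) - s0| < H'.
  by move=> nz; rewrite -nm_gt0 nz expRK subrr normr0; split; [exact: expR_gt0|lra].
have [[w0 wH] [w'0 w'H]] := (ins w nw, ins w' nw').
have [_ _ _ hc] := hh w w0 wH; have [_ _ _ hc'] := hh w' w'0 w'H.
apply: (le_trans (HK _ _ hc hc')); rewrite -mulrA ler_pM2l //.
apply: (circle_estimate (F := F) H4 HH' _ nw nw') => z z0 zH; have [sh za zb zc] := hh z z0 zH.
by split; [exact: mob_cdiff|exact: mob_neq0|exact: mob_neq1].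
Qed.

End CoreCurve.

(** * Paths, connected sets and components *)

Section Connectedness.
Variable R : realType.
Local Notation C := (R[i]).
Local Notation nm := (@Normc.normc R).
Local Notation dc := (@dC R).
Local Notation dr := (@dR R).
Local Notation d := (@chordal R).
Local Notation S := (sphere R).
Implicit Types (A B K U V X : set S) (x y : S).

Lemma path_connected (X Y : Type) (dX : X -> X -> R) (g : R -> X) (P : X -> Prop) :
  (forall t, 0 <= t <= 1 -> mcont dr dX g t) ->
  (forall t, 0 <= t <= 1 -> P (g t) -> exists2 e, 0 < e &
     forall u, 0 <= u <= 1 -> dX (g t) (g u) < e -> P (g u)) ->
  (forall t, 0 <= t <= 1 -> ~ P (g t) -> exists2 e, 0 < e &
     forall u, 0 <= u <= 1 -> dX (g t) (g u) < e -> ~ P (g u)) ->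
  P (g 0) -> P (g 1).
Proof.
move=> cg Po Pc P0; apply: (@unit_connected R (fun t => P (g t))) => //; last lra.
- move=> t t01 /(Po t t01) [e e0 H]; have [r r0 h] := cg t t01 e e0.
  by exists r => // u u01 ut; apply: H => //; apply: h; rewrite /dR distrC.
- move=> t t01 /(Pc t t01) [e e0 H]; have [r r0 h] := cg t t01 e e0.
  by exists r => // u u01 ut; apply: H => //; apply: h; rewrite /dR distrC.
Qed.

Lemma rcont_id (t : R) : mcont dr dr (fun u => u) t.
Proof. exact: mcont_id. Qed.

Lemma rcont_affine (a b t : R) : mcont dr dr (fun u => a + u * b) t.
Proof.
apply: rcontD; first exact: rcont_cst.
by apply: rcontM; [exact: rcont_id|exact: rcont_cst].
Qed.

Lemma sconnected_path (g : R -> S) : (forall t, mcont dr d g t) ->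
  sconnected [set g t | t in [set t | 0 <= t <= 1]].
Proof.
move=> cg U V /sopenP oU /sopenP oV sub disj [_ [[t0 t01 <-] Ut0]] [_ [[t1 t11 <-] Vt1]].
pose k u := t0 + u * (t1 - t0).
have k01 u : 0 <= u <= 1 -> 0 <= k u <= 1.
  move=> u01; rewrite /=  in t01 t11; rewrite /k; apply/andP; split; nra.
have im u : 0 <= u <= 1 -> [set g t | t in [set t | 0 <= t <= 1]] (g (k u)).
  by move=> u01; exists (k u) => //; exact: k01.
have dis u : 0 <= u <= 1 -> U (g (k u)) -> V (g (k u)) -> False.
  by move=> u01 a b; have : set0 (g (k u)) by rewrite -disj; split => //; split => //; exact: im.
have k0 : k 0 = t0 by rewrite /k mul0r addr0.
have k1 : k 1 = t1 by rewrite /k mul1r addrC subrK.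
have : U (g (k 1)).
  apply: (@path_connected S S d (fun u => g (k u))) => //; last by rewrite k0.
  - move=> u _; exact: (mcont_comp (rcont_affine t0 (t1 - t0) u) (cg _)).
  - move=> u _ Uu; have [r r0 rU] := oU _ Uu; exists r => // v _; exact: rU.
  - move=> u u01 nU; have Vu : V (g (k u)) by have [] := sub _ (im u u01).
    have [r r0 rV] := oV _ Vu; exists r => // v v01 /rV Vv Uv; exact: dis Uv Vv.
by move=> Uk; apply: (dis 1) Uk _; rewrite ?k1 //; lra.
Qed.

Lemma sconnected_pairs X :
  (forall x y, X x -> X y -> exists K, [/\ K `<=` X, sconnected K, K x & K y]) -> sconnected X.
Proof.
move=> H U V oU oV sub disj [x [Xx Ux]] [y [Xy Vy]].
have [K [KX cK Kx Ky]] := H x y Xx Xy.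
apply: (cK U V oU oV); [by move=> z /KX /sub| |by exists x|by exists y].
by rewrite -subset0 => z [[/KX Xz Uz] Vz]; rewrite -disj.
Qed.

Lemma sconnectedU K K' x : sconnected K -> sconnected K' -> K x -> K' x ->
  sconnected (K `|` K').
Proof.
move=> cK cK' Kx K'x U V oU oV sub disj [u [Ku Uu]] [v [Kv Vv]].
have half L : L `<=` K `|` K' -> sconnected L -> L `&` U !=set0 -> L `&` V !=set0 -> False.
  move=> LK cL; apply: (cL U V oU oV); first by move=> z /LK /sub.
  by rewrite -subset0 => z [[/LK Kz Uz] Vz]; rewrite -disj.
have hK : K `<=` K `|` K' by move=> z; left.
have hK' : K' `<=` K `|` K' by move=> z; right.
have [Ux|Vx] := sub x (or_introl Kx).
  case: Kv => Kv; last by apply: (half K' hK' cK'); [exists x|exists v].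
  by apply: (half K hK cK); [exists x|exists v].
case: Ku => Ku; last by apply: (half K' hK' cK'); [exists u|exists x].
by apply: (half K hK cK); [exists u|exists x].
Qed.

Definition adherent X x := forall e, 0 < e -> exists2 y, X y & d x y < e.

Lemma adherentN X x : ~ adherent X x -> exists2 r, 0 < r & forall y, d x y < r -> ~ X y.
Proof.
move=> /existsNP [e /not_implyP [e0 ne]]; exists e => // y ye Xy.
by apply: ne; exists y.
Qed.

Lemma sconnected_adherent K x : sconnected K -> adherent K x -> sconnected (K `|` [set x]).
Proof.
move=> cK ax U V /sopenP oU /sopenP oV sub disj mU mV.
have meet W : dopen W -> (K `|` [set x]) `&` W !=set0 -> K `&` W !=set0.
  move=> oW [z [[Kz|->] Wz]]; first by exists z.
  by have [r r0 rW] := oW _ Wz; have [y Ky xy] := ax r r0; exists y; split => //; exact: rW.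
have oU' : sopen U by apply/sopenP.
have oV' : sopen V by apply/sopenP.
apply: (cK U V oU' oV'); [by move=> z Kz; apply: sub; left| |exact: meet|exact: meet].
by rewrite -subset0 => z [[Kz Uz] Vz]; rewrite -disj; split => //; split => //; left.
Qed.

Lemma same_component_sym X x y : same_component X x y -> same_component X y x.
Proof. by move=> [K [h1 [h2 [h3 h4]]]]; exists K. Qed.

Lemma same_component_trans X x y z :
  same_component X x y -> same_component X y z -> same_component X x z.
Proof.
move=> [K [h1 [h2 [h3 h4]]]] [K' [h1' [h2' [h3' h4']]]]; exists (K `|` K').
split; first by move=> t [/h1|/h1'].
by split; [exact: sconnectedU h4 h3'|split; [left|right]].
Qed.

Lemma same_component_mem X x y : same_component X x y -> X x /\ X y.
Proof. by move=> [K [KX [_ [Kx Ky]]]]; split; exact: KX. Qed.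

Lemma component_sconnected X x : sconnected [set y | same_component X x y].
Proof.
apply: sconnected_pairs => y z xy xz.
have [K [h1 [h2 [h3 h4]]]] := same_component_trans (same_component_sym xy) xz.
exists K; split => // t Kt /=; apply: (same_component_trans xy).
by exists K.
Qed.

Lemma component_adherent X x y : X x -> X y -> adherent [set y | same_component X x y] y ->
  same_component X x y.
Proof.
move=> Xx Xy ay; exists ([set y | same_component X x y] `|` [set y]); split.
  by move=> t [xt|->] //; have [] := same_component_mem xt.
split; first exact: sconnected_adherent (@component_sconnected _ _) ay.
split; last by right.
left; exists [set x]; split; first by move=> t ->.
split => //; move=> U V _ _ _ disj [_ [-> Ux]] [_ [-> Vx]].
by have : set0 x by rewrite -disj.
Qed.

(** The path interpolates the moduli linearly and normalises the segment between the directions.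
    This fails only for opposite directions, which are joined through i w. *)
Lemma annulus_connected (I : R -> Prop) (P : C -> Prop) :
  (forall a, I a -> 0 < a) ->
  (forall a b t, I a -> I b -> 0 <= t <= 1 -> I (a + t * (b - a))) ->
  (forall w, I (nm w) -> P w -> exists2 e, 0 < e & forall z, dc w z < e -> I (nm z) -> P z) ->
  (forall w, I (nm w) -> ~ P w -> exists2 e, 0 < e & forall z, dc w z < e -> I (nm z) -> ~ P z) ->
  forall w w', I (nm w) -> I (nm w') -> P w -> P w'.
Proof.
move=> Ip Ic Po Pc.
have main w w' : I (nm w) -> I (nm w') -> w / (nm w)%:C%C <> - (w' / (nm w')%:C%C) -> P w -> P w'.
  move=> Iw Iw' no; have w0 := Ip _ Iw; have w'0 := Ip _ Iw'.
  pose u := w / (nm w)%:C%C; pose u' := w' / (nm w')%:C%C.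
  have nmu z : 0 < nm z -> nm (z / (nm z)%:C%C) = 1.
    by move=> z0; rewrite nmM nmV nm_real gtr0_norm // divff // gt_eqF.
  have nu : nm u = 1 by exact: nmu.
  have nu' : nm u' = 1 by exact: nmu.
  pose v (t : R) := u + t%:C%C * (u' - u).
  have v0 t : 0 <= t <= 1 -> v t != 0.
    move=> t01; apply/eqP => vt.
    have E : (1 - t)%:C%C * u = - (t%:C%C * u').
      by move: vt; rewrite /v rmorphB rmorph1 => vt; rewrite -[RHS]addr0 -vt; ring.
    have tt : 1 - t = t.
      have := congr1 nm E; rewrite nmN (nmM _ u) (nmM _ u') !nm_real nu nu' !mulr1 !ger0_norm //; lra.
    have t0 : t%:C%C != 0 :> C by rewrite -nm_gt0 nm_real normr_gt0; apply/eqP; lra.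
    by apply: no; move: E; rewrite tt -mulrN => /(mulfI t0).
  pose g t := (nm w + t * (nm w' - nm w))%:C%C * (v t / (nm (v t))%:C%C).
  have ng t : 0 <= t <= 1 -> nm (g t) = nm w + t * (nm w' - nm w).
    move=> t01; rewrite /g nmM nmu ?nm_gt0 ?v0 // mulr1 nm_real ger0_norm //.
    exact/ltW/Ip/Ic.
  have Ig t : 0 <= t <= 1 -> I (nm (g t)) by move=> t01; rewrite ng //; exact: Ic.
  have recon z : 0 < nm z -> (nm z)%:C%C * (z / (nm z)%:C%C) = z.
    move=> z0; rewrite mulrC divfK //; by rewrite -nm_gt0 nm_real normr_gt0 gt_eqF.
  have g0 : g 0 = w.
    rewrite /g mul0r addr0 /v mul0r addr0 nu rmorph1 divr1; exact: recon.
  have g1 : g 1 = w'.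
    rewrite /g mul1r addrC subrK /v mul1r addrC subrK nu' rmorph1 divr1; exact: recon.
  rewrite -g0 -g1; apply: (@path_connected C C dc).
  - move=> t t01.
    have cid : mcont dr dc (fun t : R => t%:C%C) t by apply/rcont_cplx; exact: rcont_id.
    have cv : mcont dr dc v t.
      apply: ccontD; first exact: ccont_cst.
      by apply: ccontM => //; exact: ccont_cst.
    apply: ccontM; first by apply/rcont_cplx; exact: rcont_affine.
    apply: ccont_div => //; first by apply/rcont_cplx; exact: cont_nm.
    by rewrite -nm_gt0 nm_real normr_gt0 nm_eq0 v0.
  - move=> t t01 Pt; have [e e0 H] := Po _ (Ig t t01) Pt.
    by exists e => // s s01 /H; apply; exact: Ig.
  - move=> t t01 Pt; have [e e0 H] := Pc _ (Ig t t01) Pt.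
    by exists e => // s s01 /H; apply; exact: Ig.
move=> w w' Iw Iw' Pw; have w0 := Ip _ Iw; have w'0 := Ip _ Iw'.
have [E|no] := pselect (w / (nm w)%:C%C = - (w' / (nm w')%:C%C)); last exact: main no Pw.
pose ii : C := (0 +i* 1)%C.
have niw : nm (ii * w) = nm w by rewrite nmM nm_i mul1r.
have u0 : w / (nm w)%:C%C != 0.
  by rewrite -nm_gt0 nmM nmV nm_real gtr0_norm // divff ?ltr01 // gt_eqF.
have ic (k : C) : k != 0 -> w / (nm w)%:C%C * k <> 0.
  by move=> k0; apply/eqP; rewrite mulf_neq0.
have P2 : P (ii * w).
  apply: (main w) => //; first by rewrite niw.
  rewrite niw => h; apply: (ic (1 + ii)); last first.
    have -> : w / (nm w)%:C%C * (1 + ii) = w / (nm w)%:C%C - - (ii * w / (nm w)%:C%C) by ring.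
    by rewrite -h subrr.
  by apply/eqP => /(congr1 (@complex.Re R)); rewrite ReD /=; lra.
apply: (main (ii * w)) => //; first by rewrite niw.
rewrite niw -E => h; apply: (ic (ii - 1)); last first.
  have -> : w / (nm w)%:C%C * (ii - 1) = ii * w / (nm w)%:C%C - w / (nm w)%:C%C by ring.
  by rewrite h subrr.
by apply/eqP => /(congr1 (@complex.Re R)); rewrite ReD ReN /=; lra.
Qed.

End Connectedness.

(** * Convexity of the sets of radii *)

Section ConvexCombination.
Variable R : realType.
Implicit Types a b t c : R.

Lemma conv_min a b t : 0 <= t <= 1 -> Num.min a b <= a + t * (b - a).
Proof.
move=> /andP[t0 t1]; case: (leP a b) => ab.
  by rewrite lerDl mulr_ge0 // subr_ge0.
have : 0 <= (1 - t) * (a - b) by rewrite mulr_ge0 //; lra.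
lra.
Qed.

Lemma conv_max a b t : 0 <= t <= 1 -> a + t * (b - a) <= Num.max a b.
Proof.
move=> /andP[t0 t1]; case: (leP a b) => ab.
  have : 0 <= (1 - t) * (b - a) by rewrite mulr_ge0 //; lra.
  lra.
have : 0 <= t * (a - b) by rewrite mulr_ge0 //; lra.
lra.
Qed.

Lemma conv_gt c a b t : c < a -> c < b -> 0 <= t <= 1 -> c < a + t * (b - a).
Proof. by move=> ca cb /conv_min h; apply: lt_le_trans (h a b); rewrite lt_min ca. Qed.

Lemma conv_lt c a b t : a < c -> b < c -> 0 <= t <= 1 -> a + t * (b - a) < c.
Proof. by move=> ca cb /conv_max h; apply: le_lt_trans (h a b) _; rewrite gt_max ca. Qed.

Lemma conv_lte (c : \bar R) a b t : (a%:E < c)%E -> (b%:E < c)%E -> 0 <= t <= 1 ->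
  ((a + t * (b - a))%:E < c)%E.
Proof.
move=> ca cb /conv_max h; have := h a b; case: (leP a b) => _ k.
  by apply: le_lt_trans cb; rewrite lee_fin.
by apply: le_lt_trans ca; rewrite lee_fin.
Qed.

End ConvexCombination.

(** * The ends of an annulus are connected *)

Section Ends.
Variable R : realType.
Local Notation d := (@chordal R).
Local Notation dr := (@dR R).
Local Notation S := (sphere R).
Variables (A : set S) (L : S -> R) (lv : R -> Prop) (mid : R).
Hypotheses (oA : dopen A) (cL : forall p, A p -> mcont d dr L p).
Hypothesis below : forall p, A p -> exists2 s, lv s & s < L p.
Hypothesis cpt : forall p s, ~ A p -> lv s ->
  exists2 e, 0 < e & forall q, A q -> s <= L q <= mid -> e <= d p q.
Hypothesis conn : forall s (U V : set S), lv s -> dopen U -> dopen V ->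
  (forall q, A q -> L q < s -> U q \/ V q) -> (forall q, U q -> V q -> False) ->
  forall q q', A q -> A q' -> L q < s -> L q' < s -> U q -> U q'.
Hypothesis lv_mid : lv mid.

(** The boundary of A on its low side. L is |phi| for the inner end and -|phi| for the outer one;
    [lv] holds the admissible levels, and by [cpt] the part of A between a level and [mid] keeps
    away from each point outside A. *)
Definition ann_end : set S := [set p | ~ A p /\ adherent [set q | A q /\ L q < mid] p].

Lemma end_closed p : ~ ann_end p -> exists2 r, 0 < r & forall y, d p y < r -> ~ ann_end y.
Proof.
move=> np; have [Ap|nAp] := pselect (A p).
  by have [r r0 rA] := oA Ap; exists r => // y /rA Ay [].
have [|r r0 H] := @adherentN R [set q | A q /\ L q < mid] p; first by move=> ap; apply: np.
exists (r / 2); first lra.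
move=> y yr [_ ay]; have [|q Aq yq] := ay (r / 2); first lra.
apply: (H q) => //; have := chordal_tri y p q; lra.
Qed.

(** Points of A close to p cannot lie between the levels s and mid, so they are below s. *)
Lemma end_near p s e : ann_end p -> lv s -> 0 < e -> exists q, [/\ A q, L q < s & d p q < e].
Proof.
move=> [nAp ap] ls e0; have [e' e'0 H] := cpt nAp ls.
have [|q [Aq Lq] pq] := ap (Num.min e e'); first by rewrite lt_min e0.
rewrite lt_min in pq; case/andP: pq => pq pq'.
exists q; split => //; rewrite ltNge; apply/negP => sL.
by have := H q Aq; rewrite sL (ltW Lq) => /(_ isT); lra.
Qed.

Lemma lv_min s s' : lv s -> lv s' -> lv (Num.min s s').
Proof. by move=> ls ls'; case: (leP s s'). Qed.

(** Two pieces of the end would be at a positive distance [del]. Their del/2-neighbourhoods are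
    disjoint and, by compactness of the sphere, cover A below some level s; that part of A is
    connected but meets both. *)
Lemma end_connected : sconnected ann_end.
Proof.
move=> U V /sopenP oU /sopenP oV sub disj [u [Xu Uu]] [v [Xv Vv]].
have dis z : ann_end z -> U z -> V z -> False.
  by move=> Xz Uz Vz; have : set0 z by rewrite -disj.
have [del del0 Hdel] : exists2 e, 0 < e & forall x y, ann_end x -> ann_end y ->
    U x -> V y -> e <= d x y.
  suff [e e0 H] : exists2 e, 0 < e & forall x y, [set: S] x -> ann_end x -> ann_end y ->
    U x -> V y -> e <= d x y by exists e => // x y; exact: H.
  apply: (@sphere_cousin R (fun B => exists2 e, 0 < e & forall x y, B x -> ann_end x ->
    ann_end y -> U x -> V y -> e <= d x y)).
  - by move=> B B' BB' [e e0 H]; exists e => // x y /BB'; exact: H.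
  - move=> B B' [e e0 H] [e' e'0 H']; exists (Num.min e e'); first by rewrite lt_min e0.
    move=> x y [Bx|Bx] Xx Xy Ux Vy.
      by rewrite ge_min (H x y).
    by rewrite ge_min (H' x y) ?orbT.
  move=> p; have [Xp|nXp] := pselect (ann_end p); last first.
    by have [r r0 H] := end_closed nXp; exists r => //; exists 1 => // x y /H.
  have [Up|Vp] := sub p Xp.
    have [r r0 rU] := oU p Up; exists (r / 2); first lra.
    exists (r / 2); first lra.
    move=> x y; rewrite /dball /= => px Xx Xy Ux Vy; rewrite leNgt; apply/negP => xy.
    by apply: (dis y) => //; apply: rU; rewrite /dball /=; have := chordal_tri x p y; lra.
  have [r r0 rV] := oV p Vp; exists r => //; exists 1 => // x y /rV Vx Xx _ Ux.
  by case: (dis x).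
pose U' : set S := [set q | exists2 x, ann_end x /\ U x & d x q < del / 2].
pose V' : set S := [set q | exists2 x, ann_end x /\ V x & d x q < del / 2].
have oW (W : set S) : dopen [set q | exists2 x, ann_end x /\ W x & d x q < del / 2].
  move=> q [x Wx xq]; exists (del / 2 - d x q); first by rewrite subr_gt0.
  by move=> t; rewrite /dball /= => qt; exists x => //; have := chordal_tri q x t; lra.
have [s ls Hs] : exists2 s, lv s & forall q, A q -> L q < s -> U' q \/ V' q.
  suff [s ls H] : exists2 s, lv s & forall q, [set: S] q -> A q -> L q < s -> U' q \/ V' q.
    by exists s => // q; exact: H.
  apply: (@sphere_cousin R (fun B => exists2 s, lv s & forall q, B q -> A q -> L q < s -> U' q \/ V' q)).
  - by move=> B B' BB' [e e0 H]; exists e => // x /BB'; exact: H.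
  - move=> B B' [s ls H] [s' ls' H']; exists (Num.min s s'); first exact: lv_min.
    by move=> q [Bq|Bq] Aq; rewrite lt_min => /andP[q1 q2]; [exact: H|exact: H'].
  move=> p; have [Ap|nAp] := pselect (A p).
    have [s ls sL] := below Ap; have sL0 : 0 < L p - s by rewrite subr_gt0.
    have [r r0 H] := cL Ap sL0.
    exists r => //; exists s => // q /H; rewrite /dR ltr_norml => h Aq; lra.
  have [Xp|nXp] := pselect (ann_end p).
    have pp : d p p < del / 2 by rewrite chordalxx; lra.
    have [Up|Vp] := sub p Xp.
      have [r r0 rU] := oW U p (ex_intro2 _ _ p (conj Xp Up) pp).
      by exists r => //; exists mid => // q /rU; left.
    have [r r0 rV] := oW V p (ex_intro2 _ _ p (conj Xp Vp) pp).
    by exists r => //; exists mid => // q /rV; right.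
  have [|r r0 H] := @adherentN R [set q | A q /\ L q < mid] p; first by move=> ap; apply: nXp.
  by exists r => //; exists mid => // q /H h Aq Lq; case: h.
have e2 : 0 < del / 2 by lra.
have [q [Aq Lq uq]] := end_near Xu ls e2; have [q' [Aq' Lq' vq]] := end_near Xv ls e2.
have disj' t : U' t -> V' t -> False.
  move=> [x [Xx Ux] xt] [y [Xy Vy] yt]; have := Hdel x y Xx Xy Ux Vy.
  by have := chordal_tri t x y; rewrite (chordalC t y); lra.
have Uq : U' q by exists u.
have Vq' : V' q' by exists v.
have := conn ls (oW U) (oW V) Hs disj' Aq Aq' Lq Lq' Uq.
by move/disj'; apply.
Qed.

Lemma end_same_component x y : ann_end x -> ann_end y -> same_component (~` A) x y.
Proof.
move=> Xx Xy; exists ann_end; split; first by move=> z [].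
by split; [exact: end_connected|].
Qed.

End Ends.

(** * The core curve separates what the annulus separates *)

Section Separation.
Variable R : realType.
Local Notation C := (R[i]).
Local Notation nm := (@Normc.normc R).
Local Notation dc := (@dC R).
Local Notation dr := (@dR R).
Local Notation d := (@chordal R).
Local Notation S := (sphere R).
Variables (A : set S) (phi : S -> C) (psi : C -> S) (r1 : R) (r2 : \bar R).
Hypotheses (oA : dopen A) (r10 : 0 <= r1).
Hypothesis psiP : forall w, round_annulus r1 r2 w -> A (psi w) /\ phi (psi w) = w.
Hypothesis phiP : forall p, A p -> round_annulus r1 r2 (phi p) /\ psi (phi p) = p.
Hypothesis cpsi : forall w, round_annulus r1 r2 w -> mcont dc d psi w.
Hypothesis cphi : forall p, A p -> mcont d dc phi p.
Variable rho : R.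
Hypotheses (rho1 : r1 < rho) (rho2 : (rho%:E < r2)%E).

Let N p := nm (phi p).

Lemma cN p : A p -> mcont d dr N p.
Proof. by move=> /cphi; exact: cont_nm. Qed.

Lemma level_compact p s s' : ~ A p -> r1 < s -> (s'%:E < r2)%E ->
  exists2 e, 0 < e & forall q, A q -> s <= N q <= s' -> e <= d p q.
Proof.
move=> nAp s1 s2; have r1_ := r10.
have [ss'|ss'] := leP s s'; last by exists 1 => // q _; lra.
have inA w : s <= nm w <= s' -> round_annulus r1 r2 w.
  by move=> /andP[w1 w2]; split; [lra|apply: le_lt_trans s2; rewrite lee_fin].
have [||||w0 w0in Hw0] := @extreme_value R (fun w => s <= nm w <= s') (fun w => - d p (psi w)).
- by exists s' => z /andP[].
- move=> z nz; have cn := cont_nm (mcont_id dc z).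
  have [z1|z1] := ltP (nm z) s.
    have [e e0 H] := cn (s - nm z) ltac:(lra); exists e => // w /H.
    by rewrite /dR ltr_norml => h /andP[]; lra.
  have z2 : s' < nm z by rewrite ltNge; apply/negP => z2; apply: nz; rewrite z1.
  have [e e0 H] := cn (nm z - s') ltac:(lra); exists e => // w /H.
  by rewrite /dR ltr_norml => h /andP[]; lra.
- exists s%:C%C; rewrite nm_real ger0_norm; lra.
- move=> z /inA zin; apply: rcontN; move=> e e0; have [r r0 H] := cpsi zin e0; exists r => // w /H.
  apply: le_lt_trans; rewrite /dR ler_norml; have := chordal_tri (psi w) p (psi z).
  by have := chordal_tri (psi z) p (psi w); rewrite (chordalC (psi w) (psi z)); lra.
exists (d p (psi w0)).
  rewrite lt_neqAle chordal_ge0 andbT eq_sym; apply/eqP => /chordal_eq0 E.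
  by apply: nAp; rewrite E; have [] := psiP (inA _ w0in).
move=> q Aq Nq; have [_ <-] := phiP Aq.
by have := Hw0 _ Nq; rewrite lerN2.
Qed.

Lemma level_conn (I : R -> Prop) (U V : set S) : (forall a, I a -> r1 < a /\ (a%:E < r2)%E) ->
  (forall a b t, I a -> I b -> 0 <= t <= 1 -> I (a + t * (b - a))) ->
  dopen U -> dopen V -> (forall q, A q -> I (N q) -> U q \/ V q) ->
  (forall q, U q -> V q -> False) ->
  forall q q', A q -> A q' -> I (N q) -> I (N q') -> U q -> U q'.
Proof.
move=> Ir Ic oU oV cov disj q q' Aq Aq' Iq Iq' Uq; have r1_ := r10.
have inA w : I (nm w) -> round_annulus r1 r2 w by move=> /Ir [].
have [_ E] := phiP Aq; have [_ E'] := phiP Aq'.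
rewrite -E'; apply: (@annulus_connected R I (fun w => U (psi w))) Iq Iq' _ => //.
- by move=> a /Ir [h _]; lra.
- move=> w Iw Uw; have [r r0 rU] := oU _ Uw; have [e e0 H] := cpsi (inA _ Iw) r0.
  by exists e => // z /H /rU.
- move=> w Iw nU; have [Aw pw] := psiP (inA _ Iw).
  have Vw : V (psi w) by case: (cov _ Aw) => //; rewrite /N pw.
  have [r r0 rV] := oV _ Vw; have [e e0 H] := cpsi (inA _ Iw) r0.
  by exists e => // z /H /rV Vz _ Uz; exact: disj Uz Vz.
- by rewrite E.
Qed.

Let Xm := ann_end A N rho.
Let Xp := ann_end A (fun p => - N p) (- rho).

Lemma Xm_component x y : Xm x -> Xm y -> same_component (~` A) x y.
Proof.
apply: (@end_same_component R A N (fun s => r1 < s) rho) => //.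
- exact: cN.
- move=> p Ap; have [[h _] _] := phiP Ap; rewrite -/(N p) in h.
  by exists ((r1 + N p) / 2); lra.
- by move=> p s nAp s1; exact: level_compact.
- move=> s U V s1 oU oV cov disj q q' Aq Aq' Nq Nq'.
  pose I a := r1 < a < s /\ (a%:E < r2)%E.
  have IA t : A t -> N t < s -> I (N t).
    by move=> At Nt; have [[h1 h2] _] := phiP At; split => //; rewrite h1.
  apply: (@level_conn I U V) => //; try exact: IA.
  + by move=> a [/andP[]].
  + move=> a b t [/andP[a1 a2] a3] [/andP[b1 b2] b3] t01; split.
      by apply/andP; split; [exact: conv_gt|exact: conv_lt].
    exact: conv_lte.
  + by move=> t At [/andP[_ ts] _]; exact: cov.
Qed.

Lemma Xp_component x y : Xp x -> Xp y -> same_component (~` A) x y.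
Proof.
apply: (@end_same_component R A (fun p => - N p) (fun s => ((- s)%:E < r2)%E) (- rho)) => //.
- by move=> p Ap; apply: rcontN; exact: cN.
- move=> p Ap; have [[_ h] _] := phiP Ap; rewrite -/(N p) in h.
  case: (r2) h => [t|_|//]; last by exists (- (N p + 1)); rewrite ?ltry //; lra.
  rewrite lte_fin => h; exists (- ((N p + t) / 2)); last lra.
  by rewrite opprK lte_fin; lra.
- move=> p s nAp s1; have [e e0 H] := level_compact nAp rho1 s1; exists e => // q Aq h.
  apply: H => //; lra.
- move=> s U V s1 oU oV cov disj q q' Aq Aq' Nq Nq'.
  pose I a := r1 < a /\ - s < a /\ (a%:E < r2)%E.
  have IA t : A t -> - N t < s -> I (N t).
    by move=> At Nt; have [[h1 h2] _] := phiP At; split => //; split => //; lra.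
  apply: (@level_conn I U V) => //; try exact: IA.
  + by move=> a [? []].
  + move=> a b t [a1 [a2 a3]] [b1 [b2 b3]] t01; split; first exact: conv_gt.
    by split; [exact: conv_gt|exact: conv_lte].
  + by move=> t At [_ [ts _]]; apply: cov => //; lra.
- by rewrite opprK.
Qed.

Lemma boundary_end p : ~ A p -> adherent A p -> Xm p \/ Xp p.
Proof.
move=> nAp ap; have [e e0 H] := level_compact nAp rho1 rho2.
have [am|nam] := pselect (adherent [set q | A q /\ N q < rho] p); first by left.
right; split => // e' e'0; have [r r0 Hr] := adherentN nam.
have [|q Aq pq] := ap (Num.min e (Num.min e' r)); first by rewrite !lt_min e0 e'0.
rewrite !lt_min in pq; case/and3P: pq => q1 q2 q3.
exists q => //; split => //; rewrite ltrN2 ltNge; apply/negP => qle.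
have [ql|ql] := ltP (N q) rho; first exact: (Hr q q3).
by have := H q Aq; rewrite ql qle => /(_ isT); lra.
Qed.

(** Along the projection of a segment of C^2 from x to a point of A, the first point adherent to A
    is a boundary point, and the path up to it stays outside A. *)
Lemma outside_end x : ~ A x -> exists2 y, Xm y \/ Xp y & same_component (~` A) x y.
Proof.
move=> nAx; have r1_ := r10.
have rhoA : round_annulus r1 r2 rho%:C%C by split; rewrite nm_real gtr0_norm //; have := rho1; lra.
have [Aa _] := psiP rhoA; set a := psi rho%:C%C in Aa.
have xa : x <> a by move=> E; apply: nAx; rewrite E.
pose v := lift x; pose w := lift a.
have det0 : hdet v w != 0.
  by apply/eqP => E; apply: xa; apply: chordal_eq0; rewrite chordalE E nm0 mulr0 mul0r.
pose p1 (t : R) := v.1 + t%:C%C * (w.1 - v.1); pose p2 (t : R) := v.2 + t%:C%C * (w.2 - v.2).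
have nz t : (p1 t, p2 t) != (0, 0).
  apply/eqP => -[E1 E2].
  have e1 : t%:C%C * hdet v w = v.1 * p2 t - p1 t * v.2 by rewrite /p1 /p2 /hdet; ring.
  have e2 : (1 - t%:C%C) * hdet v w = p1 t * w.2 - w.1 * p2 t by rewrite /p1 /p2 /hdet; ring.
  have : hdet v w = 0.
    have -> : hdet v w = t%:C%C * hdet v w + (1 - t%:C%C) * hdet v w by ring.
    by rewrite e1 e2 E1 E2 !(mulr0, mul0r) !subrr addr0.
  by move/eqP; rewrite (negbTE det0).
pose g t := proj (p1 t, p2 t).
have cg t : mcont dr d g t.
  have cid : mcont dr dc (fun t : R => t%:C%C) t by apply/rcont_cplx; exact: rcont_id.
  have cp (y y' : C) : mcont dr dc (fun t : R => y + t%:C%C * (y' - y)) t.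
    apply: ccontD; first exact: ccont_cst.
    by apply: ccontM; [exact: cid|exact: ccont_cst].
  exact: (mcont_proj (cp v.1 w.1) (cp v.2 w.2) (nz t)).
have g0 : g 0 = x.
  by rewrite /g /p1 /p2 !mul0r !addr0 -surjective_pairing /v proj_lift.
have g1 : g 1 = a.
  have E (z z' : C) : z + 1 * (z' - z) = z' by ring.
  by rewrite /g /p1 /p2 rmorph1 !E -surjective_pairing /w proj_lift.
have [ax|nax] := pselect (adherent A x).
  have xx : same_component (~` A) x x.
    exists [set x]; split; first by move=> t ->.
    split => //; move=> U V _ _ _ disj [_ [-> Ux]] [_ [-> Vx]].
    by have : set0 x by rewrite -disj.
  by exists x => //; exact: boundary_end.
have [t [t01 before at_]] : exists t, [/\ 0 < t <= 1, forall s, 0 <= s < t -> ~ adherent A (g s) & adherent A (g t)].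
  apply: contrapT => no.
  have : ~ adherent A (g 1).
    apply: (@real_induction R (fun t => ~ adherent A (g t))); last lra.
    - by rewrite g0.
    - move=> t t01 H; have /adherentN [r r0 Hr] := H t ltac:(lra).
      have [e e0 He] := cg t (r / 2) ltac:(lra).
      exists e => // s ste s1 as_; have [|q Aq sq] := as_ (r / 2); first lra.
      apply: (Hr q) Aq; have := He s; rewrite dRC /dR ger0_norm; last lra.
      by move=> /(_ ltac:(lra)); have := chordal_tri (g s) (g t) q; lra.
    - by move=> t t01 H at_; apply: no; exists t.
  by apply; move=> e e0; exists a => //; rewrite g1 chordalxx.
have nAt : ~ A (g t).
  move=> At; have [r r0 rA] := oA At; have [e e0 He] := cg t r r0.
  pose s := Num.max 0 (t - e / 2).
  have s0 : 0 <= s by rewrite le_max lexx.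
  have st : s < t by rewrite gt_max; lra.
  have sd : t - e / 2 <= s by rewrite le_max lexx orbT.
  apply: (before s); first by rewrite s0.
  move=> e' e'0; exists (g s); last by rewrite chordalxx.
  by apply: rA; apply: He; rewrite /dR ger0_norm; lra.
exists (g t); first exact: boundary_end.
exists [set g (t * u) | u in [set u | 0 <= u <= 1]]; split.
  move=> _ [u u01 <-] Au; rewrite /= in u01.
  have [E|nE] := eqVneq u 1; first by apply: nAt; rewrite E mulr1 in Au.
  have u1 : u < 1 by rewrite lt_neqAle nE; lra.
  have tu : 0 < t * (1 - u) by apply: mulr_gt0; lra.
  have tu' : 0 <= t * u by apply: mulr_ge0; lra.
  apply: (before (t * u)); first by lra.
  by move=> e e0; exists (g (t * u)) => //; rewrite chordalxx.
split.
  apply: (@sconnected_path R (fun u => g (t * u))) => u.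
  have cm : mcont dr dr (fun u => t * u) u by apply: rcontM; [exact: rcont_cst|exact: rcont_id].
  exact: mcont_comp cm (cg _).
split; first by exists 0; [rewrite /=; lra|rewrite mulr0].
by exists 1; [rewrite /=; lra|rewrite mulr1].
Qed.

(** Every point outside A shares its component with one of the two connected ends, so the components
    of x and y contain different ends and exhaust the complement. Each of them, joined to the half
    annulus at its end, forms one side. *)
Lemma core_separates x y : ~ A x -> ~ A y -> ~ same_component (~` A) x y ->
  exists U V : set S, [/\ dopen U, dopen V, U x, V y &
    (forall p, U p -> V p -> False) /\ (forall p, [\/ U p, V p | A p /\ N p = rho])].
Proof.
move=> nAx nAy nxy.
have refl z : ~ A z -> same_component (~` A) z z.
  move=> nAz; exists [set z]; split; first by move=> t ->.
  split => //; move=> U V _ _ _ disj [_ [-> Ux]] [_ [-> Vx]].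
  by have : set0 z by rewrite -disj.
(* Stated for both sides at once. Near a point of the component of z there are no points of the
   other component, of the other half annulus, or of the core: each would make that point belong to
   z' or to A. *)
have opn (z z' : S) (B : set S) (Xother : set S) : ~ A z ->
    dopen B -> (forall p, Xother p -> same_component (~` A) z' p) ->
    (forall p, ~ A p -> adherent [set q | A q /\ ~ B q /\ N q != rho] p -> Xother p) ->
    (forall p, ~ A p -> same_component (~` A) z p \/ same_component (~` A) z' p) ->
    ~ A z' -> ~ same_component (~` A) z z' ->
    (forall p, B p -> A p) ->
    dopen (B `|` [set p | same_component (~` A) z p]).
  move=> nAz oB Xo aX cover nAz' nzz' BA p [Bp|zp].
    by have [r r0 rB] := oB p Bp; exists r => // t /rB; left.
  have [_ nAp] := same_component_mem zp.
  have nz'p : ~ same_component (~` A) z' p.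
    by move=> z'p; apply: nzz'; exact: same_component_trans zp (same_component_sym z'p).
  have [r r0 Hr] : exists2 r, 0 < r & forall q, d p q < r -> ~ same_component (~` A) z' q.
    have := @adherentN R [set q | same_component (~` A) z' q] p; apply => az'.
    by apply: nz'p; exact: component_adherent.
  have [r' r'0 Hr'] : exists2 r, 0 < r & forall q, d p q < r -> ~ (A q /\ ~ B q /\ N q != rho).
    have := @adherentN R [set q | A q /\ ~ B q /\ N q != rho] p; apply => ao.
    by apply: nz'p; apply: Xo; exact: aX.
  have [e e0 He] := level_compact nAp rho1 rho2.
  exists (Num.min r (Num.min r' e)); first by rewrite !lt_min r0 r'0.
  move=> q; rewrite /dball /= !lt_min => /and3P[q1 q2 q3].
  have [Bq|nBq] := pselect (B q); first by left.
  have [Aq|nAq] := pselect (A q).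
    exfalso; have [E|nE] := eqVneq (N q) rho.
      by have := He q Aq; rewrite E !lexx => /(_ isT); lra.
    exact: Hr' q2 (conj Aq (conj nBq nE)).
  by right; have [//|z'q] := cover q nAq; have := Hr q q1.
pose Bm : set S := [set p | A p /\ N p < rho]; pose Bp : set S := [set p | A p /\ rho < N p].
have oBm : dopen Bm.
  move=> p [Ap Np]; have [r r0 rA] := oA Ap; have Np0 : 0 < rho - N p by rewrite subr_gt0.
  have [e e0 H] := cN Ap Np0.
  exists (Num.min r e); first by rewrite lt_min r0.
  move=> q; rewrite /dball /= lt_min => /andP[/rA Aq /H]; rewrite /dR ltr_norml => h.
  by split => //; lra.
have oBp : dopen Bp.
  move=> p [Ap Np]; have [r r0 rA] := oA Ap; have Np0 : 0 < N p - rho by rewrite subr_gt0.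
  have [e e0 H] := cN Ap Np0.
  exists (Num.min r e); first by rewrite lt_min r0.
  move=> q; rewrite /dball /= lt_min => /andP[/rA Aq /H]; rewrite /dR ltr_norml => h.
  by split => //; lra.
have main z z' : ~ A z -> ~ A z' -> ~ same_component (~` A) z z' ->
   (exists2 u, Xm u & same_component (~` A) z u) -> (exists2 u, Xp u & same_component (~` A) z' u) ->
   exists U V : set S, [/\ dopen U, dopen V, U z, V z' &
    (forall p, U p -> V p -> False) /\ (forall p, [\/ U p, V p | A p /\ N p = rho])].
  move=> nAz nAz' nzz' [u Xu zu] [u' Xu' zu'].
  have zm p : Xm p -> same_component (~` A) z p.
    by move=> Xp'; exact: same_component_trans zu (Xm_component Xu Xp').
  have zp p : Xp p -> same_component (~` A) z' p.
    by move=> Xp'; exact: same_component_trans zu' (Xp_component Xu' Xp').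
  have cover p : ~ A p -> same_component (~` A) z p \/ same_component (~` A) z' p.
    move=> /outside_end [q [/zm zq|/zp zq] pq]; [left|right];
    exact: same_component_trans zq (same_component_sym pq).
  have nz'z : ~ same_component (~` A) z' z by move=> h; apply: nzz'; exact: same_component_sym.
  exists (Bm `|` [set p | same_component (~` A) z p]), (Bp `|` [set p | same_component (~` A) z' p]).
  split.
  - apply: (opn z z' Bm Xp) => //; last by move=> p [].
    move=> p nAp ap; split => // e e0; have [q [Aq [nB nE]] pq] := ap e e0.
    exists q => //; split => //; rewrite ltrN2 lt_neqAle eq_sym nE /= leNgt; apply/negP => h.
    exact: nB.
  - apply: (opn z' z Bp Xm) => //; first 1 last.
      by move=> p /cover []; [right|left].
      by move=> p [].
    move=> p nAp ap; split => // e e0; have [q [Aq [nB nE]] pq] := ap e e0.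
    exists q => //; split => //; rewrite lt_neqAle nE /= leNgt; apply/negP => h.
    exact: nB.
  - by right; exact: refl.
  - by right; exact: refl.
  split.
    move=> p [[Ap Np]|zp1] [[Ap' Np']|zp2].
    + lra.
    + by have [_] := same_component_mem zp2; apply.
    + by have [_] := same_component_mem zp1; apply.
    + by apply: nzz'; exact: same_component_trans zp1 (same_component_sym zp2).
  move=> p; have [Ap|/cover [zq|zq]] := pselect (A p).
  - case: (ltgtP (N p) rho) => h; [constructor 1; left|constructor 2; left|constructor 3] => //.
  - by constructor 1; right.
  - by constructor 2; right.
have [u [Xu|Xu] xu] := outside_end nAx; have [u' [Xu'|Xu'] yu'] := outside_end nAy.
- exfalso; apply: nxy; apply: (same_component_trans xu).
  exact: same_component_trans (Xm_component Xu Xu') (same_component_sym yu').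
- by apply: main => //; [exists u|exists u'].
- have nyx : ~ same_component (~` A) y x by move=> h; apply: nxy; exact: same_component_sym.
  have [||U [V [oU oV Uy Vx [dj cv]]]] := main y x nAy nAx nyx; [by exists u'|by exists u|].
  exists V, U; split => //; split; first by move=> p Vp Up; exact: dj Up Vp.
  by move=> p; case: (cv p) => h; [constructor 2|constructor 1|constructor 3].
- exfalso; apply: nxy; apply: (same_component_trans xu).
  exact: same_component_trans (Xp_component Xu Xu') (same_component_sym yu').
Qed.

End Separation.

(** * The inverse of the conformal map of the annulus *)

Section ConformalInverse.
Variable R : realType.
Local Notation C := (R[i]).
Local Notation nm := (@Normc.normc R).
Local Notation dc := (@dC R).
Local Notation d := (@chordal R).
Local Notation S := (sphere R).
Variables (A : set S) (phi : S -> C).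
Hypotheses (oA : dopen A) (hphi : holo_on A phi).
Hypothesis inj : forall p q, A p -> A q -> phi p = phi q -> p = q.

Lemma holo_chart p : A p -> exists b z0, p = chart b z0 /\
  exists2 s, 0 < s & forall z, csq z0 s z -> A (chart b z) /\ cdiff_at (fun u => phi (chart b u)) z.
Proof.
move=> Ap.
have near b z0 : p = chart b z0 -> exists2 s, 0 < s & forall z, csq z0 s z -> A (chart b z).
  move=> E; have [r r0 rA] := oA Ap; rewrite E in rA; have [e e0 H] := chart_cont b z0 r0.
  exists (e / 4); first lra.
  by move=> z /csq_nm h; apply: rA; apply: H; rewrite dCC /dC; lra.
case: p Ap near => [z0|] Ap near.
  exists false, z0; split => //; have [s s0 H] := near false z0 erefl; exists s => // z /H Az.
  by split => //; exact: (hphi Az).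
have E : None = chart true 0 :> S by rewrite chart_true eqxx.
exists true, 0; split => //; have [s s0 H] := near true 0 E; exists s => // z /H Az; split => //.
have [->|z0] := eqVneq z 0.
  have -> : (fun u => phi (chart true u)) = (fun u => phi (if u == 0 then None else Some u^-1)).
    by apply: funext => u; rewrite chart_true.
  exact: (hphi Ap).
rewrite chart_true (negbTE z0) in Az.
apply: (@cdiff_near _ (fun u => phi (Some u^-1))).
  have [e e0 He] := near_neq0 (mcont_id dc z) z0.
  by exists e => // w /He [w0 _]; rewrite chart_true (negbTE w0).
apply: (@cdiff_comp _ (fun u => u^-1) (fun u => phi (Some u))); last exact: (hphi Az).
by apply: cdiffV z0; exact: cdiff_id.
Qed.

Lemma holo_cont p : A p -> mcont d dc phi p.
Proof.
move=> Ap; have [b [z0 [pE [s s0 H]]]] := holo_chart Ap => e e0.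
have [_ df] := H z0 (csqxx z0 (ltW s0)).
have [r r0 Hr] := cdiff_cont df e0.
have [r' r'0 Hr'] := chart_inv b z0 r0.
by exists r' => // q; rewrite pE => /Hr' [z zr ->]; exact: Hr.
Qed.

Lemma holo_inverse (psi : C -> S) w0 : A (psi w0) -> phi (psi w0) = w0 ->
  (forall p, A p -> psi (phi p) = p) -> shol psi w0.
Proof.
move=> Aw pw psiK; have [b [z0 [pE [s s0 H]]]] := holo_chart Aw.
have fz0 : phi (chart b z0) = w0 by rewrite -pE.
have [||psi' [r [r0 _ Hr]]] := @local_inverse R (fun u => phi (chart b u)) z0 s s0.
- by move=> z /H [].
- by move=> z w /H [Az _] /H [Aw' _] /(inj Az Aw') /chart_inj.
exists b, psi', r => // w; rewrite dCC /dC => wr.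
have [|win fw dw] := Hr w; first by rewrite fz0.
by split => //; have [Az _] := H _ win; rewrite -[in LHS]fw psiK.
Qed.

End ConformalInverse.

(** * An open set with small boundary is small or nearly everything *)

Section Dichotomy.
Variable R : realType.
Local Notation C := (R[i]).
Local Notation nm := (@Normc.normc R).
Local Notation dc := (@dC R).
Local Notation dr := (@dR R).
Local Notation d := (@chordal R).
Local Notation S := (sphere R).

(* The witness k' is the antipode of k. *)
Lemma antipodal_path (k : S) : exists k' : S, forall s, s <> k -> exists g : R -> S,
  [/\ forall t, mcont dr d g t, g 0 = k', g 1 = s &
      forall t, 0 <= t <= 1 -> d k s <= d k (g t)].
Proof.
pose v := lift k; pose cj (z : C) : C := (complex.Re z +i* - complex.Im z)%C.
pose w : C * C := (- cj v.2, cj v.1).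
pose n : C := v.1 * cj v.1 + v.2 * cj v.2.
have v0 : 0 < hn v by rewrite hn_gt0 lift_nz.
have nE : n = (hn v ^+ 2)%:C%C.
  by rewrite hn_sq !nm_sq /n /cj; apply: ReImP; rewrite !(ReD, ImD, ReM, ImM) /=; ring.
have n0 : n != 0 by rewrite nE -nm_gt0 nm_real normr_gt0 expf_neq0 // gt_eqF.
have hnE (a b : C) : hn (a * v.1 + b * w.1, a * v.2 + b * w.2) ^+ 2 =
    (nm a ^+ 2 + nm b ^+ 2) * hn v ^+ 2.
  by rewrite !hn_sq [(_, _).1]/= [(_, _).2]/= !nm_sq !(ReD, ImD, ReN, ImN, ReM, ImM) /=; ring.
exists (proj w) => s sk; pose u := lift s.
pose al := (u.1 * cj v.1 + u.2 * cj v.2) / n; pose be := (v.1 * u.2 - v.2 * u.1) / n.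
have uE : u = (al * v.1 + be * w.1, al * v.2 + be * w.2).
  rewrite [LHS]surjective_pairing /al /be /w /=; congr (_, _).
    have -> : (u.1 * cj v.1 + u.2 * cj v.2) / n * v.1 + (v.1 * u.2 - v.2 * u.1) / n * - cj v.2 =
      u.1 * (n / n) by rewrite /n; ring.
    by rewrite divff // mulr1.
  have -> : (u.1 * cj v.1 + u.2 * cj v.2) / n * v.2 + (v.1 * u.2 - v.2 * u.1) / n * cj v.1 =
      u.2 * (n / n) by rewrite /n; ring.
  by rewrite divff // mulr1.
have be0 : be != 0.
  apply/eqP => b0; apply: sk; apply: chordal_eq0; rewrite chordalE -/u -/v.
  have -> : hdet u v = 0.
    by rewrite uE b0 /hdet /=; ring.
  by rewrite nm0 mulr0 mul0r.
pose q1 (t : R) := t%:C%C * al * v.1 + be * w.1; pose q2 (t : R) := t%:C%C * al * v.2 + be * w.2.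
have hq t : hn (q1 t, q2 t) ^+ 2 = (t ^+ 2 * nm al ^+ 2 + nm be ^+ 2) * hn v ^+ 2.
  by rewrite hnE nmM exprMn nm_real real_normK // num_real.
have q0 t : (q1 t, q2 t) != (0, 0).
  rewrite -hn_gt0 lt_neqAle hn_ge0 andbT eq_sym -sqrf_eq0 hq.
  rewrite mulf_eq0 negb_or; apply/andP; split; last by rewrite expf_neq0 // gt_eqF.
  rewrite gt_eqF //; apply: ltr_wpDl; first by rewrite mulr_ge0 ?sqr_ge0.
  by rewrite exprn_gt0 // nm_gt0.
exists (fun t => proj (q1 t, q2 t)); split.
- move=> t; have cid : mcont dr dc (fun t : R => t%:C%C) t by apply/rcont_cplx; exact: rcont_id.
  have cq (y y' : C) : mcont dr dc (fun t : R => t%:C%C * al * y + be * y') t.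
    apply: ccontD; last exact: ccont_cst.
    by apply: ccontM; [apply: ccontM; [exact: cid|]|]; exact: ccont_cst.
  exact: (mcont_proj (cq v.1 w.1) (cq v.2 w.2) (q0 t)).
- have w0 : w != (0, 0).
    rewrite -hn_gt0 lt_neqAle hn_ge0 andbT eq_sym -sqrf_eq0.
    have := hnE 0 1; rewrite !mul0r !add0r !mul1r -surjective_pairing nm0 nm1 => ->.
    by rewrite expr0n expr1n add0r mul1r expf_neq0 // gt_eqF.
  apply: chordal_eq0; rewrite chordal_proj //; have -> : hdet (q1 0, q2 0) w = 0.
    by rewrite /q1 /q2 /hdet /=; ring.
  by rewrite nm0 mulr0 mul0r.
- have -> : (q1 1, q2 1) = u by rewrite uE /q1 /q2 !mul1r.
  exact: proj_lift.
move=> t t01; rewrite -(proj_lift k) -(proj_lift s) -/v -/u !chordal_proj ?lift_nz //.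
have dE t' : hdet v (q1 t', q2 t') = be * n by rewrite /q1 /q2 /hdet /w /n /=; ring.
have uq : u = (q1 1, q2 1) by rewrite uE /q1 /q2 !mul1r.
rewrite uq !dE.
have h1 t' : 0 < hn (q1 t', q2 t') by rewrite hn_gt0.
apply: ler_wpM2l; first by rewrite mulr_ge0 ?nm_ge0.
rewrite lef_pV2 ?posrE ?mulr_gt0 // ler_pM2l // -(ler_pXn2r (n := 2)) ?nnegrE ?hn_ge0 //.
rewrite !hq; apply: ler_wpM2r; first exact: sqr_ge0.
rewrite lerD2r; apply: ler_wpM2r; first exact: sqr_ge0.
by rewrite lerXn2r ?nnegrE; lra.
Qed.

(** A point farther than e from k is joined to the antipode of k by a path that never comes closer
    to k, hence misses the boundary of V. So V contains all of these points or none. *)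
Lemma dichotomy (V : set S) (k : S) e : 0 <= e -> dopen V ->
  (forall p, adherent V p -> ~ V p -> d k p <= e) ->
  (forall p, V p -> d k p <= e) \/ (forall p, e < d k p -> V p).
Proof.
move=> e0 oV bd; have [k' path] := antipodal_path k.
have link s : e < d k s -> (V k' <-> V s).
  move=> es; have sk : s <> k by move=> E; move: es; rewrite E chordalxx; lra.
  have [g [cg g0 g1 gd]] := path s sk.
  have far t : 0 <= t <= 1 -> e < d k (g t) by move=> /gd; lra.
  have opn t : 0 <= t <= 1 -> V (g t) -> exists2 r, 0 < r & forall u, 0 <= u <= 1 -> d (g t) (g u) < r -> V (g u).
    by move=> t01 Vt; have [r r0 rV] := oV _ Vt; exists r => // u _ /rV.
  have cls t : 0 <= t <= 1 -> ~ V (g t) -> exists2 r, 0 < r & forall u, 0 <= u <= 1 -> d (g t) (g u) < r -> ~ V (g u).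
    move=> t01 nV; have [|r r0 H] := @adherentN R V (g t); last by exists r => // u _ /H.
    by move=> at_; have := bd _ at_ nV; have := far t t01; lra.
  rewrite -g0 -g1; split; first exact: (@path_connected R S S d g V) (fun t _ => cg t) opn cls.
  move=> V1; apply: contrapT => nV0.
  apply: (@path_connected R S S d g (fun p => ~ V p)) (fun t _ => cg t) cls _ nV0 V1.
  move=> t t01 /contrapT Vt; have [r r0 H] := opn t t01 Vt; exists r => // u u01 /(H u u01) Vu.
  exact.
have [Vk|nVk] := pselect (V k').
  by right => p /link <-.
by left => p Vp; rewrite leNgt; apply/negP => /link h; apply: nVk; apply/h.
Qed.

(** The points 0, 1 and infinity are at least 1 apart, so at most one of them is within 1/2 of k. *)
Lemma two_far_points (k : S) : exists p q, [/\ 1 / 2 <= d k p, 1 / 2 <= d k q & 1 <= d p q].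
Proof.
have s2 : 1 <= Num.sqrt 2 :> R by rewrite -[leLHS]sqrtr1 ler_sqrt //; lra.
have s22 : Num.sqrt 2 * Num.sqrt 2 = 2 :> R by rewrite -expr2 sqr_sqrtr.
have p2 : 0 < Num.sqrt 2 :> R by lra.
have E2 : 2 / Num.sqrt 2 = Num.sqrt 2 :> R by rewrite -{1}s22 mulfK // gt_eqF.
have d1 : 1 <= d (Some 0) (None).
  by rewrite /chordal nm0 expr0n /= addr0 sqrtr1 divr1; lra.
have d2 : 1 <= d (Some 1) None.
  by rewrite /chordal nm1 expr1n (_ : 1 + 1 = 2) // E2.
have d3 : 1 <= d (Some 0) (Some 1).
  rewrite /chordal sub0r nmN nm1 nm0 expr0n expr1n /= addr0 mul1r mulr1.
  by rewrite (_ : 1 + 1 = 2) // E2.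
have tr p q : d p q <= d k p + d k q by rewrite (chordalC k p); exact: chordal_tri.
have := tr (Some 0) None; have := tr (Some 1) None; have := tr (Some 0) (Some 1).
case: (leP (1 / 2) (d k None)) => h1; case: (leP (1 / 2) (d k (Some 0))) => h2.
- by exists (Some 0), None.
- by move=> *; exists (Some 1), None; split => //; lra.
- by move=> *; exists (Some 0), (Some 1); split => //; lra.
- by move=> *; exfalso; lra.
Qed.

End Dichotomy.

(** * Equicontinuity and normality *)

Section Normality.
Variable R : realType.
Local Notation C := (R[i]).
Local Notation nm := (@Normc.normc R).
Local Notation dc := (@dC R).
Local Notation d := (@chordal R).
Local Notation S := (sphere R).

(* The refinement step of the Arzela-Ascoli theorem, by bisection of the square. *)
Lemma lipschitz_refine (u : nat -> C -> S) (z0 : C) (s L : R) : 0 < s -> 0 < L ->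
  (forall n z z', csq z0 s z -> csq z0 s z' -> d (u n z) (u n z') <= L * nm (z - z')) ->
  forall e, 0 < e -> forall P, frequently P -> exists Q, [/\ frequently Q, forall n, Q n -> P n &
    forall n m z, Q n -> Q m -> csq z0 s z -> d (u n z) (u m z) <= e].
Proof.
move=> s0 L0 lip e e0.
set X := complex.Re z0; set Y := complex.Im z0.
pose T (x y w h : R) := forall P, frequently P -> exists Q, [/\ frequently Q, forall n, Q n -> P n &
  forall n m z, Q n -> Q m -> inrect x (x + w) y (y + h) z -> d (u n z) (u m z) <= e].
have inE z : csq z0 s z <-> inrect (X - s) (X - s + 2 * s) (Y - s) (Y - s + 2 * s) z.
  rewrite /csq /inrect !(ReD, ImD, ReN, ImN) -/X -/Y !ler_norml.
  by split=> -[h1 h2]; split; lra.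
suff H : T (X - s) (Y - s) (2 * s) (2 * s).
  move=> P fP; have [Q [fQ QP cl]] := H P fP; exists Q; split => // n m z Qn Qm /inE; exact: cl.
apply: cousin; [lra|lra| |].
  move=> x y w h w0 h0 _ _ _ _ T1 T2 T3 T4 P fP.
  have [Q1 [f1 s1 c1]] := T1 P fP; have [Q2 [f2 s2 c2]] := T2 Q1 f1.
  have [Q3 [f3 s3 c3]] := T3 Q2 f2; have [Q4 [f4 s4 c4]] := T4 Q3 f3.
  exists Q4; split => //; first by move=> n /s4/s3/s2/s1.
  move=> n m z Qn Qm [zx zy].
  case: (leP (complex.Re z) (x + w / 2)) => hx; case: (leP (complex.Im z) (y + h / 2)) => hy.
  - by apply: c1; [exact/s2/s3/s4|exact/s2/s3/s4|split; lra].
  - by apply: c3; [exact/s4|exact/s4|split; lra].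
  - by apply: c2; [exact/s3/s4|exact/s3/s4|split; lra].
  - by apply: c4 => //; split; lra.
move=> x0 y0 xr yr; pose z1 : C := (x0 +i* y0)%C.
have z1in : csq z0 s z1 by apply/inE; split => /=; lra.
exists (e / (8 * L)); first by rewrite divr_gt0 // mulr_gt0.
move=> x y w h w0 h0 xx yy l1 l2 l3 l4 P fP.
have [c Hc] := frequently_cluster (fun n => u n z1) fP.
exists (fun n => P n /\ d c (u n z1) < e / 4); split.
- by apply: Hc; lra.
- by move=> n [].
move=> n m z [Pn cn] [Pm cm] [zx zy].
have zin : csq z0 s z by apply/inE; split; lra.
have zz : nm (z - z1) <= e / (4 * L).
  apply: (le_trans (nm_le_ReIm _)); rewrite !(ReD, ImD, ReN, ImN) /=.
  have : `|complex.Re z - x0| <= w by rewrite ler_norml; lra.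
  have : `|complex.Im z - y0| <= h by rewrite ler_norml; lra.
  have -> : e / (4 * L) = e / (8 * L) + e / (8 * L) by field; rewrite gt_eqF.
  lra.
have Lz k : d (u k z) (u k z1) <= e / 4.
  apply: (le_trans (lip k z z1 zin z1in)).
  have -> : e / 4 = L * (e / (4 * L)) by field; rewrite gt_eqF.
  by rewrite ler_pM2l.
have := chordal_tri (u n z1) (u n z) (u m z); have := chordal_tri c (u n z1) (u m z).
have := chordal_tri (u m z1) c (u m z); have := Lz n; have := Lz m.
rewrite (chordalC (u m z1) (u m z)) (chordalC (u n z1) c); lra.
Qed.

Lemma lipschitz_subsequence (u : nat -> C -> S) (z0 : C) (s L : R) : 0 < s -> 0 < L ->
  (forall n z z', csq z0 s z -> csq z0 s z' -> d (u n z) (u n z') <= L * nm (z - z')) ->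
  exists2 k : nat -> nat, (forall n, (k n < k n.+1)%N) &
    forall e, 0 < e -> exists N, forall n m z, (N <= n)%N -> (N <= m)%N -> csq z0 s z ->
      d (u (k n) z) (u (k m) z) <= e.
Proof.
move=> s0 L0 lip; have ref := lipschitz_refine s0 L0 lip.
have step (st : nat * (nat -> Prop)) : exists Q, frequently st.2 ->
    [/\ frequently Q, forall n, Q n -> st.2 n &
    forall n m z, Q n -> Q m -> csq z0 s z -> d (u n z) (u m z) <= 1 / st.1.+1%:R].
  have [fP|nf] := pselect (frequently st.2); last by exists st.2.
  have p0 : 0 < 1 / st.1.+1%:R :> R by rewrite divr_gt0 ?ltr0n.
  by have [Q hQ] := ref _ p0 st.2 fP; exists Q.
have [nxt nxtP] := choice step.
(* Nested infinite index sets for a diagonal choice: on [Ps] (m + 1) the maps differ by at most 1 /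
   (m + 1), and [k] n is taken from [Ps] n beyond the previous index. *)
pose Ps := fix Ps n := if n is m.+1 then nxt (m, Ps m) else fun=> True.
have fPs n : frequently (Ps n).
  elim: n => [|n IH]; first by move=> N; exists N.
  by have [] := nxtP (n, Ps n) IH.
have sub n m : (n <= m)%N -> forall i, Ps m i -> Ps n i.
  move=> /subnKC <-; elim: (m - n)%N => [|k IH] i; first by rewrite addn0.
  by rewrite addnS => h; apply: IH; have [_ h2 _] := nxtP ((n + k)%N, Ps (n + k)%N) (fPs (n + k)%N); exact: h2.
have pick (st : nat * nat) : exists i, (st.2 < i)%N /\ Ps st.1 i.
  by have [j] := fPs st.1 st.2.+1; exists j.
have [pk pkP] := choice pick.
pose k := fix k n := if n is m.+1 then pk (n, k m) else pk (0%N, 0%N).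
have kP n : Ps n (k n).
  by case: n => [|n]; [have [] := pkP (0%N, 0%N)|have [] := pkP (n.+1, k n)].
exists k; first by move=> n; have [] := pkP (n.+1, k n).
move=> e e0; have := archi_boundP (normr_ge0 (1 / e)); set N := Num.bound _ => hN.
exists N.+1 => n m z Nn Nm zin.
have [_ _ cl] := nxtP (N, Ps N) (fPs N).
have := cl (k n) (k m) z (sub N.+1 n Nn _ (kP n)) (sub N.+1 m Nm _ (kP m)) zin.
move=> h; apply: (le_trans h); rewrite /= ler_pdivrMr // mulrC -ler_pdivrMr //.
apply: (le_trans (ler_norm _)); apply: (le_trans (ltW hN)).
by rewrite ler_nat.
Qed.

(** A set of small diameter is visible in a single chart with bounded coordinates, which is where
    Cauchy's estimates apply. *)
Lemma chart_bounded b (w : C) t : nm w <= 1 -> d (chart b w) t <= 1 / 4 ->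
  exists2 w', nm w' <= 3 & t = chart b w'.
Proof.
move=> w1; suff H t' : d (Some w) t' <= 1 / 4 -> exists2 w', nm w' <= 3 & t' = Some w'.
  case: b; last exact: H.
  by rewrite /chart -(sinvK t) chordal_sinv => /H [w' w'3 ->]; exists w'.
have pr (x y : C) : ((x, y).1 = x) * ((x, y).2 = y) by [].
have hw : hn (w, 1) <= 2 by apply: (le_trans (hn_le _)); rewrite !pr nm1; lra.
have hw0 : 0 < hn (w, 1) by rewrite hn_gt0 xpair_eqE oner_eq0 andbF.
rewrite chordalE ler_pdivrMr ?mulr_gt0 ?hn_gt0 ?lift_nz // [lift (Some w)]/=.
case: t' => [w'|]; rewrite [lift _]/= /hdet !pr ?mulr1.
  move=> h; exists w' => //; rewrite leNgt; apply/negP => w3.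
  have h1 : hn (w', 1) <= nm w' + 1 by apply: (le_trans (hn_le _)); rewrite !pr nm1.
  have h2 : hn (w, 1) * hn (w', 1) <= 2 * (nm w' + 1) by apply: ler_pM; rewrite ?hn_ge0.
  have := nm_lower w' w; rewrite nm_dist; lra.
have -> : hn (1 : C, 0 : C) = 1 by rewrite /hn [(_, _).1]/= [(_, _).2]/= nm1 nm0 expr1n expr0n addr0 sqrtr1.
rewrite mulr0 sub0r nmN nm1; lra.
Qed.

(** The chart provided by [shol] may be the other one; the two coordinates are then inverse to each
    other and do not vanish. *)
Lemma chart_lift_cdiff (h : C -> S) (r : C -> C) b z : shol h z ->
  (exists2 e, 0 < e & forall w, dc z w < e -> h w = chart b (r w)) -> cdiff_at r z.
Proof.
move=> [b' [r' [e' e'0 H']]] [e e0 H].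
have both w : dc z w < Num.min e e' -> cdiff_at r' w /\ chart b (r w) = chart b' (r' w).
  by rewrite lt_min => /andP[/H <- /H' []].
have m0 : 0 < Num.min e e' by rewrite lt_min e0.
have [dz Ez] := both z ltac:(by rewrite dCxx).
have inv (a c : C) : chart true a = chart false c -> c != 0 /\ a = c^-1.
  rewrite chart_true; case: eqVneq => // a0 -[<-].
  by rewrite invr_neq0 // invrK.
case: (eqVneq b b') => bb.
  apply: (cdiff_near _ dz); exists (Num.min e e') => // w /both [_].
  by rewrite bb => /chart_inj.
have key : r' z != 0 /\ forall w, dc z w < Num.min e e' -> r w = (r' w)^-1.
  case: b bb both {H Ez} => [|]; case: b' {H'} => // _ both.
    split; first by have [_ /inv []] := both z ltac:(by rewrite dCxx).
    by move=> w /both [_ /inv []].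
  have k w : dc z w < Num.min e e' -> r w != 0 /\ r' w = (r w)^-1 by move=> /both [_ /esym /inv].
  split; first by have [r0 ->] := k z ltac:(by rewrite dCxx); rewrite invr_neq0.
  by move=> w /k [_ ->]; rewrite invrK.
apply: (@cdiff_near _ (fun w => (r' w)^-1)); last by apply: cdiffV => //; exact: key.1.
by exists (Num.min e e') => // w /key.2.
Qed.

Lemma chart_lipschitz b (z w : C) : d (chart b z) (chart b w) <= 2 * nm (z - w).
Proof.
suff H : d (Some z) (Some w) <= 2 * nm (z - w) by case: b => //; rewrite /chart chordal_sinv.
have q u : 1 <= 1 + nm u ^+ 2 by have := sqr_ge0 (nm u); lra.
have m1 : 1 <= (1 + nm z ^+ 2) * (1 + nm w ^+ 2) by rewrite -[X in X <= _]mulr1 ler_pM ?q.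
rewrite /chordal ler_pdivrMr ?sqrtr_gt0; last by lra.
by rewrite ler_peMr ?mulr_ge0 ?nm_ge0 // -[X in X <= _]sqrtr1 ler_wsqrtr.
Qed.

(** All values of f on U are within 1/4 of f(x), so f has a coordinate bounded by 3 on a fixed
    square. The Lipschitz estimate makes the family equi-Lipschitz, with 24 / s' = 2 (4 * 3 / s'),
    and a diagonal subsequence converges uniformly. *)
Lemma equi_normal (F : set (S -> S)) (U : set S) (x : S) : dopen U -> U x ->
  (forall f h z, F f -> shol h z -> shol (fun u => f (h u)) z) ->
  (forall f p q, F f -> U p -> U q -> d (f p) (f q) <= 1 / 4) -> fatou F x.
Proof.
move=> oU Ux Fs small; have [b [z0 [_ xE]]] := chart_surj x.
have [r r0 rU] := oU x Ux; rewrite xE in rU.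
have [e1 e10 H1] := chart_cont b z0 r0.
pose s := e1 / 4; have s0 : 0 < s by rewrite /s; lra.
have inU z : csq z0 s z -> U (chart b z).
  by move=> /csq_nm h; apply: rU; apply: H1; rewrite dCC /dC /s in h *; lra.
pose s' := 3 / 4 * s.
have s'0 : 0 < s' by rewrite /s'; lra.
have lip f z z' : F f -> csq z0 (s' / 2) z -> csq z0 (s' / 2) z' ->
    d (f (chart b z)) (f (chart b z')) <= 24 / s' * nm (z - z').
  move=> Ff zin z'in; have [b' [w [w1 wE]]] := chart_surj (f x).
  have ex u : exists v, csq z0 s u -> nm v <= 3 /\ f (chart b u) = chart b' v.
    have [uin|nu] := pselect (csq z0 s u); last by exists 0.
    have cl : d (chart b' w) (f (chart b u)) <= 1 / 4.
      by rewrite -wE; apply: small => //; exact: inU.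
    by have [v v3 vE] := chart_bounded w1 cl; exists v.
  have [rf rfP] := choice ex.
  have drf u : csq z0 s' u -> cdiff_at rf u.
    move=> uin; apply: (@chart_lift_cdiff (fun u => f (chart b u)) _ b'); first exact: Fs (shol_chart b u).
    exists (s / 4); first lra.
    move=> v; rewrite dCC /dC => vu; have [] := rfP v; last by [].
    case: uin => h1 h2; have E : v - z0 = (v - u) + (u - z0) by ring.
    have := Re_le_nm (v - u); have := Im_le_nm (v - u) => k1 k2.
    by split; rewrite E ?(ReD (v - u)) ?(ImD (v - u)); apply: (le_trans (ler_normD _ _)); rewrite /s' in h1 h2; lra.
  have ss (u : C) : csq z0 s' u -> csq z0 s u by apply: csq_le; rewrite /s'; lra.
  have rf3 u : csq z0 s' u -> nm (rf u) <= 3 by move=> /ss /rfP [].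
  have hs (u : C) : csq z0 (s' / 2) u -> csq z0 s u by move=> h; apply/ss; apply: csq_le h; lra.
  have [_ ->] := rfP z (hs _ zin); have [_ ->] := rfP z' (hs _ z'in).
  apply: (le_trans (chart_lipschitz _ _ _)).
  have := lipschitz_estimate s'0 drf rf3 zin z'in.
  have -> : 24 / s' = 2 * (4 * 3 / s') by field; rewrite gt_eqF.
  by rewrite -[2 * _ * _]mulrA ler_pM2l.
have h20 : 0 < s' / 2 by lra.
have [r2 r20 inv] := chart_inv b z0 h20; apply/fatouP; exists r2 => //.
move=> h Fh; have L0 : 0 < 24 / s' by rewrite divr_gt0.
have [k kmono kc] := lipschitz_subsequence h20 L0 (fun n z z' => lip (h n) z z' (Fh n)).
(* A cluster point exists at every p, so phi is total; where the subsequence is uniformly Cauchy it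
   is the limit. *)
have [phi phiP] := choice (fun p => sphere_cluster (fun n => h (k n) p)).
exists k, phi; split => // p pin; have [r3 r30 sub] := dopen_dball pin.
exists r3; split => //; split => // e e0.
have [|N hN] := kc (e / 2); first lra.
exists N => n Nn q /sub; rewrite /dball /= xE => /inv [z zz ->].
have zin : csq z0 (s' / 2) z by apply: nm_csq; rewrite -/(dC _ _) dCC ltW.
have e20 : 0 < e / 2 by lra.
have [m Nm cm] := phiP (chart b z) (e / 2) N e20.
have := hN n m z Nn Nm zin; have := chordal_tri (h (k m) (chart b z)) (h (k n) (chart b z)) (phi (chart b z)).
by rewrite (chordalC (h (k m) _)) in cm *; lra.
Qed.

End Normality.

(** * Small orbits and the bound on the modulus *)

Section UniformlyPerfect.
Variable R : realType.
Local Notation C := (R[i]).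
Local Notation nm := (@Normc.normc R).
Local Notation dc := (@dC R).
Local Notation d := (@chordal R).
Local Notation S := (sphere R).

(** The image h(W) is open, and by compactness a boundary point of it is the image of a boundary
    point of W. Hence the dichotomy applies to h(W). *)
Lemma spread (h : S -> S) (W Q : set S) (k : S) (e : R) : 0 <= e -> open_map h ->
  (forall p, mcont d d h p) -> dopen W -> (forall p, adherent W p -> ~ W p -> Q p) ->
  (forall p, Q p -> d k (h p) <= e) ->
  (forall p, W p -> d k (h p) <= e) \/ (forall t, e < d k t -> exists2 p, W p & h p = t).
Proof.
move=> e0 oh ch oW bW hQ.
pose V : set S := fun t => exists2 p, W p & h p = t.
have oV : dopen V.
  move=> _ [p Wp <-]; have [r r0 rW] := oW p Wp; have [r' r'0 H] := oh p r r0.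
  by exists r' => // t /H [p' /rW Wp' <-]; exists p'.
have bV t : adherent V t -> ~ V t -> d k t <= e.
  move=> aV nV.
  have ex (n : nat) : exists p, W p /\ d t (h p) < n.+1%:R^-1.
    have n0 : 0 < n.+1%:R^-1 :> R by rewrite invr_gt0 ltr0n.
    by have [_ [p Wp <-] tp] := aV _ n0; exists p.
  have [u uP] := choice ex; have [q qP] := sphere_cluster u.
  have aq : adherent W q by move=> e1 /(qP _ 0%N) [n _ qn]; exists (u n) => //; case: (uP n).
  have hq : h q = t.
    apply: chordal_eq0; apply/eqP; rewrite eq_le chordal_ge0 andbT; apply/ler_addgt0Pr => e1 e10.
    rewrite add0r; have e20 : 0 < e1 / 2 by lra.
    have [r r0 hr] := ch q _ e20; have [n Nn qn] := qP r (Num.bound (2 / e1)) r0.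
    have := hr _ qn; have [_] := uP n; have := chordal_tri (h (u n)) (h q) t.
    have b0 : 0 <= 2 / e1 by rewrite divr_ge0 ?ltW.
    have : n.+1%:R^-1 <= e1 / 2.
      rewrite -[e1 / 2]invrK lef_pV2 ?posrE ?invr_gt0 ?ltr0n // invf_div.
      apply: (le_trans (ltW (archi_boundP b0))); rewrite ler_nat; exact: leqW.
    by move: (n.+1%:R^-1) => v; rewrite (chordalC t); lra.
  by rewrite -hq; apply/hQ/bW => // Wq; apply: nV; exists q.
have [sm|bg] := dichotomy e0 oV bV; [left => p Wp|right => t /bg //].
by apply: sm; exists p.
Qed.

Section Generators.
Variables (I : Type) (g : I -> S -> S) (M : R).
Hypothesis rat : forall i, is_rational_map (g i) /\ nonconstant (g i).
Hypothesis M0 : 0 < M.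
Hypothesis lip : forall i p q, d (g i p) (g i q) <= M * d p q.
Local Notation G := (semigroup g).

Lemma sg_lipschitz f : G f -> exists2 L, 0 < L & forall p q, d (f p) (f q) <= L * d p q.
Proof.
elim=> [i|f1 f2 _ [L1 L10 h1] _ [L2 L20 h2]]; first by exists M => // p q; exact: lip.
exists (L1 * L2); first exact: mulr_gt0.
by move=> p q; apply: (le_trans (h1 _ _)); rewrite -mulrA ler_pM2l.
Qed.

Lemma sg_cont f p : G f -> mcont d d f p.
Proof.
move=> /sg_lipschitz [L L0 h] e e0; exists (e / L); first exact: divr_gt0.
move=> q pq; apply: (le_lt_trans (h p q)).
by rewrite mulrC -ltr_pdivlMr.
Qed.

(* A small open set whose boundary stays small under the whole semigroup stays
   small itself: a generator cannot blow it up in one step, by the Lipschitz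
   bound, and images of small boundary bound sets that are small or almost everything. *)
Lemma small_orbit (W Q : set S) (k0 : S) (e : R) : 0 <= e <= 1 / 8 -> M * (2 * e) < 1 ->
  dopen W -> (forall p, adherent W p -> ~ W p -> Q p) -> Q k0 ->
  (forall f, G f -> forall p q, Q p -> Q q -> d (f p) (f q) <= e) ->
  (forall p, W p -> d k0 p <= e) ->
  forall f, G f -> forall p q, W p -> W q -> d (f p) (f q) <= 1 / 4.
Proof.
move=> /andP[e0 e8] Me oW bW Qk0 QG Wk0.
pose small (h : S -> S) := exists k, forall p, W p -> d k (h p) <= e.
have diam h p q : small h -> W p -> W q -> d (h p) (h q) <= 2 * e.
  move=> [k kP] Wp Wq; have := chordal_tri k (h p) (h q); have := kP p Wp; have := kP q Wq.
  by rewrite (chordalC (h p) k); lra.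
have gen i h : G (g i \o h) -> small h -> small (g i \o h).
  move=> Gh sh.
  have bd p : Q p -> d ((g i \o h) k0) ((g i \o h) p) <= e by move=> Qp; exact: QG.
  have [sm|bg] := spread e0 (sg_open rat Gh) (fun p => sg_cont p Gh) oW bW bd.
    by exists ((g i \o h) k0).
  exfalso; have [p [q [kp kq pq]]] := two_far_points ((g i \o h) k0).
  have [|p' Wp' pE] := bg p; first lra.
  have [|q' Wq' qE] := bg q; first lra.
  have := lip i (h p') (h q'); have := diam h p' q' sh Wp' Wq'.
  move=> h1 h2; rewrite -pE -qE /= in pq.
  have : M * d (h p') (h q') <= M * (2 * e) by rewrite ler_pM2l.
  by lra.
(* Strengthened to compositions, so that an induction on f adds the letters one at a time on the
   outside, where the Lipschitz bound of a single generator applies. *)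
suff H f : G f -> small f /\ forall h, G h -> small h -> small (f \o h).
  by move=> f /H [sf _] p q Wp Wq; have := diam f p q sf Wp Wq; lra.
elim=> [i|f1 f2 G1 [s1 IH1] G2 [s2 IH2]]; split.
- by apply: (gen i id); [exact: (sg_gen g i)|exists k0].
- by move=> h Gh sh; apply: gen => //; apply: sg_comp => //; exact: sg_gen.
- exact: IH1.
- by move=> h Gh sh; apply: (IH1 (f2 \o h)); [exact: sg_comp|exact: IH2].
Qed.

End Generators.

(** An infimum only provides admissible constants below |B| + 1; the factor 2 is the price of
    passing from sigma to the chordal distance. *)
Lemma Lip_chordal (f : S -> S) (B : R) : (Lip f <= B%:E)%E ->
  forall p q, d (f p) (f q) <= 2 * (`|B| + 1) * d p q.
Proof.
move=> fB p q.
have : (Lip f < (`|B| + 1)%:E)%E.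
  by apply: (le_lt_trans fB); rewrite lte_fin; have := ler_norm B; lra.
move=> /ereal_inf_lt [_ [m mP <-]]; rewrite lte_fin => mB.
apply: (le_trans (chordal_le_sigma _ _)); apply: (le_trans (mP p q)).
apply: (@le_trans _ _ ((`|B| + 1) * sigma p q)); first by rewrite ler_wpM2r ?sigma_ge0 // ltW.
have B0 : 0 <= `|B| + 1 by have := normr_ge0 B; lra.
by rewrite (mulrC 2) -mulrA ler_wpM2l // sigma_le_chordal.
Qed.

(** For finite modulus the logarithmic width exceeds 2 pi H >= 4 H, which leaves a margin for
    shrinking both radii strictly; for infinite modulus any width is available. *)
Lemma modulus_wide (r1 : R) (r2 : \bar R) (H : R) : 0 < H -> 0 <= r1 -> (r1%:E < r2)%E ->
  (H%:E < modulus r1 r2)%E ->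
  exists l1 l2, [/\ r1 < expR l1, ((expR l2)%:E < r2)%E & 2 * H < l2 - l1].
Proof.
move=> H0 r10 r12; rewrite /modulus.
have [r1E _|r1n] := eqVneq r1 0.
  have [u uP] : exists u, ((expR u)%:E < r2)%E.
    case: r2 r12 => [b| |] //; last by exists 0; rewrite ltry.
    rewrite lte_fin r1E => b0; exists (ln (b / 2)); rewrite lnK ?posrE ?lte_fin; lra.
  by exists (u - 2 * H - 1), u; split => //; rewrite ?r1E ?expR_gt0 //; lra.
have r1p : 0 < r1 by rewrite lt0r r1n.
case: r2 r12 => [b| |] //=; last first.
  move=> _ _; exists (ln r1 + 1), (ln r1 + 2 * H + 2); split; rewrite ?ltry //; last lra.
  by rewrite -[X in X < _](lnK (x := r1)) ?posrE // ltr_expR; lra.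
rewrite !lte_fin => r1b; have b0 : 0 < b by lra.
have p0 : 0 < 2 * pi :> R by have := @pi_ge2 R; lra.
rewrite ltr_pdivlMr // ln_div ?posrE // => hH.
have : H * 4 <= H * (2 * pi) by rewrite ler_pM2l //; have := @pi_ge2 R; lra.
move=> h4; pose t := (ln b - ln r1 - 2 * H) / 4.
exists (ln r1 + t), (ln b - t); split; last by rewrite /t; lra.
  by rewrite -[X in X < _](lnK (x := r1)) ?posrE // ltr_expR /t; lra.
by rewrite lte_fin -[X in _ < X](lnK (x := b)) ?posrE // ltr_expR /t; lra.
Qed.

End UniformlyPerfect.

Theorem theorem3p1 (R : realType) (I : Type) (g : I -> sphere R -> sphere R) :
  (forall i, is_rational_map (g i) /\ nonconstant (g i)) ->
  non_elementary (semigroup g) ->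
  (exists C : R, forall i, (Lip (g i) <= C%:E)%E) ->
  uniformly_perfect (julia (semigroup g)).
Proof.
move=> rat [a [b [c [Ja [Jb [Jc [ab [bc ac]]]]]]]] [B lipB].
split; first by apply: scompact_closed; rewrite /julia setCK; exact: dopen_fatou.
split; first by exists a, b.
pose M : R := 2 * (`|B| + 1).
have M2 : 2 <= M by rewrite /M; have := normr_ge0 B; lra.
have M0 : 0 < M by lra.
have lip i p q : chordal (g i p) (g i q) <= M * chordal p q by exact: Lip_chordal.
have [K K0 core] := core_estimate ab bc ac.
(* The common size of all core images: with M >= 2 it is at most 1/8, and a generator applied to a
   set of diameter 2 e cannot produce points at distance 1. *)
pose e : R := 1 / (8 * M).
have e0 : 0 < e by rewrite divr_gt0 // mulr_gt0.
have Me : M * (8 * e) = 1 by rewrite /e; field; rewrite gt_eqF.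
have e8 : e <= 1 / 8.
  by rewrite /e ler_pdivrMr ?mulr_gt0 //; lra.
have Me1 : M * (2 * e) < 1 by lra.
(* 4 is required by the estimate on the core circle, and K / e brings that estimate below e. *)
pose H := Num.max 4 (K / e).
have H4 : 4 <= H by rewrite le_max lexx.
have KH : K / H <= e.
  rewrite ler_pdivrMr; last by lra.
  by rewrite mulrC -ler_pdivrMr // le_max lexx orbT.
exists H => A r1 r2 [/sopenP oA [r10 [r12 [phi [hphi [injphi imphi]]]]]] AJ [_ [x [y [Jx [Jy nxy]]]]].
rewrite leNgt; apply/negP => big.
have H0 : 0 < H by lra.
have [l1 [l2 [r1l l2r l12]]] := modulus_wide H0 r10 r12 big.
have inj p q : A p -> A q -> phi p = phi q -> p = q.
  by move=> Ap Aq; apply: injphi; rewrite inE.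
have phiA p : A p -> round_annulus r1 r2 (phi p) by move=> Ap; rewrite -imphi; exists p.
have ex w : exists p, round_annulus r1 r2 w -> A p /\ phi p = w.
  have [win|nw] := pselect (round_annulus r1 r2 w); last by exists a.
  by move: (win); rewrite -imphi => -[p Ap pw]; exists p.
have [psi psiP] := choice ex.
have phiP p : A p -> round_annulus r1 r2 (phi p) /\ psi (phi p) = p.
  by move=> Ap; split; [exact: phiA|have [A' E] := psiP _ (phiA p Ap); exact: inj].
have hpsi w : round_annulus r1 r2 w -> shol psi w.
  by move=> /psiP [Apsi E]; apply: (holo_inverse oA hphi inj) => // p /phiP [].
(* The core is the middle circle on the logarithmic scale, and the half width H' exceeds H. *)
pose s0 := (l1 + l2) / 2; pose H' := (l2 - l1) / 2.
have HH' : H < H' by rewrite /H'; lra.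
have ann w : w != 0 -> `|ln (Normc.normc w) - s0| < H' -> round_annulus r1 r2 w.
  move=> w0; rewrite ltr_norml => hw; have w0' : 0 < Normc.normc w by rewrite nm_gt0.
  have E : Normc.normc w = expR (ln (Normc.normc w)) by rewrite lnK.
  rewrite /s0 /H' in hw; rewrite /round_annulus /= E; split.
    by apply: (lt_trans r1l); rewrite ltr_expR; lra.
  by apply: lt_trans l2r; rewrite lte_fin ltr_expR; lra.
have rho1 : r1 < expR s0 by apply: (lt_trans r1l); rewrite ltr_expR /s0; lra.
have rho2 : ((expR s0)%:E < r2)%E by apply: lt_trans l2r; rewrite lte_fin ltr_expR /s0; lra.
pose Q : set (sphere R) := fun p => A p /\ Normc.normc (phi p) = expR s0.
have AN p : A p -> fatou (semigroup g) p by move=> /AJ; rewrite /julia setCK.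
(* The identity need not belong to the semigroup, but the core itself must be small too, for the
   dichotomy of its two sides. *)
have est f : f = id \/ semigroup g f -> forall p q, Q p -> Q q -> chordal (f p) (f q) <= e.
  move=> Gf p q [Ap np] [Aq nq].
  have avoid w : w != 0 -> `|ln (Normc.normc w) - s0| < H' ->
      [/\ shol (fun w => f (psi w)) w, f (psi w) <> a, f (psi w) <> b & f (psi w) <> c].
    move=> w0 /(ann w w0) win; have [Aw _] := psiP w win.
    have Nf : fatou (semigroup g) (f (psi w)).
      by case: Gf => [->|Gf]; [exact: AN|apply: fatou_forward => //; exact: AN].
    split; [|by move=> E; apply: Ja; rewrite -E|by move=> E; apply: Jb; rewrite -E|
      by move=> E; apply: Jc; rewrite -E].
    by case: Gf => [->|Gf]; [exact: hpsi|apply: sg_shol => //; exact: hpsi].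
  have [_ <-] := phiP p Ap; have [_ <-] := phiP q Aq.
  exact: le_trans (core _ s0 H H' H4 HH' avoid _ _ np nq) KH.
have [U [V [oU oV Ux Vy [dUV cov]]]] := core_separates oA r10 psiP phiP
  (fun w win => shol_cont (hpsi w win)) (fun p Ap => holo_cont oA hphi Ap) rho1 rho2
  (fun Ax => Jx (AN x Ax)) (fun Ay => Jy (AN y Ay)) nxy.
have bU p : adherent U p -> ~ U p -> Q p.
  move=> aU nU; case: (cov p) => // Vp; have [r r0 rV] := oV p Vp.
  by have [q Uq pq] := aU r r0; case: (dUV q Uq (rV q pq)).
have bV p : adherent V p -> ~ V p -> Q p.
  move=> aV nV; case: (cov p) => // Up; have [r r0 rU] := oU p Up.
  by have [q Vq pq] := aV r r0; case: (dUV q (rU q pq) Vq).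
pose k0 := psi ((expR s0)%:C)%C.
have Qk0 : Q k0.
  have nE : Normc.normc ((expR s0)%:C)%C = expR s0 by rewrite nm_real gtr0_norm ?expR_gt0.
  have [|Ak E] := psiP ((expR s0)%:C)%C; first by split; rewrite nE.
  by split=> //; rewrite E nE.
have concl W z : dopen W -> (forall p, adherent W p -> ~ W p -> Q p) ->
    (forall p, W p -> chordal k0 p <= e) -> W z -> fatou (semigroup g) z.
  move=> oW bW sW Wz; apply: (equi_normal oW Wz).
    by move=> f h w; exact: sg_shol.
  move=> f p q Gf; apply: (small_orbit rat M0 lip _ Me1 oW bW Qk0 _ sW Gf).
    by rewrite ltW.
  by move=> f' Gf'; apply: est; right.
have Qe p : Q p -> chordal k0 p <= e by move=> Qp; apply: (est id) => //; left.
have e0' := ltW e0.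
have [sU|gU] := dichotomy e0' oU (fun p aU nU => Qe p (bU p aU nU)).
  exact: Jx (concl U x oU bU sU Ux).
have [sV|gV] := dichotomy e0' oV (fun p aV nV => Qe p (bV p aV nV)).
  exact: Jy (concl V y oV bV sV Vy).
(* If both sides were large, a point far from the core would lie in both, although they are
   disjoint. *)
have [p [_ [kp _ _]]] := two_far_points k0.
by apply: (dUV p); [apply: gU|apply: gV]; lra.
Qed.
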